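(* Let $(M,g)$ be a Riemannian manifold of dimension $n\ge2$. For each point $p\in M$ there exists $\delta_p>0$ such that $(B(p,\delta_p)\setminus\{p\},g)$ is expanding throughout the radial polar geodesic vector field centered at $p$, where $B(p,\delta_p)$ denotes the open geodesic ball of radius $\delta_p$ centered at $p$.
   Context: For $\delta>0$ small enough, $\exp_p$ restricts to a diffeomorphism from the ball of radius $\delta$ in $T_pM$ onto $B(p,\delta)$, and by geodesic polar coordinates $(r,v)\mapsto\exp_p(rv)$, with $v$ in the unit sphere $\mathbb S^{n-1}\subset T_pM$, $(B(p,\delta)\setminus\{p\},g)$ is isometric to $((0,\delta)\times\mathbb S^{n-1},\,dr^2+h_r)$ for a smooth one-parameter family of Riemannian metrics $h_r$ on $\mathbb S^{n-1}$; $\partial_r$ is the radial polar geodesic vector field centered at $p$. A Riemannian manifold of the form $(I\times F,\beta\,dt^2+g_t)$, with $I\subseteq\mathbb R$ an open interval, $(g_t)_{t\in I}$ a smooth family of Riemannian metrics on $F$ and $\beta>0$ smooth, is expanding throughout $\partial_t$ if $\partial_t\beta\ge0$ and $(\partial_tg_t)(X,X)>0$ for every $t\in I$ and every nonzero vector $X$ tangent to $F$. Here this is applied with $t=r$, $I=(0,\delta_p)$, $F=\mathbb S^{n-1}$, $\beta=1$, $g_t=h_r$, and $\delta_p$ is such that these polar coordinates are defined on $B(p,\delta_p)\setminus\{p\}$. *)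

(* Defs.v *)
(* MathComp-Analysis, over an arbitrary R : realType. *)
From HB Require Import structures.
From mathcomp Require Export all_boot all_order all_algebra.
From mathcomp Require Export all_classical all_reals all_analysis.
Export Order.TTheory GRing.Theory Num.Theory.
Export numFieldNormedType.Exports.

Set Implicit Arguments.
Unset Strict Implicit.
Unset Printing Implicit Defensive.

Local Open Scope classical_set_scope.
Local Open Scope ring_scope.

(* The predicates below are meant for open U and finite-dimensional V, where
   existence and continuity of all iterated directional derivatives is the
   usual notion of C^k, resp. C^oo, map. *)
Fixpoint Ck_on (R : realType) (V W : normedModType R) (k : nat) (U : set V)
    (f : V -> W) : Prop :=
  (forall x, U x -> {for x, continuous f}) /\
  if k is k'.+1 then
    forall v, (forall x, U x -> derivable f x v) /\ Ck_on k' U ('D_v f)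
  else True.

Definition smooth_on (R : realType) (V W : normedModType R) (U : set V)
    (f : V -> W) : Prop := forall k, Ck_on k U f.

(* Smooth functions on an arbitrary subset D are those that extend smoothly
   around each point of D. *)
Definition smooth_along (R : realType) (V W : normedModType R) (D : set V)
    (f : V -> W) : Prop :=
  forall z, D z -> exists (O : set V) (f' : V -> W),
    [/\ open O, O z, smooth_on O f' & forall w, O w -> D w -> f w = f' w].

(* A smooth atlas need not be maximal. The tangent space at p is modelled on
   'rV[R]_n through the distinguished chart [chart_at p]. The functions
   [chart i] and [chart_inv i] are total, but only meaningful on
   [chart_dom i] and on its image. *)
Record smooth_manifold (R : realType) (n : nat) := SmoothManifold {
  point_of :> topologicalType;
  chart_index : Type;
  chart_dom : chart_index -> set point_of;
  chart : chart_index -> point_of -> 'rV[R]_n;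
  chart_inv : chart_index -> 'rV[R]_n -> point_of;
  chart_at : point_of -> chart_index;
  manifold_hausdorff : hausdorff_space point_of;
  manifold_second_countable : @second_countable point_of;
  chart_dom_open : forall i, open (chart_dom i);
  chart_im_open : forall i, open (chart i @` chart_dom i);
  chartK : forall i q, chart_dom i q -> chart_inv i (chart i q) = q;
  chart_continuous : forall i q, chart_dom i q ->
    {for q, continuous (chart i)};
  chart_inv_continuous : forall i x, (chart i @` chart_dom i) x ->
    {for x, continuous (chart_inv i)};
  chart_transition_smooth : forall i j,
    smooth_on (chart i @` (chart_dom i `&` chart_dom j))
      (chart j \o chart_inv i);
  chart_at_mem : forall p, chart_dom (chart_at p) p
}.
Arguments chart_dom {R n} M i : rename.
Arguments chart {R n} M i q : rename.
Arguments chart_inv {R n} M i x : rename.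
Arguments chart_at {R n} M p : rename.

Section Manifold.
Context {R : realType} {n : nat} (M : smooth_manifold R n).

Definition tangent (p : M) := 'rV[R]_n.

Definition smooth_to (V : normedModType R) (U : set V) (F : V -> M) : Prop :=
  (forall x, U x -> {for x, continuous F}) /\
  forall i, smooth_on (U `&` F @^-1` chart_dom M i) (chart M i \o F).

Definition smooth_from (W : normedModType R) (B : set M) (G : M -> W) : Prop :=
  forall i, smooth_on (chart M i @` (B `&` chart_dom M i))
    (G \o chart_inv M i).

Definition diff_to (V : normedModType R) (F : V -> M) (x u : V) :
    tangent (F x) := 'D_u (chart M (chart_at M (F x)) \o F) x.

Definition velocity (c : R -> M) (t : R) : tangent (c t) :=
  derive1 (chart M (chart_at M (c t)) \o c) t.

Definition diffeo_onto (V : normedModType R) (U : set V) (F : V -> M)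
    (B : set M) : Prop :=
  smooth_to U F /\
  exists G : M -> V,
    [/\ smooth_from B G,
        forall x, U x -> B (F x) /\ G (F x) = x &
        forall q, B q -> U (G q) /\ F (G q) = q].

Definition form (m : nat) (A : 'M[R]_m) (u v : 'rV[R]_m) : R :=
  (u *m A *m v^T) 0 0.

(* (F^* g)_x, for g_p the bilinear form on the tangent space at p with Gram
   matrix [gram p]. *)
Definition pullback_form (gram : M -> 'M[R]_n) (V : normedModType R)
    (F : V -> M) (x u v : V) : R :=
  form (gram (F x)) (diff_to F x u) (diff_to F x v).

Definition coord_gram (gram : M -> 'M[R]_n) (i : chart_index M)
    (x : 'rV[R]_n) : 'M[R]_n :=
  \matrix_(a < n, b < n)
    pullback_form gram (chart_inv M i) x (delta_mx 0 a) (delta_mx 0 b).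

Record riemannian_metric := RiemannianMetric {
  gram :> M -> 'M[R]_n;
  gram_sym : forall p, (gram p)^T = gram p;
  gram_pos : forall p (u : tangent p), u != 0 -> 0 < form (gram p) u u;
  gram_smooth : forall i,
    smooth_on (chart M i @` chart_dom M i) (coord_gram gram i)
}.

End Manifold.

Section Riemannian.
Context {R : realType} {n : nat} {M : smooth_manifold R n}.
Variable g : riemannian_metric M.

Definition inner (p : M) (u v : tangent p) : R := form (g p) u v.

Arguments inner : clear implicits.

Definition gnorm (p : M) (u : tangent p) : R := Num.sqrt (inner p u u).
Arguments gnorm : clear implicits.

Definition christoffel (i : chart_index M) (k a b : 'I_n) (x : 'rV[R]_n) : R :=
  let G := coord_gram g i in
  let d (l : 'I_n) (f : 'rV[R]_n -> R^o) := 'D_(delta_mx 0 l) f x in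
  2^-1 * \sum_(l < n) invmx (G x) k l *
    (d a (fun y => G y b l) + d b (fun y => G y a l) - d l (fun y => G y a b)).

Definition geodesic_on (J : set R) (c : R -> M) : Prop :=
  smooth_to (J : set R^o) c /\
  forall (i : chart_index M) (t : R), J t -> chart_dom M i (c t) ->
    let x : R -> 'rV[R]_n := chart M i \o c in
    forall k : 'I_n,
      (derive1n 2 x t) 0 k +
      \sum_(a < n) \sum_(b < n)
        christoffel i k a b (x t) * (derive1 x t) 0 a * (derive1 x t) 0 b = 0.

Definition exp_rel (p : M) (v : tangent p) (q : M) : Prop :=
  exists (e : R) (c : R -> M),
    [/\ 0 < e, geodesic_on `]- e, 1 + e[ c, c 0 = p,
        derive1 (chart M (chart_at M p) \o c) 0 = v & c 1 = q].
Arguments exp_rel : clear implicits.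

(* Total: the value is p for v outside the domain of the exponential map. *)
Definition exp_map (p : M) (v : tangent p) : M := xget p (exp_rel p v).
Arguments exp_map : clear implicits.

Definition piecewise_smooth (c : R -> M) : Prop :=
  exists (N : nat) (t : nat -> R),
    [/\ t 0%N = 0, t N = 1, forall k, (k < N)%N -> t k < t k.+1 &
      forall k, (k < N)%N -> exists (O : set R^o) (c' : R^o -> M),
        [/\ open O, `[t k, t k.+1] `<=` O, smooth_to O c' &
            forall s, s \in `[t k, t k.+1] -> c s = c' s]].

Definition curve_length (c : R -> M) : \bar R :=
  (\int[lebesgue_measure]_(t in `[0%R, 1%R]) (gnorm (c t) (velocity c t))%:E)%E.

(* +oo when p and q lie in different connected components *)
Definition riemannian_dist (p q : M) : \bar R :=
  ereal_inf [set curve_length c | c in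
    [set c | [/\ piecewise_smooth c, c 0 = p & c 1 = q]]].

Definition geodesic_ball (p : M) (d : R) : set M :=
  [set q | (riemannian_dist p q < d%:E)%E].

Definition tangent_ball (p : M) (d : R) : set (tangent p) :=
  [set v | gnorm p v < d].

Definition unit_sphere (p : M) : set (tangent p) := [set v | gnorm p v = 1].

End Riemannian.
Arguments inner {R n M} g p u v.
Arguments gnorm {R n M} g p u.
Arguments exp_rel {R n M} g p v q.
Arguments exp_map {R n M} g p v.
Arguments tangent_ball {R n M} g p d _.
Arguments unit_sphere {R n M} g p _.

(* Product manifolds I x F are handled for I an open interval and F a
   submanifold of a vector space 'rV[R]_m. *)
Section Product.
Context {R : realType} {m : nat}.
Implicit Types (I : set R) (F : set 'rV[R]_m).

Definition tangent_to F (v X : 'rV[R]_m) : Prop :=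
  exists (e : R) (c : R^o -> 'rV[R]_m),
    [/\ 0 < e, smooth_on (`]- e, e[ : set R^o) c,
        forall t : R, t \in `]- e, e[ -> F (c t), c 0 = v &
        derive1 (c : R -> 'rV[R]_m) 0 = X].

Definition prod_set I F : set (R^o * 'rV[R]_m)%type :=
  [set z | I z.1 /\ F z.2].

(* h t v X Y stands for (g_t)_v(X, Y), meaningful for X, Y tangent to F at v. *)
Definition smooth_metric_family I F
    (h : R -> 'rV[R]_m -> 'rV[R]_m -> 'rV[R]_m -> R) : Prop :=
  [/\ exists A : R^o * 'rV[R]_m -> 'M[R]_m, smooth_along (prod_set I F) A /\
        forall t v X Y, I t -> F v -> tangent_to F v X -> tangent_to F v Y ->
          h t v X Y = form (A (t, v)) X Y,
      forall t v X Y, I t -> F v -> tangent_to F v X -> tangent_to F v Y ->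
        h t v X Y = h t v Y X &
      forall t v X, I t -> F v -> tangent_to F v X -> X != 0 ->
        0 < h t v X X].

(* The smoothness and positivity conditions say that beta dt^2 + h is a metric
   of the required form on I x F. *)
Definition expanding_throughout_dt I F (beta : R -> 'rV[R]_m -> R)
    (h : R -> 'rV[R]_m -> 'rV[R]_m -> 'rV[R]_m -> R) : Prop :=
  [/\ smooth_along (prod_set I F) (fun z => beta z.1 z.2 : R^o) /\
        (forall t v, I t -> F v -> 0 < beta t v),
      smooth_metric_family I F h,
      forall t v, I t -> F v -> 0 <= derive1 (fun s => beta s v : R^o) t &
      forall t v X, I t -> F v -> tangent_to F v X -> X != 0 ->
        0 < derive1 (fun s => h s v X X : R^o) t].

(* P is (the ambient extension of) an isometry from (I x F, beta dt^2 + h_t)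
   onto (B, g). *)
Definition isometry_onto (n : nat) (M : smooth_manifold R n)
    (g : riemannian_metric M) I F (beta : R -> 'rV[R]_m -> R)
    (h : R -> 'rV[R]_m -> 'rV[R]_m -> 'rV[R]_m -> R)
    (P : R^o * 'rV[R]_m -> M) (B : set M) : Prop :=
  [/\ exists O, [/\ open O, prod_set I F `<=` O & smooth_to O P],
      exists Q : M -> R^o * 'rV[R]_m,
        [/\ smooth_from B Q,
            forall z, prod_set I F z -> B (P z) /\ Q (P z) = z &
            forall q, B q -> prod_set I F (Q q) /\ P (Q q) = q] &
      forall (t : R) v (a b : R) X Y, I t -> F v ->
        tangent_to F v X -> tangent_to F v Y ->
        pullback_form g P (t, v) (a, X) (b, Y) =
          beta t v * a * b + h t v X Y].

End Product.

Definition polar (R : realType) (n : nat) (M : smooth_manifold R n)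
    (g : riemannian_metric M) (p : M) (z : R^o * tangent p) : M :=
  exp_map g p (z.1 *: z.2).
Arguments polar {R n M} g p z.

Definition expanding_throughout_radial (R : realType) (n : nat)
    (M : smooth_manifold R n) (g : riemannian_metric M) (p : M) (d : R) :
    Prop :=
  [/\ forall v, tangent_ball g p d v -> exp_rel g p v (exp_map g p v),
      diffeo_onto (tangent_ball g p d) (exp_map g p) (geodesic_ball g p d) &
      exists h : R -> tangent p -> tangent p -> tangent p -> R,
        isometry_onto g `]0, d[ (unit_sphere g p) (fun _ _ => 1) h
          (polar g p) (geodesic_ball g p d `\ p) /\
        expanding_throughout_dt `]0, d[ (unit_sphere g p) (fun _ _ => 1) h].

(* Main.v *)
(* Near the constant solution at p the geodesic flow is smooth up to time 2, since differentiating a flow in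
   its initial condition gives the flow of the tangent field. Homogeneity of the geodesic spray then yields a
   smooth E with derivative the identity at 0 such that t |-> E (t v) is the geodesic of velocity v, and near 0
   the contraction principle makes E a diffeomorphism; this is exp_p in the chart at p. Let H be the pullback
   of g by exp_p. The Euler-Lagrange equation along rays, tested against constant vectors, is the Gauss lemma
   H_w(w, u) = g_p(w, u). Combined with the Cauchy-Schwarz inequality it bounds the growth of the radial
   distance along a curve by its speed, so that curves of length less than d starting at p stay in the
   compact exp-images of smaller balls, and geodesic balls are the exp-images of tangent balls.
   In polar coordinates the metric is dt^2 + h_t with h_t(X, X) = t^2 H_{tv}(X, X), and
     d/dt h_t(X, X) = t (2 H_w(X, X) + (D_w H)_w(X, X)),   w = t v,
   where the bracket is positive definite near w = 0, because it tends to 2 g_p. *)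

From HB Require Import structures.
Require Import Defs.
From mathcomp Require Import ring lra.

Set Implicit Arguments.
Unset Strict Implicit.
Unset Printing Implicit Defensive.

Local Open Scope classical_set_scope.
Local Open Scope ring_scope.

(** * Derivatives and C^k maps *)

(** Smoothness by iterated directional derivatives carries no differential. [C1_strict_expansion]
    supplies one: near a point the increments of a C^1 map are those of a fixed linear map up to a
    small Lipschitz error. The chain rule, the derivative of the flow and the local inversion are
    all read off from it. Regularity of the flow is proved in the initial condition only; regularity
    of geodesics in time follows because [E (t *: v)] is the smooth map [E] composed with a linear
    one. Geodesics must solve their equation in every chart, and tangent vectors are read in a chart
    that may jump with the point. Christoffel symbols are therefore traded for the Euler-Lagrange
    expression of the energy, whose naturality under pullback gives both the passage between charts
    and the equation of rays in normal coordinates. The exponential map is a choice among endpoints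
    of all geodesics, even of those that might leave the chart, so identifying it takes a uniqueness
    theorem on the Hausdorff space [M]. Two norms coexist: the sup norm of coordinates for
    estimates, and [gnorm g p] for balls. *)

(** The supremum of the initial segments on which [P] holds is reached by the closing hypothesis and
    cannot lie below [b] by the opening one. This continuation principle yields the comparison of
    norms, the uniqueness of geodesics and the confinement of short curves. *)
Lemma real_induction (R : realType) (a b : R) (P : R -> Prop) :
  P a ->
  (forall t, a <= t < b -> (forall s, a <= s <= t -> P s) ->
     exists2 e, 0 < e & forall s, t < s < t + e -> s <= b -> P s) ->
  (forall t, a < t <= b -> (forall s, a <= s < t -> P s) -> P t) ->
  forall t, a <= t <= b -> P t.
Proof.
move=> Pa Pr Pl t0 /andP[at0 t0b].
have ab := le_trans at0 t0b.
pose S := [set t | a <= t <= b /\ forall s, a <= s <= t -> P s].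
have Sa : S a.
  by split; [rewrite lexx|move=> s sa; have -> : s = a by apply: le_anti; rewrite andbC].
have hS : has_sup S by split; [exists a|exists b => t [/andP[]]].
pose m := sup S.
have am : a <= m by exact: ub_le_sup hS.2 _ Sa.
have mb : m <= b by apply: ge_sup; [exists a|move=> t [/andP[]]].
have Pm' s : a <= s < m -> P s.
  move=> /andP[as_ sm]; have [t [/andP[_ _] Pt]] := sup_adherent (eps := m - s) ltac:(lra) hS.
  by rewrite -/m => mt; apply: Pt; apply/andP; split => //; lra.
have Pm : P m.
  have [->//|am'] := eqVneq m a.
  by apply: Pl => //; rewrite mb andbT lt_neqAle eq_sym am' am.
have Pms s : a <= s <= m -> P s.
  by move=> /andP[as_]; rewrite le_eqVlt => /predU1P[->//|sm]; apply: Pm'; rewrite as_.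
have [mb'|bm] := ltP m b; last by apply: Pms; rewrite at0 (le_trans t0b).
have [e e0 Pe] := Pr m ltac:(by rewrite am mb') Pms.
pose t := Num.min b (m + e / 2).
have mt : m < t by rewrite lt_min mb'/=; lra.
have St : S t.
  split; first by rewrite (le_trans am (ltW mt))/= ge_min lexx.
  move=> s /andP[as_ st]; have [sm|ms] := leP s m; first by apply: Pms; rewrite as_.
  move: st; rewrite /t le_min => /andP[sb sme].
  by apply: Pe => //; apply/andP; split => //; lra.
by have := ub_le_sup hS.2 St; rewrite -/m leNgt mt.
Qed.

Section IsDerive.
Context {R : realType} {V W : normedModType R}.
Implicit Types (f : V -> W) (x v : V).

Lemma is_derive_cvg f x v df : is_derive x v f df <->
  (h^-1 *: (f (x + h *: v) - f x)) @[h --> (0 : R)^'] --> df.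
Proof.
have E : (fun h : R => h^-1 *: (f (x + h *: v) - f x)) =
    (fun h => h^-1 *: ((f \o shift x) (h *: v) - f x)).
  by apply/funext => h /=; rewrite [h *: v + x]addrC.
rewrite E; split; first by move=> [fd <-].
by move=> fd; split; [apply/cvg_ex; exists df|exact: cvg_lim].
Qed.

(** Multiplying the difference quotient by [h] removes the puncture at 0, where both sides vanish,
    so the estimate holds on a full neighbourhood. *)
Lemma is_deriveP f x v df : is_derive x v f df <->
  forall e, 0 < e -> \forall h \near (0 : R),
    `|f (x + h *: v) - f x - h *: df| <= e * `|h|.
Proof.
rewrite is_derive_cvg; split => [/cvgrPdist_le fd e e0|fd].
  have := fd e e0; rewrite near_withinE; apply: filterS => h.
  have [->|h0 /(_ isT)] := eqVneq h 0.
    by move=> _; rewrite !scale0r addr0 !subrr !normr0 mulr0.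
  rewrite -normrN opprB => fh.
  rewrite -[X in X - h *: df](scalerKV h0) -scalerBr normrZ mulrC.
  by rewrite ler_wpM2r// -normrN.
apply/cvgrPdist_le => e e0; rewrite near_withinE.
have := fd e e0; apply: filterS => h fh h0.
rewrite -normrN opprB -[df in X in X <= _](scalerK h0) -scalerBr normrZ normfV.
by rewrite ler_pdivrMl ?normr_gt0// mulrC.
Qed.

(** Continuity along the line directed by [v] is all that one directional derivative gives; the
    chain rules below use no more from the inner function. *)
Lemma is_derive_cvg0 f x v df : is_derive x v f df ->
  f (x + h *: v) @[h --> (0 : R)] --> f x.
Proof.
move=> /is_deriveP/(_ 1 ltr01) fd; apply/cvgrPdist_le => e e0.
pose d := e / (`|df| + 1).
have d0 : 0 < d by rewrite divr_gt0// ltr_wpDl.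
near=> h.
have : `|f (x + h *: v) - f x - h *: df| <= 1 * `|h| by near: h.
have hd : `|h| <= d by near: h; exact: (@nbhs0_le _ R).
rewrite mul1r => fh; rewrite distrC -(subrK (h *: df) (f _ - f x)).
apply: (le_trans (ler_normD _ _)); rewrite normrZ.
apply: (@le_trans _ _ (`|h| * (`|df| + 1))); first by lra.
by rewrite -ler_pdivlMr// ltr_wpDl.
Unshelve. all: by end_near. Qed.

Lemma is_derive_unique f x v d1 d2 :
  is_derive x v f d1 -> is_derive x v f d2 -> d1 = d2.
Proof. by move=> [_ <-] [_ <-]. Qed.

Lemma is_derive_exact f x v df :
  (forall h, f (x + h *: v) = f x + h *: df) -> is_derive x v f df.
Proof.
move=> fE; apply/is_deriveP => e e0; near=> h.
by rewrite fE [f x + _]addrC addrK subrr normr0 mulr_ge0// ltW.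
Unshelve. all: by end_near. Qed.

End IsDerive.

Lemma is_derive_line (R : realType) (V W : normedModType R) (f : V -> W) x v (s : R) df : is_derive (x + s *: v) v f df ->
  is_derive s 1 (fun s => f (x + s *: v)) df.
Proof.
move=> /is_deriveP fd.
have E h : s + h *: (1 : R) = s + h by rewrite /GRing.scale/= mulr1.
apply: (proj2 (is_deriveP _ _ _ _)) => e /fd; apply: filterS => h.
by rewrite E scalerDl addrA.
Qed.

Lemma is_deriveZf (R : realType) (V W : normedModType R) (a : V -> R)
    (f : V -> W) x v da df :
  is_derive x v a da -> is_derive x v f df ->
  is_derive x v (fun y => a y *: f y) (a x *: df + da *: f x).
Proof.
move=> ad fd; apply/is_derive_cvg.
have E : (fun h : R => h^-1 *: (a (x + h *: v) *: f (x + h *: v) - a x *: f x))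
   = (fun h => a x *: (h^-1 *: (f (x + h *: v) - f x)) +
     (h^-1 * (a (x + h *: v) - a x)) *: f (x + h *: v)).
  apply/funext => h; rewrite scalerA mulrC -!scalerA -scalerDr; congr (_ *: _).
  by rewrite scalerBr scalerBl [RHS]addrC addrA subrK.
rewrite E; apply: cvgD.
  by apply: cvgZr; move/is_derive_cvg : fd.
apply: cvgZ; first by move/is_derive_cvg : ad.
by apply: cvg_within_filter; exact: is_derive_cvg0 fd.
Qed.

Section Comparison.
Context {R : realType} {V : normedModType R}.

(* The largest interval on which the bound holds is closed by continuity, and open on the
   right because the bounding function grows strictly faster. *)
Lemma norm_le_comparison (u u' : R -> V) (w w' : R -> R) (a b : R) :
  (forall t, a <= t <= b -> is_derive t 1 u (u' t)) ->
  (forall t, a <= t <= b -> is_derive t 1 w (w' t)) ->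
  `|u a| <= w a ->
  (forall t, a <= t < b -> `|u t| <= w t -> `|u' t| < w' t) ->
  forall t, a <= t <= b -> `|u t| <= w t.
Proof.
move=> du dw ua uw.
apply: real_induction => //.
- move=> t /andP[at_ tb] us.
  have tt : a <= t <= t by rewrite at_ lexx.
  have atb : a <= t <= b by rewrite at_ ltW.
  have utw := uw t ltac:(by rewrite at_ tb) (us t tt).
  (* Half of the gap between the speeds: [u] and [w] may each deviate by [e * (s - t)] from their
     tangents, and the two deviations together use up exactly the gap. *)
  pose e := (w' t - `|u' t|) / 2.
  have e0 : 0 < e by rewrite /e; lra.
  have := (is_deriveP _ _ _ _).1 (du t atb) e e0.
  move=> [r1 /= r10 hu].
  have := (is_deriveP _ _ _ _).1 (dw t atb) e e0.
  move=> [r2 /= r20 hw].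
  exists (Num.min r1 r2); first by rewrite lt_min r10 r20.
  move=> s /andP[ts]; rewrite -ltrBlDl lt_min => /andP[sr1 sr2] sb.
  have st0 : 0 < s - t by lra.
  have E : t + (s - t) *: (1 : R) = s by rewrite /GRing.scale/= mulr1 addrC subrK.
  have := hu (s - t); rewrite /ball_ /= sub0r normrN gtr0_norm// E => /(_ sr1) us1.
  have := hw (s - t); rewrite /ball_ /= sub0r normrN gtr0_norm// E => /(_ sr2).
  rewrite ler_norml => /andP[ws1 _].
  rewrite -(subrK (u t) (u s)) -(subrK ((s - t) *: u' t) (u s - u t)).
  apply: (le_trans (ler_normD _ _)).
  apply: (@le_trans _ _ (e * (s - t) + (s - t) * `|u' t| + w t)).
    apply: lerD; last exact: us.
    by apply: (le_trans (ler_normD _ _)); rewrite normrZ gtr0_norm// lerD.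
  move: ws1; rewrite /GRing.scale /= /e.
  set A := w s; set B := w t; set C := w' t; set D := `|u' t|; set F := s - t => H.
  suff -> : (C - D) / 2 * F + F * D + B = - ((C - D) / 2 * F) + F * C + B by lra.
  by field.
- move=> t /andP[at_ tb] us; rewrite leNgt; apply/negP => wut.
  have atb : a <= t <= b by rewrite ltW.
  have cu := is_derive_cvg0 (du t atb).
  have cw := is_derive_cvg0 (dw t atb).
  have : \forall h \near (0 : R), w (t + h *: (1 : R)) < `|u (t + h *: (1 : R))|.
    pose d := (`|u t| - w t) / 2.
    have d0 : 0 < d by rewrite /d; lra.
    near=> h.
    have : `|u t - u (t + h *: (1 : R))| < d by near: h; apply: cvgr_dist_lt.
    have : `|w t - w (t + h *: (1 : R))| < d by near: h; apply: cvgr_dist_lt.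
    move=> /ltr_normlP[H _] /(le_lt_trans (lerB_dist _ _)).
    by rewrite /d in H *; lra.
  move=> [r /= r0 hr].
  pose h := Num.min (r / 2) (t - a).
  have h0 : 0 < h by rewrite lt_min; apply/andP; split; lra.
  have hr2 : h < r by rewrite /h; rewrite gt_min; apply/orP; left; lra.
  have hta : h <= t - a by rewrite /h ge_min lexx orbT.
  have := hr (- h); rewrite /ball_ /= sub0r opprK gtr0_norm// => /(_ hr2).
  have -> : t + (- h) *: (1 : R) = t - h by rewrite /GRing.scale/= mulr1.
  by rewrite ltNge us//; apply/andP; split; lra.
Unshelve. all: by end_near. Qed.

(** [norm_le_comparison] wants a strict inequality between speeds. An extra slope [c] in the bound
    provides it, at a total cost of at most [e]. *)
Lemma mean_value_growth (u u' : R -> V) (w w' : R -> R) (a b : R) :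
  a <= b ->
  (forall t, a <= t <= b -> is_derive t 1 u (u' t)) ->
  (forall t, a <= t <= b -> is_derive t 1 w (w' t)) ->
  (forall t, a <= t <= b -> `|u' t| <= w' t) ->
  `|u b - u a| <= w b - w a.
Proof.
move=> ab du dw uw; apply/ler_addgt0Pr => e e0.
(* The [+ 1] keeps the denominator positive when [a = b]. *)
pose c := e / (b - a + 1).
have c0 : 0 < c by rewrite divr_gt0//; lra.
have H : `|(u \- cst (u a)) b| <= w b - w a + c * (b - a).
  apply: (@norm_le_comparison (u \- cst (u a)) u' (fun t => w t - w a + c * (t - a)) (fun t => w' t + c) a b) => //.
  - move=> t tab; rewrite -[u' t]subr0; apply: is_deriveB; exact: du.
  - move=> t tab; apply: is_deriveD.
      by rewrite -[w' t]subr0; apply: is_deriveB; exact: dw.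
    by apply: is_derive_exact => h; rewrite /GRing.scale/=; ring.
  - by rewrite /= !subrr normr0 mulr0 addr0.
  - move=> t /andP[at_ tb] _; apply: (@le_lt_trans _ _ (w' t)); last by rewrite ltrDl.
    by apply: uw; rewrite at_ ltW.
  - by rewrite ab lexx.
apply: (le_trans H); rewrite lerD2l /c mulrAC -mulrA ler_piMr ?(ltW e0)//.
by rewrite ler_pdivrMr; lra.
Qed.

Lemma mean_value_le (u u' : R -> V) (M a b : R) : a <= b ->
  (forall t, a <= t <= b -> is_derive t 1 u (u' t)) ->
  (forall t, a <= t <= b -> `|u' t| <= M) ->
  `|u b - u a| <= M * (b - a).
Proof.
move=> ab du uM; rewrite mulrBr; apply: (mean_value_growth (w := *%R M) (w' := fun=> M) ab du) => // t _.
by apply: is_derive_exact => h; rewrite /GRing.scale/=; ring.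
Qed.

End Comparison.

(** Subtracting the uniform motion of velocity [d] turns the mean value inequality into a bound on a
    first-order error. The strict expansion of C^1 maps and the second differences are both
    estimated this way. *)
Lemma mean_value_segment (R : realType) (V W : normedModType R) (f : V -> W)
    (x v : V) (D : R -> W) (d : W) (M : R) :
  (forall s, 0 <= s <= 1 -> is_derive (x + s *: v) v f (D s)) ->
  (forall s, 0 <= s <= 1 -> `|D s - d| <= M) ->
  `|f (x + v) - f x - d| <= M.
Proof.
move=> fD DM.
pose u s := f (x + s *: v) - s *: d.
have := @mean_value_le _ _ u (fun s => D s - d) M 0 1 ler01.
rewrite /u scale1r scale0r addr0 scale1r scale0r !subr0 mulr1 addrAC; apply => //.
move=> t t01; apply: is_deriveB; first exact: is_derive_line (fD t t01).
rewrite -[X in is_derive _ _ _ X]addr0 -[X in is_derive _ _ _ (X + _)]scale1r addrC.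
rewrite -[X in X + _](scaler0 _ t).
by apply: (is_deriveZf (a := id) (f := cst d)).
Qed.

Lemma mx_norm_leP (R : realType) m n (A : 'M[R]_(m, n)) (r : R) : 0 <= r ->
  `|A| <= r <-> forall i j, `|A i j| <= r.
Proof.
move=> r0; rewrite [`|A|]/Num.Def.normr/= mx_normrE; split=> [H i j|H].
  by apply: le_trans H; exact: (le_bigmax _ (fun ij => `|A ij.1 ij.2|) (i, j)).
by apply: bigmax_le => // -[i j] _; exact: H.
Qed.

Lemma mx_norm_ltP (R : realType) m n (A : 'M[R]_(m, n)) (r : R) : 0 < r ->
  `|A| < r <-> forall i j, `|A i j| < r.
Proof.
move=> r0; rewrite [`|A|]/Num.Def.normr/= mx_normrE; split=> [H i j|H].
  by apply: le_lt_trans H; exact: (le_bigmax _ (fun ij => `|A ij.1 ij.2|) (i, j)).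
by apply: bigmax_lt => // -[i j] _; exact: H.
Qed.

Lemma le_mx_norm (R : realType) m n (A : 'M[R]_(m, n)) i j : `|A i j| <= `|A|.
Proof. exact: (mx_norm_leP A (normr_ge0 _)).1. Qed.

Lemma ball_convex (R : realType) (V : normedModType R) (a b : V) (r s : R) :
  `|a| < r -> `|b| < r -> 0 <= s <= 1 -> `|a + s *: (b - a)| < r.
Proof.
move=> ar br /andP[s0 s1].
have -> : a + s *: (b - a) = (1 - s) *: a + s *: b.
  by rewrite scalerBr scalerBl scale1r addrA addrAC.
apply: (le_lt_trans (ler_normD _ _)); rewrite !normrZ ger0_norm ?subr_ge0// ger0_norm//.
have [s00|s00] := eqVneq s 0; first by rewrite s00 mul0r addr0 subr0 mul1r.
have : s * `|b| < s * r by rewrite ltr_pM2l// lt_neqAle eq_sym s00.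
have : (1 - s) * `|a| <= (1 - s) * r by rewrite ler_wpM2l ?subr_ge0// ltW.
rewrite mulrBl mul1r; lra.
Qed.

Section IsDeriveMore.
Context {R : realType} {V W : normedModType R}.
Implicit Types (f : V -> W) (x v : V).

Lemma is_derive_dirZ f x v df (c : R) :
  is_derive x v f df -> is_derive x (c *: v) f (c *: df).
Proof.
have [->|c0] := eqVneq c 0; first by rewrite !scale0r => _; exact: is_derive0.
move=> fd; apply/is_deriveP => e e0.
have ec0 : 0 < e / `|c| by rewrite divr_gt0// normr_gt0.
have := (is_deriveP _ _ _ _).1 fd _ ec0 => {}fd.
have cc : (h * c) @[h --> (0 : R)] --> (0 : R).
  by rewrite -[X in _ --> X](mul0r c); apply: cvgMl; exact: cvg_id.
have {}fd : \forall h \near (0 : R), `|f (x + (h * c) *: v) - f x - (h * c) *: df| <=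
  e / `|c| * `|h * c| := cc _ fd.
apply: filterS fd => h; rewrite !scalerA normrM.
by have -> : e / `|c| * (`|h| * `|c|) = e * `|h| by field; rewrite normr_eq0.
Qed.

Lemma is_derive_translate f x v c df :
  is_derive (x + c) v f df -> is_derive x v (fun y => f (y + c)) df.
Proof.
move=> /is_deriveP fd; apply/is_deriveP => e /fd; apply: filterS => h.
by rewrite [x + c + _]addrAC.
Qed.

Lemma is_derive_lin_comp (Z : normedModType R) (L : W -> Z) f x v df :
  linear L -> continuous L -> is_derive x v f df -> is_derive x v (L \o f) (L df).
Proof.
move=> Ll Lc /is_derive_cvg fd; apply/is_derive_cvg.
have L0 : L 0 = 0.
  have := Ll 1 0 0; rewrite !scale1r addr0 => /eqP; rewrite eq_sym -subr_eq0 addrK => /eqP.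
  by [].
have E (h : R) (p q : W) : h *: (L p - L q) = L (h *: (p - q)).
  have := Ll h (p - q) 0; rewrite L0 !addr0 => ->.
  by have := Ll (-1) q p; rewrite !scaleN1r [- q + p]addrC [- L q + _]addrC => ->.
under eq_fun do rewrite /= E.
by apply: continuous_cvg => //; exact: Lc.
Qed.

End IsDeriveMore.

Lemma open_ball_ex (R : realType) (V : normedModType R) (U : set V) x : open U -> U x ->
  exists2 d : R, 0 < d & forall y, `|y - x| < d -> U y.
Proof.
move=> oU Ux; have : nbhs x U by exact: open_nbhs_nbhs.
by move=> /nbhs_normP[d d0 dU]; exists d => // y; rewrite distrC => yd; exact: dU.
Qed.

Lemma open_distP (R : realType) (V : normedModType R) (U : set V) :
  (forall x, U x -> exists2 d : R, 0 < d & forall y, `|y - x| < d -> U y) -> open U.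
Proof.
move=> H; rewrite openE => x /H[d d0 dU]; suff : nbhs x U by [].
by apply/nbhs_normP; exists d => // y /=; rewrite distrC => /dU.
Qed.

Lemma continuous_distP (R : realType) (V W : normedModType R) (f : V -> W) x :
  {for x, continuous f} <-> forall e, 0 < e ->
    exists2 d, 0 < d & forall y, `|y - x| < d -> `|f y - f x| <= e.
Proof.
split=> [/cvgrPdist_le cf e e0|H].
  have := cf e e0; rewrite -nbhs_nearE => /nbhs_normP[d d0 dU]; exists d => // y yd.
  by rewrite distrC; apply: dU; rewrite /= distrC.
apply/cvgrPdist_le => e /H[d d0 dU]; rewrite -nbhs_nearE; apply/nbhs_normP.
by exists d => // y /=; rewrite distrC => /dU; rewrite distrC.
Qed.

(** * Calculus of C^k maps *)

Section CkBasics.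
Context {R : realType} {V W : normedModType R}.
Implicit Types (f : V -> W) (U : set V) (k : nat).

Lemma Ck_on_continuous k U f x : Ck_on k U f -> U x -> {for x, continuous f}.
Proof. by case: k => [|k] [H _]; exact: H. Qed.

Lemma Ck_onW k U f : Ck_on k.+1 U f -> Ck_on k U f.
Proof.
elim: k f => [|k IH] f [cf df]; split => // v.
by have [dfv /IH] := df v.
Qed.

Lemma Ck_on_le k l U f : (k <= l)%N -> Ck_on l U f -> Ck_on k U f.
Proof.
elim: l => [|l IH]; first by rewrite leqn0 => /eqP->.
by rewrite leq_eqVlt => /predU1P[->//|]; rewrite ltnS => /IH H /Ck_onW.
Qed.

(** All conditions in [Ck_on] are imposed point by point on [f] and on the globally defined
    functions ['D_v f], so they pass to arbitrary unions of sets. *)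
Lemma Ck_on_local k U f :
  (forall x, U x -> exists B : set V, B x /\ Ck_on k B f) -> Ck_on k U f.
Proof.
elim: k f => [|k IH] f H.
  by split=> // x /H[B [Bx [cf _]]]; exact: cf.
split=> [x /H[B [Bx [cf _]]]|v]; first exact: cf.
split=> [x /H[B [Bx [_ /(_ v)[df _]]]]|]; first exact: df.
by apply: IH => x /H[B [Bx [_ /(_ v)[_ df]]]]; exists B.
Qed.

Lemma Ck_on_sub k U U' f : U' `<=` U -> Ck_on k U f -> Ck_on k U' f.
Proof. by move=> UU fk; apply: Ck_on_local => x /UU Ux; exists U. Qed.

Lemma continuous_near_eq f g x : {near x, f =1 g} ->
  {for x, continuous f} -> {for x, continuous g}.
Proof.
move=> fg cf; rewrite /prop_for /continuous_at -(nbhs_singleton fg).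
by apply: cvg_trans cf; apply: near_eq_cvg; apply: filterS fg => y ->.
Qed.

Lemma open_near U (P : V -> Prop) x : open U -> U x -> (forall y, U y -> P y) ->
  \forall y \near x, P y.
Proof. by move=> oU Ux UP; apply: filterS UP _; exact: open_nbhs_nbhs. Qed.

Lemma Ck_on_eq k U f g : open U -> (forall x, U x -> f x = g x) ->
  Ck_on k U f -> Ck_on k U g.
Proof.
move=> oU; elim: k f g => [|k IH] f g fg.
  move=> [cf _]; split=> // x Ux; apply: continuous_near_eq (cf _ Ux).
  exact: (open_near oU Ux).
move=> [cf df]; split=> [x Ux|v].
  by apply: continuous_near_eq (cf _ Ux); exact: (open_near oU Ux).
have [dfv Dfv] := df v; split=> [x Ux|].
  by apply: near_eq_derivable (dfv _ Ux); exact: (open_near oU Ux).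
apply: IH Dfv => x Ux; apply: near_eq_derive; exact: (open_near oU Ux).
Qed.

Lemma Ck_is_derive k U f x v : Ck_on k.+1 U f -> U x -> is_derive x v f ('D_v f x).
Proof. by move=> [_ /(_ v)[df _]] Ux; split => //; exact: df. Qed.

Lemma Ck_on_derive k U f v : Ck_on k.+1 U f -> Ck_on k U ('D_v f).
Proof. by move=> [_ /(_ v)[]]. Qed.

(** The form in which inductions on the order are run below: the derivative is exhibited as a
    formula in maps of known regularity, and openness of [U] lets it stand for ['D_v f]. *)
Lemma Ck_onS k U f (D : V -> V -> W) : open U ->
  (forall x, U x -> {for x, continuous f}) ->
  (forall x v, U x -> is_derive x v f (D v x)) ->
  (forall v, Ck_on k U (D v)) -> Ck_on k.+1 U f.
Proof.
move=> oU cf df kf; split=> // v; split=> [x Ux|]; first by have [] := df x v Ux.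
by apply: Ck_on_eq (kf v) => // x Ux; have [_ ->] := df x v Ux.
Qed.

Lemma Ck_on_cst k U (c : W) : Ck_on k U (cst c).
Proof.
elim: k c => [|k IH] c; first by split=> // x _; exact: cvg_cst.
split=> [x _|v]; first exact: cvg_cst.
split=> [x _|]; first exact: derivable_cst.
have -> : 'D_v (cst c) = cst 0 :> (V -> W) by apply/funext => x; rewrite derive_cst.
exact: IH.
Qed.

Lemma Ck_onD k U f g : open U -> Ck_on k U f -> Ck_on k U g ->
  Ck_on k U (fun x => f x + g x).
Proof.
move=> oU; elim: k f g => [|k IH] f g fk gk.
  split=> // x Ux; apply: cvgD; [exact: Ck_on_continuous fk Ux|exact: Ck_on_continuous gk Ux].
apply: (@Ck_onS _ _ _ (fun v x => 'D_v f x + 'D_v g x)) => //.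
- move=> x Ux; apply: cvgD; [exact: Ck_on_continuous fk Ux|exact: Ck_on_continuous gk Ux].
- by move=> x v Ux; have df := Ck_is_derive v fk Ux; have dg := Ck_is_derive v gk Ux; exact: is_deriveD.
- by move=> v; apply: IH; [have [_ /(_ v)[]] := fk|have [_ /(_ v)[]] := gk].
Qed.

Lemma Ck_on_sum k U (I : Type) (r : seq I) (P : pred I) (f : I -> V -> W) : open U ->
  (forall i, Ck_on k U (f i)) -> Ck_on k U (fun x => \sum_(i <- r | P i) f i x).
Proof.
move=> oU fk; elim: r => [|i r IH].
  by under eq_fun do rewrite big_nil; exact: Ck_on_cst.
have [Pi|Pi] := boolP (P i).
  by under eq_fun do rewrite big_cons Pi; exact: Ck_onD.
by under eq_fun do rewrite big_cons (negbTE Pi).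
Qed.

End CkBasics.

Section CkLinear.
Context {R : realType} {V W : normedModType R}.

Lemma Ck_on_lin_comp (Z : normedModType R) (L : W -> Z) k (U : set V) (f : V -> W) :
  open U -> linear L -> continuous L -> Ck_on k U f -> Ck_on k U (L \o f).
Proof.
move=> oU Ll Lc; elim: k f => [|k IH] f fk.
  split=> // x Ux; apply: continuous_comp; [exact: Ck_on_continuous fk Ux|exact: Lc].
apply: (@Ck_onS _ _ _ _ _ _ (fun v x => L ('D_v f x))) => //.
- move=> x Ux; apply: continuous_comp; [exact: Ck_on_continuous fk Ux|exact: Lc].
- by move=> x v Ux; apply: is_derive_lin_comp => //; exact: (Ck_is_derive _ fk).
- by move=> v; apply: IH; have [_ /(_ v)[]] := fk.
Qed.

Lemma Ck_onZ k (U : set V) (a : V -> R^o) (f : V -> W) : open U -> Ck_on k U a -> Ck_on k U f ->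
  Ck_on k U (fun x => a x *: f x).
Proof.
move=> oU; elim: k a f => [|k IH] a f ak fk.
  split=> // x Ux; apply: cvgZ; [exact: Ck_on_continuous ak Ux|exact: Ck_on_continuous fk Ux].
apply: (@Ck_onS _ _ _ _ _ _ (fun v x => a x *: 'D_v f x + 'D_v a x *: f x)) => //.
- move=> x Ux; apply: cvgZ; [exact: Ck_on_continuous ak Ux|exact: Ck_on_continuous fk Ux].
- move=> x v Ux; apply: is_deriveZf; [exact: Ck_is_derive ak Ux|exact: Ck_is_derive fk Ux].
- move=> v; have [_ /(_ v)[_ av]] := ak; have [_ /(_ v)[_ fv]] := fk.
  by apply: Ck_onD => //; apply: IH => //; exact: Ck_onW.
Qed.

End CkLinear.

Lemma Ck_on_id (R : realType) (V : normedModType R) k (U : set V) :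
  open U -> Ck_on k U id.
Proof.
move=> oU; case: k => [|k]; first by split=> // x _; exact: cvg_id.
apply: (@Ck_onS _ _ _ _ _ _ (fun v => cst v)) => //.
- by move=> x _; exact: cvg_id.
- by move=> v; exact: Ck_on_cst.
Qed.

Section CkScalar.
Context {R : realType} {V : normedModType R}.
Implicit Types (f g : V -> R^o) (U : set V) (k : nat).

Lemma Ck_onM k U f g : open U -> Ck_on k U f -> Ck_on k U g ->
  Ck_on k U (fun x => f x * g x : R^o).
Proof. exact: Ck_onZ. Qed.

Lemma Ck_onN k U f : open U -> Ck_on k U f -> Ck_on k U (fun x => - f x : R^o).
Proof.
move=> oU fk; have -> : (fun x => - f x) = (fun x => (-1 : R^o) *: f x).
  by apply/funext => x; rewrite scaleN1r.
by apply: Ck_onZ => //; exact: Ck_on_cst.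
Qed.

Lemma Ck_on_prod k U (I : Type) (r : seq I) (P : pred I) (f : I -> V -> R^o) : open U ->
  (forall i, Ck_on k U (f i)) -> Ck_on k U (fun x => \prod_(i <- r | P i) f i x : R^o).
Proof.
move=> oU fk; elim: r => [|i r IH].
  by under eq_fun do rewrite big_nil; exact: Ck_on_cst.
have [Pi|Pi] := boolP (P i).
  by under eq_fun do rewrite big_cons Pi; exact: Ck_onM.
by under eq_fun do rewrite big_cons (negbTE Pi).
Qed.

(** The derivative of the inverse is a product of ['D_v f] and of the inverse itself, so each order
    of regularity yields the next one. *)
Lemma Ck_onV k U f : open U -> (forall x, U x -> f x != 0) -> Ck_on k U f ->
  Ck_on k U (fun x => (f x)^-1 : R^o).
Proof.
move=> oU f0; elim: k => [|k IH] fk.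
  split=> // x Ux; apply: cvgV; [exact: f0|exact: Ck_on_continuous fk Ux].
apply: (@Ck_onS _ _ _ _ _ _ (fun v x => - ('D_v f x * ((f x)^-1 * (f x)^-1)))) => //.
- by move=> x Ux; apply: cvgV; [exact: f0|exact: Ck_on_continuous fk Ux].
- move=> x v Ux; have [df _] := Ck_is_derive v fk Ux; split; first exact: derivableV (f0 _ Ux) df.
  have := deriveV (f0 _ Ux) df; rewrite /GRing.scale/= => ->.
  by rewrite mulNr -exprVn expr2 mulrC.
- move=> v; have [_ /(_ v)[_ fv]] := fk.
  have fV := IH (Ck_onW fk).
  by apply: Ck_onN => //; apply: Ck_onM => //; exact: Ck_onM.
Qed.

End CkScalar.

Lemma Ck_on_mxP (R : realType) (V : normedModType R) m n k (U : set V)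
    (f : V -> 'M[R]_(m, n)) : open U ->
  Ck_on k U f <-> forall i j, Ck_on k U (fun x => f x i j : R^o).
Proof.
move=> oU; split.
  move=> fk i j; have coordL : linear (fun A : 'M[R]_(m, n) => A i j : R^o).
    by move=> a A B; rewrite !mxE.
  by apply: (Ck_on_lin_comp (L := fun A : 'M[R]_(m, n) => A i j : R^o)) => //; exact: coord_continuous.
elim: k f => [|k IH] f fk.
  split=> // x Ux; apply/cvgrPdist_le => e e0; near=> y.
  apply/mx_norm_leP; first exact: ltW.
  move=> i j; rewrite !mxE; move: i j; near: y.
  apply: filter_forall => i; apply: filter_forall => j.
  have := Ck_on_continuous (fk i j) Ux; move/cvgrPdist_le; exact.
have df x v : U x -> derivable f x v.
  by move=> Ux; apply/derivable_mxP => i j; have [] := Ck_is_derive v (fk i j) Ux.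
apply: (@Ck_onS _ _ _ _ _ _ (fun v => 'D_v f)) => //.
- move=> x Ux; apply/cvgrPdist_le => e e0; near=> y.
  apply/mx_norm_leP; first exact: ltW.
  move=> i j; rewrite !mxE; move: i j; near: y.
  apply: filter_forall => i; apply: filter_forall => j.
  have := Ck_on_continuous (fk i j) Ux; move/cvgrPdist_le; exact.
- by move=> x v /df; split.
- move=> v; apply: IH => i j; have [_ /(_ v)[_]] := fk i j; apply: Ck_on_eq => // x Ux.
  by rewrite derive_mx ?mxE//; exact: df.
Unshelve. all: by end_near. Qed.

(* Moving from [y] to [y'] along the coordinate axes only uses the partial derivatives. *)
Lemma C1_strict_expansion (R : realType) n (W : normedModType R) (U : set 'rV[R]_n)
    (f : 'rV[R]_n -> W) x e : open U -> U x -> Ck_on 1 U f -> 0 < e ->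
  exists2 r, 0 < r & (forall y, `|y - x| < r -> U y) /\
    forall y y', `|y - x| < r -> `|y' - x| < r ->
      `|f y' - f y - \sum_i (y' - y) 0 i *: 'D_(delta_mx 0 i) f x| <= e * `|y' - y|.
Proof.
move=> oU Ux [_ f1] e0.
(* Each of the [n] coordinate steps will cost at most [eta] times the norm of [y' - y]; the
   successor keeps the quotient meaningful for [n = 0]. *)
pose eta := e / n.+1%:R.
have eta0 : 0 < eta by rewrite divr_gt0.
have : \forall y \near x, U y /\
    forall i : 'I_n, `|'D_(delta_mx 0 i) f x - 'D_(delta_mx 0 i) f y| <= eta.
  apply: filterI; first exact: open_nbhs_nbhs.
  have Hi i : \forall y \near x, `|'D_(delta_mx 0 i) f x - 'D_(delta_mx 0 i) f y| <= eta.
    have [_ [ci _]] := f1 (delta_mx 0 i).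
    by have /cvgrPdist_le := ci x Ux; exact.
  exact: filter_forall Hi.
rewrite -nbhs_nearE => /nbhs_normP[r r0 Hr].
have {}Hr y : `|y - x| < r -> U y /\
    forall i : 'I_n, `|'D_(delta_mx 0 i) f x - 'D_(delta_mx 0 i) f y| <= eta.
  by move=> yx; apply: Hr; rewrite /= distrC.
exists r => //; split=> [y /Hr[]//|y y' yr yr'].
(* The path from [y] to [y'] has these corners. Each entry of [p j] is an entry of [y] or of [y'],
   so in the sup norm the corners stay in the ball around [x]. *)
pose p (j : nat) : 'rV[R]_n := \row_k (if (k < j)%N then y' 0 k else y 0 k).
have pr j : `|p j - x| < r.
  apply/mx_norm_ltP => // a k; rewrite !mxE ord1.
  by case: ifP => _; [have := (mx_norm_ltP _ r0).1 yr' 0 k|have := (mx_norm_ltP _ r0).1 yr 0 k];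
     rewrite !mxE.
have pS (j : 'I_n) : p j.+1 = p j + ((y' - y) 0 j *: delta_mx 0 j).
  apply/rowP => k; rewrite !mxE eqxx/= ltnS leq_eqVlt.
  have [->|/= kj] := eqVneq k j; first by rewrite eqxx ltnn/= mulr1 addrC subrK.
  by rewrite val_eqE (negbTE kj) mulr0 addr0.
have p0 : p 0%N = y by apply/rowP => k; rewrite !mxE.
have pn : p n = y' by apply/rowP => k; rewrite !mxE ltn_ord.
have -> : f y' - f y = \sum_(j < n) (f (p j.+1) - f (p j)).
  by rewrite -[in LHS]p0 -[in LHS]pn -(telescope_sumr (f \o p))// big_mkord.
rewrite -sumrB; apply: (le_trans (ler_norm_sum _ _ _)).
have step (j : 'I_n) : `|f (p j.+1) - f (p j) - (y' - y) 0 j *: 'D_(delta_mx 0 j) f x| <=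
    eta * `|y' - y|.
  set c := (y' - y) 0 j; rewrite pS -/c.
  pose z s := p j + s *: (c *: delta_mx 0 j).
  have zr s : 0 <= s <= 1 -> `|z s - x| < r.
    move=> s01; have := ball_convex (pr j) (pr j.+1) s01.
    by rewrite pS -/c opprB addrA subrK [p j + _ *: _]addrC addrK addrAC.
  apply: (mean_value_segment (D := fun s => c *: 'D_(delta_mx 0 j) f (z s))) => s s01.
    have [Uz _] := Hr _ (zr _ s01); apply: is_derive_dirZ.
    by have [dz _] := f1 (delta_mx 0 j); split => //; exact: dz.
  have [_ /(_ j)] := Hr _ (zr _ s01).
  rewrite -scalerBr normrZ distrC => H.
  apply: (@le_trans _ _ (`|c| * eta)); first by rewrite ler_wpM2l.
  by rewrite mulrC ler_wpM2l ?(ltW eta0)//; exact: le_mx_norm.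
apply: (le_trans (ler_sum _ (fun j _ => step j))).
rewrite sumr_const card_ord -mulrnAl ler_wpM2r// /eta -mulr_natr.
by rewrite mulrAC ler_pdivrMr// ler_wpM2l ?(ltW e0)// ler_nat.
Qed.

(** Linear in [v] by construction, whereas linearity of ['D_v f x] in [v] is obtained only once [f]
    is C^1, by identifying the two. *)
Definition total_derivative (R : realType) n (W : normedModType R)
    (f : 'rV[R]_n -> W) (x v : 'rV[R]_n) : W :=
  \sum_i v 0 i *: 'D_(delta_mx 0 i) f x.

Section TotalDerivative.
Context {R : realType} {n : nat} {W : normedModType R}.
Variables (U : set 'rV[R]_n) (f : 'rV[R]_n -> W).
Hypotheses (oU : open U) (fC1 : Ck_on 1 U f).
Local Notation Df := (total_derivative f).

Lemma total_derivative_linear x : linear (Df x).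
Proof.
move=> a u v; rewrite /total_derivative scaler_sumr -big_split; apply: eq_bigr => i _ /=.
by rewrite !mxE scalerDl scalerA.
Qed.

Lemma total_derivative_bound x v :
  `|Df x v| <= (\sum_i `|'D_(delta_mx 0 i) f x|) * `|v|.
Proof.
apply: (le_trans (ler_norm_sum _ _ _)); rewrite mulr_suml ler_sum// => i _.
by rewrite normrZ mulrC ler_wpM2l// le_mx_norm.
Qed.

(** The strict expansion of [f] at [g x] is applied to the increment of [g] along a single line, so
    a directional derivative of [g] is enough. *)
Lemma is_derive_comp (V : normedModType R) (g : V -> 'rV[R]_n) x v dg :
  is_derive x v g dg -> U (g x) -> is_derive x v (f \o g) (Df (g x) dg).
Proof.
move=> gd Ugx; apply/is_deriveP => e e0.
pose K := \sum_i `|'D_(delta_mx 0 i) f (g x)|.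
have K0 : 0 <= K by rewrite sumr_ge0.
(* Half of the error is spent on the expansion of [f], against the growth rate of [g], and half on
   that of [g], against the bound [K] for the differential of [f]. The cap 1 on [e2] is what gives
   [g] a growth rate of at most 1 more than the norm of [dg]. *)
pose e1 := e / (2 * (`|dg| + 1)); pose e2 := Num.min 1 (e / (2 * (K + 1))).
have e10 : 0 < e1 by rewrite divr_gt0// mulr_gt0// ltr_wpDl.
have e20 : 0 < e2 by rewrite lt_min ltr01/= divr_gt0// mulr_gt0// ltr_wpDl.
have [r r0 [_ fr]] := C1_strict_expansion oU Ugx fC1 e10.
have := is_derive_cvg0 gd => /cvgr_dist_lt/(_ r r0) gr.
have := (is_deriveP _ _ _ _).1 gd _ e20 => gh.
near=> h.
have ghh : `|g (x + h *: v) - g x - h *: dg| <= e2 * `|h| by near: h.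
have grh : `|g x - g (x + h *: v)| < r by near: h.
have := fr (g x) (g (x + h *: v)); rewrite subrr normr0 => /(_ r0).
rewrite distrC => /(_ grh).
rewrite -/(Df (g x) (g (x + h *: v) - g x)) => H.
have gn : `|g (x + h *: v) - g x| <= (`|dg| + 1) * `|h|.
  rewrite -(subrK (h *: dg) (g _ - g x)); apply: (le_trans (ler_normD _ _)).
  rewrite normrZ mulrDl mul1r addrC mulrC lerD2l.
  by apply: (le_trans ghh); rewrite ler_piMl// ge_min lexx.
have E : Df (g x) (g (x + h *: v) - g x) = h *: Df (g x) dg +
    Df (g x) (g (x + h *: v) - g x - h *: dg).
  by rewrite -total_derivative_linear [h *: dg + _]addrC subrK.
rewrite /= -(subrK (Df (g x) (g (x + h *: v) - g x)) (f (g (x + h *: v)) - f (g x))).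
rewrite -addrA {2}E [h *: _ + _]addrC addrK.
apply: (le_trans (ler_normD _ _)).
have B1 : e1 * `|g (x + h *: v) - g x| <= e / 2 * `|h|.
  apply: (le_trans (ler_wpM2l (ltW e10) gn)); rewrite mulrA ler_wpM2r//.
  rewrite /e1 invfM mulrA mulfVK// gt_eqF// ltr_wpDl//.
have B2 : `|Df (g x) (g (x + h *: v) - g x - h *: dg)| <= e / 2 * `|h|.
  apply: (le_trans (total_derivative_bound _ _)); rewrite -/K.
  apply: (@le_trans _ _ (K * (e2 * `|h|))); first by rewrite ler_wpM2l.
  rewrite mulrA ler_wpM2r//.
  apply: (@le_trans _ _ ((K + 1) * (e / (2 * (K + 1))))).
    by rewrite ler_pM ?(ltW e20) ?lerDl// ge_min lexx orbT.
  have -> : (K + 1) * (e / (2 * (K + 1))) = e / 2 by field; rewrite gt_eqF// ltr_wpDl.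
  by [].
by rewrite [e]splitr mulrDl lerD// (le_trans H)// distrC.
Unshelve. all: by end_near. Qed.

Lemma is_derive_total x v : U x -> is_derive x v f (Df x v).
Proof. by move=> Ux; exact: (is_derive_comp (is_derive_id _ _)). Qed.

Lemma derive_total x v : U x -> 'D_v f x = Df x v.
Proof. by move=> /(is_derive_total v)[]. Qed.

Lemma is_derive_compD (V : normedModType R) (g : V -> 'rV[R]_n) x v dg :
  is_derive x v g dg -> U (g x) -> is_derive x v (f \o g) ('D_dg f (g x)).
Proof. by move=> gd Ug; rewrite derive_total//; exact: is_derive_comp. Qed.

End TotalDerivative.

(** Written in the coordinates of the intermediate space, the chain rule expresses the derivative by
    compositions of lower order, which closes the induction. *)
Lemma Ck_on_comp (R : realType) n (V W : normedModType R) k (U : set V)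
    (U' : set 'rV[R]_n) (f : V -> 'rV[R]_n) (g : 'rV[R]_n -> W) :
  open U -> open U' -> (forall x, U x -> U' (f x)) ->
  Ck_on k U f -> Ck_on k U' g -> Ck_on k U (g \o f).
Proof.
move=> oU oU' UU'; elim: k f g UU' => [|k IH] f g UU' fk gk.
  split=> // x Ux; apply: continuous_comp; [exact: Ck_on_continuous fk Ux|].
  by apply: Ck_on_continuous gk _; exact: UU'.
apply: (@Ck_onS _ _ _ _ _ _
  (fun v x => \sum_i ('D_v f x) 0 i *: ('D_(delta_mx 0 i) g \o f) x)) => //.
- move=> x Ux; apply: continuous_comp; [exact: Ck_on_continuous fk Ux|].
  by apply: Ck_on_continuous gk _; exact: UU'.
- move=> x v Ux.
  apply: (is_derive_comp oU' (Ck_on_le _ gk)) => //; last exact: UU'.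
  exact: (Ck_is_derive _ fk).
- move=> v; apply: Ck_on_sum => // i; have [_ /(_ v)[_ fv]] := fk.
  apply: Ck_onZ => //; first exact: (Ck_on_mxP _ _ oU).1.
  by apply: IH => //; [exact: Ck_onW|have [_ /(_ (delta_mx 0 i))[]] := gk].
Qed.

(** * Symmetry of second derivatives *)

Section Schwarz.
Context {R : realType} {V W : normedModType R}.
Variables (U : set V) (f : V -> W).
Hypotheses (oU : open U) (fC2 : Ck_on 2 U f).

(** The mean value inequality is used twice: in direction [v] for the increment of [f] along
    [t *: w], then in direction [w] for ['D_v f]. The second difference itself is symmetric in [v]
    and [w]. *)
Lemma second_difference x v w e : U x -> 0 < e -> exists2 r, 0 < r &
  forall t : R, 0 < t < r ->
    `|f (x + t *: v + t *: w) - f (x + t *: v) - (f (x + t *: w) - f x)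
      - (t * t) *: 'D_w ('D_v f) x| <= e * (t * t).
Proof.
move=> Ux e0.
have [_ f1] := fC2; have [dv [_ dwv]] := f1 v; have [dw [cw _]] := dwv w.
have : \forall y \near x, U y /\ `|'D_w ('D_v f) x - 'D_w ('D_v f) y| <= e.
  apply: filterI; first exact: open_nbhs_nbhs.
  by have /cvgrPdist_le := cw x Ux; exact.
rewrite -nbhs_nearE => /nbhs_normP[r r0 Hr].
have {}Hr y : `|y - x| < r -> U y /\ `|'D_w ('D_v f) x - 'D_w ('D_v f) y| <= e.
  by move=> yx; apply: Hr; rewrite /= distrC.
have vw0 : 0 < `|v| + `|w| + 1 by rewrite ltr_wpDl// addr_ge0.
exists (r / (`|v| + `|w| + 1)); first by rewrite divr_gt0.
move=> t /andP[t0]; rewrite ltr_pdivlMr// => tr.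
have near_x s s' : 0 <= s <= 1 -> 0 <= s' <= 1 ->
    `|x + s *: (t *: v) + s' *: (t *: w) - x| < r.
  move=> /andP[s0 s1] /andP[s0' s1']; rewrite -(addrA x) [x + _]addrC addrK.
  apply: (le_lt_trans (ler_normD _ _)); apply: le_lt_trans tr.
  rewrite !normrZ (ger0_norm s0) (ger0_norm s0') (gtr0_norm t0) !mulrDr mulr1.
  have A : s * (t * `|v|) <= t * `|v| by rewrite ler_piMl// mulr_ge0// ltW.
  have B : s' * (t * `|w|) <= t * `|w| by rewrite ler_piMl// mulr_ge0// ltW.
  lra.
pose u z := f (z + t *: w) - f z.
have -> : e * (t * t) = (e * t) * t by rewrite mulrA.
rewrite -/(u (x + t *: v)) -/(u x).
apply: (mean_value_segment (D := fun s => t *: ('D_v f (x + s *: (t *: v) + t *: w) -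
    'D_v f (x + s *: (t *: v))))) => s s01.
  have s1 : 0 <= (1 : R) <= 1 by rewrite ler01 lexx.
  have s0 : 0 <= (0 : R) <= 1 by rewrite ler01 lexx.
  have [U1 _] := Hr _ (near_x _ _ s01 s1); have [U0 _] := Hr _ (near_x _ _ s01 s0).
  rewrite scale1r in U1; rewrite scale0r addr0 in U0.
  apply: is_derive_dirZ; apply: is_deriveB; last by split => //; exact: dv.
  by apply: is_derive_translate; split=> //; exact: dv.
rewrite -scalerA -scalerBr normrZ gtr0_norm// mulrC ler_wpM2r ?(ltW t0)//.
pose D s' := t *: 'D_w ('D_v f) (x + s *: (t *: v) + s' *: (t *: w)).
apply: (@mean_value_segment _ _ _ ('D_v f) _ _ D) => s' s01'; rewrite /D.
  have [U1 _] := Hr _ (near_x _ _ s01 s01').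
  by apply: is_derive_dirZ; split => //; exact: dw.
have [_] := Hr _ (near_x _ _ s01 s01').
by rewrite -scalerBr normrZ gtr0_norm// distrC mulrC => H; rewrite ler_wpM2r// ltW.
Qed.

End Schwarz.

(** Both mixed derivatives approximate the same second difference divided by [t * t]. *)
Lemma derive_sym (R : realType) (V W : normedModType R) (U : set V) (f : V -> W) x v w :
  open U -> Ck_on 2 U f -> U x -> 'D_w ('D_v f) x = 'D_v ('D_w f) x.
Proof.
move=> oU f2 Ux; apply/eqP; rewrite -subr_eq0 -normr_le0; apply/ler_addgt0Pr => e e0.
rewrite add0r; have e20 : 0 < e / 2 by rewrite divr_gt0.
have [r1 r10 H1] := second_difference oU f2 v w Ux e20.
have [r2 r20 H2] := second_difference oU f2 w v Ux e20.
pose t := Num.min r1 r2 / 2.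
have m0 : 0 < Num.min r1 r2 by rewrite lt_min r10.
have t0 : 0 < t by rewrite divr_gt0.
have tm : t < Num.min r1 r2 by rewrite /t; lra.
move: (tm); rewrite lt_min => /andP[t1 t2].
have := H1 t ltac:(by rewrite t0); have := H2 t ltac:(by rewrite t0).
set A := f _ - f _ - _; set B := f _ - f _ - _.
have -> : A = B.
  rewrite /A /B [x + t *: w + _]addrAC !opprB -!addrA; congr (_ + _).
  by rewrite addrCA [RHS]addrCA; congr (_ + _); rewrite addrC.
move=> Hb Ha; have tt : 0 < t * t by rewrite mulr_gt0.
rewrite -(ler_pM2l tt) -{1}(gtr0_norm tt) -normrZ scalerBr.
have -> : (t * t) *: 'D_w ('D_v f) x - (t * t) *: 'D_v ('D_w f) x =
    (B - (t * t) *: 'D_v ('D_w f) x) - (B - (t * t) *: 'D_w ('D_v f) x).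
  by rewrite opprB [RHS]addrC addrA subrK.
apply: (le_trans (ler_normB _ _)); apply: (le_trans (lerD Hb Ha)).
by rewrite -mulrDl -splitr mulrC.
Qed.

(** Completeness of spaces of row vectors provides the limits of the Picard iteration and of the
    fixed point iteration for inverse functions. *)
HB.instance Definition _ (R : realType) (m n : nat) := Complete.on 'M[R]_(m, n).

Lemma is_derive_mxP (R : realType) (V : normedModType R) m n (f : V -> 'M[R]_(m, n))
    x v df :
  is_derive x v f df <-> forall i j, is_derive x v (fun y => f y i j : R^o) (df i j).
Proof.
split=> [[fd <-] i j|fd].
  by split; [exact: (derivable_mxP _ _ _).1|rewrite derive_mx// mxE].
have dfx : derivable f x v by apply/derivable_mxP => i j; have [] := fd i j.
by split=> //; rewrite derive_mx//; apply/matrixP => i j; rewrite mxE; have [_ ->] := fd i j.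
Qed.

Lemma is_derive_continuous (R : realType) (W : normedModType R) (f : R -> W) (t : R) df :
  is_derive t 1 f df -> {for t, continuous f}.
Proof.
by move=> [fd _]; apply: differentiable_continuous; exact/derivable1_diffP.
Qed.

Lemma is_derive_opp (R : realType) (W : normedModType R) (f : R -> W) (t : R) df :
  is_derive (- t) 1 f df -> is_derive t 1 (fun s => f (- s)) (- df).
Proof.
move=> fd; have E s : - s = 0 + s *: (-1 *: 1) :> R.
  by rewrite add0r /GRing.scale/= mulr1 mulrN1.
under eq_fun do rewrite E; apply: is_derive_line; rewrite -E -[- df]scaleN1r.
exact: is_derive_dirZ.
Qed.

(** In contrast with [is_derive_comp], derivability of the outer function at one point is enough:
    every real increment of [g] is a multiple of the single direction 1. *)
Lemma is_derive_comp1 (R : realType) (V W : normedModType R) (f : R -> W) (g : V -> R)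
    (x v : V) dg df :
  is_derive x v g dg -> is_derive (g x) 1 f df -> is_derive x v (f \o g) (dg *: df).
Proof.
move=> gd fd.
apply/is_deriveP => e e0.
have dg1 : 0 < `|dg| + 1 by rewrite ltr_wpDl.
have df1 : 0 < `|df| + 1 by rewrite ltr_wpDl.
pose e1 := e / 2 / (`|dg| + 1); pose e2 := Num.min 1 (e / 2 / (`|df| + 1)).
have e10 : 0 < e1 by rewrite !divr_gt0.
have e20 : 0 < e2 by rewrite lt_min ltr01/= !divr_gt0.
have := (is_deriveP _ _ _ _).1 fd _ e10 => -[r /= r0 fr].
have := is_derive_cvg0 gd => /cvgr_dist_lt/(_ r r0) gr.
have := (is_deriveP _ _ _ _).1 gd _ e20 => gh.
near=> h.
have ghh : `|g (x + h *: v) - g x - h *: dg| <= e2 * `|h| by near: h.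
have grh : `|g x - g (x + h *: v)| < r by near: h.
set k := g (x + h *: v) - g x.
have kE : g x + k *: 1 = g (x + h *: v) by rewrite /GRing.scale/= mulr1 /k addrC subrK.
have := fr k; rewrite /ball_ /= sub0r normrN kE.
have kr : `|k| < r by rewrite /k distrC.
move=> /(_ kr) H.
have kn : `|k| <= (`|dg| + 1) * `|h|.
  rewrite -(subrK (h *: dg) k); apply: (le_trans (ler_normD _ _)).
  rewrite normrZ mulrDl mul1r addrC mulrC lerD2l.
  by apply: (le_trans ghh); rewrite ler_piMl// ge_min lexx.
rewrite -(subrK (k *: df) (f _ - f _)) -addrA scalerA -scalerBl.
apply: (le_trans (ler_normD _ _)); rewrite [e]splitr mulrDl lerD//.
  apply: (le_trans H); apply: (le_trans (ler_wpM2l (ltW e10) kn)).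
  by rewrite mulrA /e1 divfK// gt_eqF.
rewrite normrZ; apply: (le_trans (ler_wpM2r (normr_ge0 _) ghh)).
rewrite mulrAC ler_wpM2r//.
apply: (@le_trans _ _ (e / 2 / (`|df| + 1) * (`|df| + 1))); last by rewrite divfK// gt_eqF.
by apply: ler_pM; rewrite ?(ltW e20) ?lerDl// ge_min lexx orbT.
Unshelve. all: by end_near. Qed.

Lemma is_derive_expRM (R : realType) (c t : R) :
  is_derive t 1 (fun s : R => expR (c * s)) (c * expR (c * t)).
Proof.
have dc : is_derive t 1 (fun s : R => c * s) c.
  by apply: is_derive_exact => h; rewrite /GRing.scale/= mulr1 mulrDr [c * h]mulrC.
exact: (is_derive_comp1 dc (is_derive_expR (c * t))).
Qed.

(** * Flows of smooth vector fields *)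

Lemma ex_primitive (R : realType) (g : R -> R) (T : R) : 0 < T -> continuous g ->
  exists2 G : R -> R, G 0 = 0 & forall t : R, `|t| < T -> is_derive t 1 G (g t).
Proof.
move=> T0 cg.
(* Integrating from [- T] makes both signs of [t] interior points; the value at 0 is subtracted
   afterwards. *)
pose F y := (\int[lebesgue_measure]_(t in `[- T, y]) g t)%R.
exists (fun y => F y - F 0); first by rewrite subrr.
move=> t /ltr_normlP[t1 t2].
have [] := @continuous_FTC1_closed R g (- T) t (t + 1) ltac:(lra).
- apply: continuous_compact_integrable; first exact: segment_compact.
  exact: continuous_subspaceT.
- lra.
- exact: cg.
rewrite derive1E => dF DF; rewrite -[g t]subr0; apply: is_deriveB.
by split; [exact: dF|rewrite -DF].
Qed.

Lemma ex_primitive_rV (R : realType) m (g : R -> 'rV[R]_m) (T : R) : 0 < T -> continuous g ->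
  exists2 G : R -> 'rV[R]_m, G 0 = 0 & forall t : R, `|t| < T -> is_derive t 1 G (g t).
Proof.
move=> T0 cg.
have /choice[G HG] (i : 'I_m) : exists G : R -> R, G 0 = 0 /\
    forall t : R, `|t| < T -> is_derive t 1 G (g t 0 i).
  have [|G G0 Gd] := @ex_primitive R (fun t => g t 0 i) T T0; last by exists G.
  move=> t; apply: (continuous_comp (f := g) (g := fun M : 'rV[R]_m => M 0 i)).
    exact: cg.
  exact: coord_continuous.
exists (fun t => \row_i G i t); first by apply/rowP => i; rewrite !mxE; have [] := HG i.
move=> t tT; apply/is_derive_mxP => i j; rewrite ord1.
under eq_fun do rewrite mxE.
by have [_] := HG j; exact.
Qed.

(** The tail of the series of increments from [k] on is at most [2 * C * 2^-1 ^+ k]. The explicit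
    rate serves as uniformity in parameters when the lemma is applied pointwise. *)
Lemma geometric_cvg (R : realType) (W : completeNormedModType R) (u : nat -> W) (C : R) :
  (forall k, `|u k.+1 - u k| <= C * 2^-1 ^+ k) ->
  exists l : W, forall k, `|l - u k| <= 2 * C * 2^-1 ^+ k.
Proof.
move=> uC.
have uk n k : `|u (n + k)%N - u k| <= 2 * C * (1 - 2^-1 ^+ n) * 2^-1 ^+ k.
  elim: n => [|n IH]; first by rewrite add0n subrr normr0 expr0 subrr mulr0 mul0r.
  rewrite addSn -(subrK (u (n + k)%N) (u (n + k).+1)) -addrA.
  apply: (le_trans (ler_normD _ _)); apply: (le_trans (lerD (uC _) IH)).
  rewrite exprD exprS le_eqVlt; apply/orP; left; apply/eqP; by field.
have C0 : 0 <= C by have := uC 0%N; rewrite expr0 mulr1; exact: le_trans.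
have uk' n k : (k <= n)%N -> `|u n - u k| <= 2 * C * 2^-1 ^+ k.
  move=> kn; rewrite -(subnK kn); apply: (le_trans (uk _ _)).
  have q0 l : 0 <= (2^-1 : R) ^+ l by rewrite exprn_ge0// invr_ge0.
  by apply: ler_wpM2r => //; apply: ler_piMr; rewrite ?mulr_ge0// gerBl.
have small e : 0 < e -> exists k : nat, 2 * C * 2^-1 ^+ k <= e.
  move=> e0; have := @cvg_geometric R (2 * C) 2^-1.
  rewrite ger0_norm ?invr_ge0// => /(_ ltac:(rewrite invf_lt1 ?ltr1n//)).
  move/cvgrPdist_le => /(_ e e0) [k _ /(_ k (leqnn k))].
  rewrite /geometric /= sub0r normrN ger0_norm; first by exists k.
  by rewrite mulr_ge0 ?mulr_ge0 ?exprn_ge0// invr_ge0.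
have cu : cvgn u.
  apply/cauchy_cvgP/cauchy_exP => e e0.
  have e20 : 0 < e / 2 by rewrite divr_gt0.
  have [k ke] := small _ e20; exists (u k), k => // n /= kn.
  rewrite -ball_normE /= distrC (le_lt_trans (uk' _ _ kn))// (le_lt_trans ke)//; lra.
exists (limn u) => k; apply/ler_addgt0Pr => e e0.
have /cvgrPdist_le/(_ e e0)[N _ HN] := cu.
rewrite -(subrK (u (maxn N k)) (limn u)) -addrA addrC.
apply: (le_trans (ler_normD _ _)); rewrite lerD ?uk' ?leq_maxr//.
by apply: HN; rewrite /= leq_maxl.
Qed.

(** * Picard iteration for globally Lipschitz equations *)

Section Picard.
Context {R : realType} {m : nat}.
Variables (F : R -> 'rV[R]_m -> 'rV[R]_m) (L B T : R) (z : 'rV[R]_m).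
Hypotheses (L0 : 0 <= L) (T0 : 0 < T).
Hypothesis Fcont : forall phi : R -> 'rV[R]_m, continuous phi ->
  continuous (fun t => F t (phi t)).
Hypothesis Flip : forall t x y, `|F t x - F t y| <= L * `|x - y|.
Hypothesis Fbound : forall t, `|F t z| <= B.

Let picard_step (phi psi : R -> 'rV[R]_m) := continuous phi ->
  psi 0 = z /\ forall t : R, `|t| <= T -> is_derive t 1 psi (F t (phi t)).

Lemma picard_step_ex phi : exists psi, picard_step phi psi.
Proof.
have [cphi|nc] := pselect (continuous phi); last by exists phi.
have T1 : 0 < T + 1 by rewrite addr_gt0.
have [G G0 Gd] := ex_primitive_rV T1 (Fcont cphi).
exists (fun t => G t + z) => _; split; first by rewrite G0 add0r.
move=> t tT; rewrite -[F t _]addr0; apply: is_deriveD.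
by apply: Gd; rewrite (le_lt_trans tT)// ltrDl.
Qed.

(** Rate of an exponential weight: in the sup norm weighted by [expR (- c * t)], integrating an
    [L]-Lipschitz field contracts by less than one half, whatever the length of the interval. *)
Let c := 2 * L + 1.

(** The sign [s] lets one argument cover both directions of time. The bound [M / 2 * expR (c * t)]
    grows at the rate [(L * M + M / 2) * expR (c * t)], strictly above the speed
    [L * M * expR (c * t)] allowed by the Lipschitz condition. *)
Lemma picard_contract_pos (phi1 phi2 psi1 psi2 : R -> 'rV[R]_m) (s M T' : R) :
  s ^+ 2 = 1 -> psi1 0 = psi2 0 -> 0 < M ->
  (forall t, 0 <= t <= T' -> is_derive (s * t) 1 psi1 (F (s * t) (phi1 (s * t)))) ->
  (forall t, 0 <= t <= T' -> is_derive (s * t) 1 psi2 (F (s * t) (phi2 (s * t)))) ->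
  (forall t, 0 <= t <= T' -> `|phi1 (s * t) - phi2 (s * t)| <= M * expR (c * t)) ->
  forall t, 0 <= t <= T' -> `|psi1 (s * t) - psi2 (s * t)| <= M / 2 * expR (c * t).
Proof.
move=> s1 psi0 M0 d1 d2 phiM.
have dir (psi : R -> 'rV[R]_m) (t : R) d : is_derive (s * t) 1 psi d ->
    is_derive t 1 (fun r => psi (s * r)) (s *: d).
  move=> pd; have E r : s * r = 0 + r *: (s *: 1) :> R.
    by rewrite add0r /GRing.scale/= mulr1 mulrC.
  by under eq_fun do rewrite E; apply: is_derive_line; rewrite -E; exact: is_derive_dirZ.
have sn : `|s| = 1.
  by apply/eqP; rewrite -(@eqrXn2 _ 2)// real_normK ?num_real// s1 expr1n.
apply: (norm_le_comparison (u' := fun t => s *: F (s * t) (phi1 (s * t)) - s *: F (s * t) (phi2 (s * t)))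
  (w' := fun t => M / 2 * (c * expR (c * t)))).
- move=> t tT; apply: is_deriveB; apply: dir; [exact: d1|exact: d2].
- by move=> t tT; apply: is_deriveZ; exact: is_derive_expRM.
- by rewrite mulr0 psi0 subrr normr0 mulr0 expR0 mulr1 divr_ge0// ltW.
- move=> t /andP[t0 tT] _; rewrite -scalerBr normrZ sn mul1r.
  apply: (le_lt_trans (Flip _ _ _)).
  apply: (@le_lt_trans _ _ (L * (M * expR (c * t)))).
    by rewrite ler_wpM2l// phiM// t0 ltW.
  rewrite !mulrA ltr_pM2r ?expR_gt0// /c.
  have -> : M / 2 * (2 * L + 1) = L * M + M / 2 by field.
  by rewrite ltrDl divr_gt0.
Qed.

Lemma picard_contract (phi1 phi2 psi1 psi2 : R -> 'rV[R]_m) (M : R) : 0 < M ->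
  continuous phi1 -> continuous phi2 -> picard_step phi1 psi1 -> picard_step phi2 psi2 ->
  (forall t, `|t| <= T -> `|phi1 t - phi2 t| <= M * expR (c * `|t|)) ->
  forall t, `|t| <= T -> `|psi1 t - psi2 t| <= M / 2 * expR (c * `|t|).
Proof.
move=> M0 c1 c2 /(_ c1)[p1 d1] /(_ c2)[p2 d2] H t tT.
have E : psi1 0 = psi2 0 by rewrite p1.
have [t0|t0] := leP 0 t.
  have K := @picard_contract_pos phi1 phi2 psi1 psi2 1 M T (expr1n _ _) E M0.
  have := K _ _ _ t; rewrite mul1r ger0_norm//; apply.
  - by move=> r /andP[r0 rT]; apply: d1; rewrite mul1r ger0_norm.
  - by move=> r /andP[r0 rT]; apply: d2; rewrite mul1r ger0_norm.
  - by move=> r /andP[r0 rT]; have := H r; rewrite mul1r ger0_norm// => ->.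
  - by rewrite t0 -(ger0_norm t0).
have s1 : (-1 : R) ^+ 2 = 1 by rewrite sqrrN expr1n.
have K := @picard_contract_pos phi1 phi2 psi1 psi2 (-1) M T s1 E M0.
have := K _ _ _ (- t); rewrite mulrNN mul1r ltr0_norm//; apply.
- by move=> r /andP[r0 rT]; apply: d1; rewrite mulN1r normrN ger0_norm.
- by move=> r /andP[r0 rT]; apply: d2; rewrite mulN1r normrN ger0_norm.
- by move=> r /andP[r0 rT]; have := H (- r); rewrite mulN1r normrN ger0_norm// => ->.
- by rewrite -(ltr0_norm t0) normr_ge0.
Qed.

(** A Picard step is controlled on the segment from [- T] to [T] only; composing with this
    retraction gives iterates continuous on the whole line, as [Fcont] demands. *)
Let clamp (t : R) := Num.max (- T) (Num.min t T).

Lemma clamp_id t : `|t| <= T -> clamp t = t.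
Proof.
by move=> /ler_normlP[t1 t2]; rewrite /clamp (min_idPl t2) (max_idPr _)// lerNl.
Qed.

Lemma clamp_le t : `|clamp t| <= T.
Proof.
rewrite /clamp ler_norml le_max lexx/= ge_max ge_min lexx orbT andbT.
by rewrite (@le_trans _ _ 0)// ?oppr_le0 ltW.
Qed.

Lemma clamp_continuous : continuous clamp.
Proof.
move=> t.
have : {for t, continuous ((cst (- T) : R -> R^o) \max ((id : R -> R^o) \min cst T))}.
  apply: continuous_max; first exact: cvg_cst.
  by apply: continuous_min; [exact: cvg_id|exact: cvg_cst].
exact.
Qed.

Theorem picard : exists phi : R -> 'rV[R]_m, phi 0 = z /\
  forall t : R, `|t| <= T -> is_derive t 1 phi (F t (phi t)).
Proof.
have /choice[S HS] := picard_step_ex.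
pose phi := fix phi (k : nat) : R -> 'rV[R]_m :=
  if k is k'.+1 then S (phi k') \o clamp else cst z.
have cS f : continuous f -> continuous (S f \o clamp).
  move=> cf t; apply: continuous_comp; first exact: clamp_continuous.
  by have [_ /(_ _ (clamp_le t))/is_derive_continuous] := HS f cf.
have cphi k : continuous (phi k).
  by elim: k => [|k IH]; [move=> t; exact: cvg_cst|exact: cS].
(* [B * T] bounds the first increment; the [+ 1] makes the constant positive for the contraction
   lemma. *)
pose M := B * T + 1.
have B0 : 0 <= B by exact: le_trans (Fbound 0).
have M0 : 0 < M by rewrite ltr_wpDl// mulr_ge0// ltW.
have c0 : 0 <= c by rewrite addr_ge0// mulr_ge0.
have exp1 (t : R) : 1 <= expR (c * `|t|) by rewrite -expR0 ler_expR mulr_ge0.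
have base (t : R) : `|t| <= T -> `|phi 1%N t - phi 0%N t| <= M * expR (c * `|t|).
  move=> tT.
  apply: (@le_trans _ _ M); last by rewrite ler_peMr// ltW.
  have [S0 Sd] := HS _ (cphi 0%N).
  have -> : phi 1%N t - phi 0%N t = S (phi 0%N) t - S (phi 0%N) 0 by rewrite S0 /= clamp_id.
  have Sd' (r : R) : `|r| <= T -> is_derive r 1 (S (phi 0%N)) (F r z) by exact: Sd.
  apply: (@le_trans _ _ (B * T)); last by rewrite lerDl.
  move: tT; have [t0|t0] := leP 0 t => tT.
    apply: (@le_trans _ _ (B * (t - 0))); last by rewrite subr0 ler_wpM2l// -(ger0_norm t0).
    apply: (mean_value_le (u' := fun r => F r z)) => // r /andP[r0 rt].
    by apply: Sd'; rewrite ger0_norm// (le_trans rt)// -(ger0_norm t0).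
  rewrite distrC.
  apply: (@le_trans _ _ (B * (0 - t))).
    apply: (mean_value_le (u' := fun r => F r z)) => //; first exact: ltW.
    move=> r /andP[rt r0].
    by apply: Sd'; apply: le_trans tT; rewrite ler0_norm// ltr0_norm// lerN2.
  by rewrite sub0r ler_wpM2l// -(ltr0_norm t0).
have step k (t : R) : `|t| <= T -> `|phi k.+1 t - phi k t| <= M * 2^-1 ^+ k * expR (c * `|t|).
  elim: k t => [|k IH] t tT; first by rewrite expr0 mulr1; exact: base.
  have := @picard_contract (phi k.+1) (phi k) _ _ (M * 2^-1 ^+ k) _ (cphi _) (cphi _)
    (HS _) (HS _) IH t tT.
  rewrite {1 2}/phi -/phi /= !clamp_id// exprSr mulrA; apply.
  by rewrite mulr_gt0// exprn_gt0// invr_gt0.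
pose C := M * expR (c * T).
have stepC k (t : R) : `|t| <= T -> `|phi k.+1 t - phi k t| <= C * 2^-1 ^+ k.
  move=> tT; apply: (le_trans (step k t tT)).
  rewrite /C mulrAC ler_wpM2r// ?exprn_ge0 ?invr_ge0// ler_wpM2l ?(ltW M0)//.
  by rewrite ler_expR ler_wpM2l.
(* Evaluating at [clamp t] gives a limit at every real time, with a uniform rate from which its
   continuity follows. *)
have /choice[lm Hlm] (t : R) : exists l, forall k, `|l - phi k (clamp t)| <= 2 * C * 2^-1 ^+ k.
  by apply: geometric_cvg => k; apply: stepC; exact: clamp_le.
have C0 : 0 < C by rewrite mulr_gt0// expR_gt0.
have D0 k : 0 <= 2 * C * 2^-1 ^+ k.
  apply: mulr_ge0; last by rewrite exprn_ge0// invr_ge0.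
  by apply: mulr_ge0 => //; exact: ltW.
have small e : 0 < e -> exists k : nat, 2 * C * 2^-1 ^+ k <= e.
  move=> e0; have := @cvg_geometric R (2 * C) 2^-1.
  rewrite ger0_norm ?invr_ge0// => /(_ ltac:(rewrite invf_lt1 ?ltr1n//)).
  move/cvgrPdist_le => /(_ e e0) [k _ /(_ k (leqnn k))].
  rewrite /geometric /= sub0r normrN ger0_norm; first by exists k.
  exact: D0.
have clm : continuous lm.
  move=> t; apply/cvgrPdist_le => e e0.
  have e30 : 0 < e / 3 by rewrite divr_gt0.
  have [k ke] := small _ e30.
  have ck : {for t, continuous (phi k \o clamp)}.
    by apply: continuous_comp; [exact: clamp_continuous|exact: cphi].
  move/cvgrPdist_le: ck => /(_ _ e30); apply: filterS => s /= ts.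
  have -> : lm t - lm s = (lm t - phi k (clamp t)) + (phi k (clamp t) - phi k (clamp s)) +
      (phi k (clamp s) - lm s) by apply/rowP => i; rewrite !mxE; ring.
  have := le_trans (Hlm t k) ke; have := le_trans (Hlm s k) ke; rewrite distrC => A D.
  apply: (le_trans (ler_normD _ _)); have := ler_normD (lm t - phi k (clamp t)) (phi k (clamp t) - phi k (clamp s)).
  lra.
have [S0 Sd] := HS _ clm.
exists (S lm); split=> // t tT; suff -> : S lm t = lm t by exact: Sd.
(* The limit is a fixed point because [S lm] and [lm] are both close to [phi k.+1]: the former by
   contraction, the latter by the rate of convergence. *)
apply/eqP; rewrite -subr_eq0 -normr_le0; apply/ler_addgt0Pr => e e0; rewrite add0r.
pose K := expR (c * T) + 1.
have K1 : 1 <= K by rewrite lerDr expR_ge0.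
have K0 : 0 < K by exact: lt_le_trans K1.
have [k ke] := small _ (divr_gt0 e0 K0).
have H1 : `|S lm t - phi k.+1 t| <= 2 * C * 2^-1 ^+ k / 2 * expR (c * `|t|).
  rewrite /= clamp_id//.
  apply: (picard_contract _ clm (cphi k) (HS _) (HS _)) => //.
    by apply: mulr_gt0; [apply: mulr_gt0|rewrite exprn_gt0// invr_gt0].
  move=> s sT; have := Hlm s k; rewrite clamp_id// => /le_trans; apply.
  by rewrite ler_peMr.
have H2 := Hlm t k.+1; rewrite clamp_id// in H2.
have -> : S lm t - lm t = (S lm t - phi k.+1 t) - (lm t - phi k.+1 t).
  by rewrite opprB addrA subrK.
apply: (le_trans (ler_normB _ _)).
apply: (le_trans (lerD H1 H2)).
apply: (@le_trans _ _ ((2 * C * 2^-1 ^+ k) * K)); last by rewrite -ler_pdivlMr.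
set D := 2 * C * 2^-1 ^+ k.
have D0' : 0 <= D by exact: D0.
have -> : 2 * C * 2^-1 ^+ k.+1 = D / 2 by rewrite exprSr mulrA.
rewrite /K mulrDr mulr1 lerD//; last by rewrite ler_pdivrMr// mulr2n mulrDr mulr1 lerDl.
have D2 : D / 2 <= D by rewrite ler_pdivrMr// mulr2n mulrDr mulr1 lerDl.
have eT : expR (c * `|t|) <= expR (c * T) by rewrite ler_expR ler_wpM2l.
by apply: ler_pM => //; rewrite ?divr_ge0// expR_ge0.
Qed.

End Picard.

(** * Gronwall bounds and uniqueness near a given trajectory *)

Section Tube.
Context {R : realType} {m : nat}.
Variables (U : set 'rV[R]_m) (f : 'rV[R]_m -> 'rV[R]_m).
Hypotheses (oU : open U) (fC1 : Ck_on 1 U f).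
Local Notation Df := (total_derivative f).

(* [is_tube T phi e r]: [f] is uniformly approximated to first order, up to the factor [e], in
   the [r]-neighbourhood of [phi]; the bound [r^-1] plays the role of a Lipschitz constant. *)
Definition is_tube (T : R) (phi : R -> 'rV[R]_m) (e r : R) :=
  forall t, 0 <= t <= T ->
    (forall y, `|y - phi t| <= r -> [/\ U y,
      `|f y - f (phi t) - Df (phi t) (y - phi t)| <= e * `|y - phi t| &
      `|f y - f (phi t)| <= r^-1 * `|y - phi t|]) /\
    (forall v, `|Df (phi t) v| <= r^-1 * `|v|).

(** Strict expansion at [y0] compares increments with the differential at [y0], and continuity of
    the partial derivatives moves it to [x]; each costs [e / 2]. The estimate is uniform in the
    centre [x] and valid for all smaller radii, which is what compactness of the time interval
    needs. *)
Lemma tube_local (y0 : 'rV[R]_m) (e : R) : U y0 -> 0 < e ->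
  exists2 r, 0 < r & forall x, `|x - y0| < r -> forall s, 0 < s < r ->
    (forall y, `|y - x| <= s -> [/\ U y,
      `|f y - f x - Df x (y - x)| <= e * `|y - x| &
      `|f y - f x| <= s^-1 * `|y - x|]) /\
    (forall v, `|Df x v| <= s^-1 * `|v|).
Proof.
move=> Uy0 e0; have e20 : 0 < e / 2 by rewrite divr_gt0.
have [r1 r10 [U1 H1]] := C1_strict_expansion oU Uy0 fC1 e20.
pose K := \sum_i `|'D_(delta_mx 0 i) f y0|.
have K0 : 0 <= K by rewrite sumr_ge0.
pose eta := e / 2 / m.+1%:R.
have eta0 : 0 < eta by rewrite !divr_gt0.
have : \forall x \near y0, forall i : 'I_m,
    `|'D_(delta_mx 0 i) f y0 - 'D_(delta_mx 0 i) f x| <= eta.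
  have Hi i : \forall x \near y0, `|'D_(delta_mx 0 i) f y0 - 'D_(delta_mx 0 i) f x| <= eta.
    have [_ /(_ (delta_mx 0 i))[_ [ci _]]] := fC1.
    by have /cvgrPdist_le := ci y0 Uy0; exact.
  exact: filter_forall Hi.
rewrite -nbhs_nearE => /nbhs_normP[r2 /= r20 H2].
have DfB x v : `|x - y0| < r2 -> `|Df x v - Df y0 v| <= e / 2 * `|v|.
  move=> xr; rewrite /total_derivative -sumrB; apply: (le_trans (ler_norm_sum _ _ _)).
  apply: (@le_trans _ _ (\sum_(i < m) eta * `|v|)).
    apply: ler_sum => i _; rewrite -scalerBr normrZ mulrC.
    apply: ler_pM => //; last exact: le_mx_norm.
    by rewrite distrC; apply: H2; rewrite /= distrC.
  rewrite sumr_const card_ord -mulrnAl ler_wpM2r// /eta -mulr_natr mulrAC ler_pdivrMr//.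
  by rewrite ler_wpM2l ?(ltW e20)// ler_nat.
(* The last term makes [s^-1] exceed [K + 2 * e], hence both the bound [K + e / 2] of the
   differential and the Lipschitz bound [K + e / 2 + e] of [f]. *)
pose r := Num.min (Num.min (r1 / 2) r2) (K + 2 * e)^-1.
have Ke : 0 < K + 2 * e by rewrite ltr_wpDl// mulr_gt0.
have r0 : 0 < r by rewrite !lt_min r20 invr_gt0 Ke divr_gt0.
exists r => // x; rewrite !lt_min -!andbA => /and3P[xr1 xr2 _] s /andP[s0].
rewrite !lt_min -!andbA => /and3P[sr1 sr2 sK].
have Ks : K + 2 * e <= s^-1 by rewrite -[leLHS]invrK lef_pV2 ?posrE ?invr_gt0// ltW.
have Dx v : `|Df x v| <= (K + e / 2) * `|v|.
  rewrite -(subrK (Df y0 v) (Df x v)) addrC mulrDl.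
  apply: (le_trans (ler_normD _ _)); rewrite lerD//; last exact: DfB.
  exact: total_derivative_bound.
split; last first.
  move=> v; apply: (le_trans (Dx v)); rewrite ler_wpM2r//; apply: le_trans Ks; lra.
move=> y ys.
have xr : `|x - y0| < r1 by lra.
have yr : `|y - y0| < r1.
  rewrite -(subrK x y) -addrA; apply: (le_lt_trans (ler_normD _ _)); lra.
have A : `|f y - f x - Df x (y - x)| <= e * `|y - x|.
  rewrite -(subrK (Df y0 (y - x)) (f y - f x)) -addrA.
  apply: (le_trans (ler_normD _ _)); rewrite [e in leRHS]splitr mulrDl lerD//.
    exact: H1.
  by rewrite distrC; exact: DfB.
split=> //; first exact: U1.
rewrite -(subrK (Df x (y - x)) (f y - f x)).
apply: (le_trans (ler_normD _ _)); apply: (le_trans (lerD A (Dx _))).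
rewrite -mulrDl ler_wpM2r//; apply: le_trans Ks; lra.
Qed.

(** Local radii exist around every point of the trajectory; the near-covering form of compactness,
    with radii tending to 0 from the right as the filter, extracts one that works for all times. *)
Lemma tube_ex (T : R) (phi : R -> 'rV[R]_m) (e : R) : 0 < e ->
  (forall t, 0 <= t <= T -> U (phi t) /\ {for t, continuous phi}) ->
  exists2 r, 0 < r & is_tube T phi e r.
Proof.
move=> e0 Hphi.
have : \forall r \near (0 : R)^'+, forall t, t \in `[0, T]%R ->
    (forall y, `|y - phi t| <= r -> [/\ U y,
      `|f y - f (phi t) - Df (phi t) (y - phi t)| <= e * `|y - phi t| &
      `|f y - f (phi t)| <= r^-1 * `|y - phi t|]) /\
    (forall v, `|Df (phi t) v| <= r^-1 * `|v|).
  have /compact_near_coveringP := @segment_compact R 0 T.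
  move=> /(_ _ (0 : R)^'+ (fun r t => (forall y, `|y - phi t| <= r -> [/\ U y,
      `|f y - f (phi t) - Df (phi t) (y - phi t)| <= e * `|y - phi t| &
      `|f y - f (phi t)| <= r^-1 * `|y - phi t|]) /\
    (forall v, `|Df (phi t) v| <= r^-1 * `|v|)) _) H.
  apply: H => t; rewrite /= in_itv/= => tT.
  have [Ut ct] := Hphi t tT.
  have [r r0 Hr] := tube_local Ut e0.
  near=> t' s; apply: Hr.
    have : `|phi t - phi t'| < r by near: t'; exact: cvgr_dist_lt.
    by rewrite distrC.
  rewrite /=; apply/andP; split; near: s; [exact: nbhs_right_gt|exact: nbhs_right_lt].
move=> H; near (0 : R)^'+ => r; exists r; first by near: r; exact: nbhs_right_gt.
have : forall t, t \in `[0, T]%R ->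
    (forall y, `|y - phi t| <= r -> [/\ U y,
      `|f y - f (phi t) - Df (phi t) (y - phi t)| <= e * `|y - phi t| &
      `|f y - f (phi t)| <= r^-1 * `|y - phi t|]) /\
    (forall v, `|Df (phi t) v| <= r^-1 * `|v|) by near: r.
by move=> K t tT; apply: K; rewrite in_itv.
Unshelve. all: by end_near. Qed.

(** The condition on [a] keeps the bound below [r] until time [T], so [psi] is in the tube whenever
    the bound holds and the Lipschitz estimate may be used. The [+ 1] in the exponent makes the
    comparison of speeds strict. *)
Lemma tube_gronwall T phi psi e r a : is_tube T phi e r -> 0 < r ->
  (forall t, 0 <= t <= T -> is_derive t 1 phi (f (phi t))) ->
  (forall t, 0 <= t <= T -> is_derive t 1 psi (f (psi t))) ->
  0 < a -> `|psi 0 - phi 0| <= a -> a * expR ((r^-1 + 1) * T) <= r ->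
  forall t, 0 <= t <= T -> `|psi t - phi t| <= a * expR ((r^-1 + 1) * t).
Proof.
move=> tube r0 dphi dpsi a0 pa ar.
have c0 : 0 <= r^-1 + 1 by rewrite addr_ge0// invr_ge0 ltW.
apply: (norm_le_comparison (u := fun t => psi t - phi t)
  (u' := fun t => f (psi t) - f (phi t)) (w := fun t => a * expR ((r^-1 + 1) * t))
  (w' := fun t => a * ((r^-1 + 1) * expR ((r^-1 + 1) * t)))).
- by move=> t tT; apply: is_deriveB; [exact: dpsi|exact: dphi].
- by move=> t _; apply: (is_deriveZ (f := fun s : R => expR ((r^-1 + 1) * s))); exact: is_derive_expRM.
- by rewrite mulr0 expR0 mulr1.
- move=> t /andP[t0 tT] H; have [tub _] := tube t ltac:(by rewrite t0 ltW).
  have H2 : a * expR ((r^-1 + 1) * t) <= r.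
    apply: le_trans ar; rewrite ler_wpM2l ?(ltW a0)// ler_expR ler_wpM2l//; exact: ltW.
  have [_ _ K] := tub _ (le_trans H H2).
  apply: (le_lt_trans K); apply: (@le_lt_trans _ _ (r^-1 * (a * expR ((r^-1 + 1) * t)))).
    by rewrite ler_wpM2l// invr_ge0 ltW.
  by rewrite mulrCA ltr_pM2l// ltr_pM2r ?expR_gt0// ltrDl.
Qed.

(** The Gronwall bound is available with every small [a], since the initial gap is 0; letting [a]
    shrink forces [psi] onto [phi]. *)
Lemma ode_unique T (phi psi : R -> 'rV[R]_m) : 
  (forall t, 0 <= t <= T -> U (phi t) /\ is_derive t 1 phi (f (phi t))) ->
  (forall t, 0 <= t <= T -> is_derive t 1 psi (f (psi t))) ->
  phi 0 = psi 0 -> forall t, 0 <= t <= T -> phi t = psi t.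
Proof.
move=> dphi dpsi p0 t tT.
have [r r0 tube] : exists2 r, 0 < r & is_tube T phi 1 r.
  apply: tube_ex => // s sT; have [Us ds] := dphi s sT; split=> //.
  exact: is_derive_continuous ds.
apply/esym/eqP; rewrite -subr_eq0 -normr_le0; apply/ler_addgt0Pr => e e0; rewrite add0r.
pose E := expR ((r^-1 + 1) * T).
have E0 : 0 < E by exact: expR_gt0.
pose a := Num.min (r / E) (e / E).
have a0 : 0 < a by rewrite lt_min !divr_gt0.
have := @tube_gronwall T phi psi 1 r a tube r0 _ dpsi a0 _ _ t tT.
move=> /(_ (fun s sT => (dphi s sT).2)); rewrite p0 subrr normr0 => /(_ (ltW a0)).
have ar : a * E <= r by rewrite -ler_pdivlMr// ge_min lexx.
move=> /(_ ar) H; apply: (le_trans H).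
apply: (@le_trans _ _ (a * E)); last by rewrite -ler_pdivlMr// ge_min lexx orbT.
move: tT => /andP[t0 tT].
by rewrite ler_wpM2l ?(ltW a0)// ler_expR ler_wpM2l// addr_ge0// invr_ge0 ltW.
Qed.

End Tube.

(** * Dependence of the flow on the initial condition *)

Definition is_flow (R : realType) m (U : set 'rV[R]_m) (f : 'rV[R]_m -> 'rV[R]_m)
    (W : set 'rV[R]_m) (T : R) (Phi : R -> 'rV[R]_m -> 'rV[R]_m) :=
  forall x, W x -> Phi 0 x = x /\ forall t : R, 0 <= t <= T ->
    U (Phi t x) /\ is_derive t 1 (Phi^~ x) (f (Phi t x)).

Section Flow.
Context {R : realType} {m : nat}.
Variables (U : set 'rV[R]_m) (f : 'rV[R]_m -> 'rV[R]_m) (W : set 'rV[R]_m).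
Variables (T : R) (Phi : R -> 'rV[R]_m -> 'rV[R]_m).
Hypotheses (oU : open U) (fC1 : Ck_on 1 U f) (oW : open W) (T0 : 0 <= T).
Hypothesis flow : is_flow U f W T Phi.
Local Notation Df := (total_derivative f).

Lemma flow_tube x e : W x -> 0 < e ->
  exists2 r, 0 < r & is_tube U f T (Phi^~ x) e r.
Proof.
move=> Wx e0; apply: tube_ex => // t tT.
have [Ut dt] := (flow Wx).2 t tT; split=> //; exact: is_derive_continuous dt.
Qed.

Lemma flow_gronwall x y e r a : W x -> W y -> is_tube U f T (Phi^~ x) e r -> 0 < r ->
  0 < a -> `|y - x| <= a -> a * expR ((r^-1 + 1) * T) <= r ->
  forall t, 0 <= t <= T -> `|Phi t y - Phi t x| <= a * expR ((r^-1 + 1) * T).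
Proof.
move=> Wx Wy tube r0 a0 yx ar t /andP[t0 tT].
have H := tube_gronwall tube r0 (fun s sT => ((flow Wx).2 s sT).2)
  (fun s sT => ((flow Wy).2 s sT).2) a0.
have := H _ ar t; rewrite (flow Wx).1 (flow Wy).1 => /(_ yx) {}H.
apply: (le_trans (H _)); first by rewrite t0.
rewrite ler_wpM2l ?(ltW a0)// ler_expR ler_wpM2l// addr_ge0// invr_ge0 ltW//.
Qed.

Lemma flow_continuous x t : W x -> 0 <= t <= T -> {for x, continuous (Phi t)}.
Proof.
move=> Wx tT; have [r r0 tube] := flow_tube Wx ltr01.
apply/continuous_distP => e e0.
pose E := expR ((r^-1 + 1) * T); have E0 : 0 < E by exact: expR_gt0.
pose a := Num.min (r / E) (e / E).
have a0 : 0 < a by rewrite lt_min !divr_gt0.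
have [d d0 dW] := open_ball_ex oW Wx.
exists (Num.min a d); first by rewrite lt_min a0.
move=> y; rewrite lt_min => /andP[/ltW yx /dW Wy].
have ar : a * E <= r by rewrite -ler_pdivlMr// ge_min lexx.
apply: (le_trans (flow_gronwall Wx Wy tube r0 a0 yx ar tT)).
by rewrite -/E -ler_pdivlMr// ge_min lexx orbT.
Qed.

(** The equation is linear in [Y] with coefficients bounded along the trajectory, thanks to a tube,
    so [picard] solves it over the full interval. Freezing the coefficients outside the interval of
    the flow extends them to all times. *)
Lemma variational_ex x w : W x -> exists Y : R -> 'rV[R]_m, Y 0 = w /\
  forall t : R, 0 <= t <= T -> is_derive t 1 Y (Df (Phi t x) (Y t)).
Proof.
move=> Wx; have [r r0 tube] := flow_tube Wx ltr01.
pose clamp (t : R) := Num.max 0 (Num.min t T).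
have clampT t : 0 <= clamp t <= T.
  by rewrite /clamp le_max lexx/= ge_max T0 ge_min lexx orbT.
have clamp_id t : 0 <= t <= T -> clamp t = t.
  by move=> /andP[t0 tT]; rewrite /clamp (min_idPl tT) (max_idPr t0).
have cclamp : continuous clamp.
  move=> t.
  have : {for t, continuous ((cst 0 : R -> R^o) \max ((id : R -> R^o) \min cst T))}.
    apply: continuous_max; first exact: cvg_cst.
    by apply: continuous_min; [exact: cvg_id|exact: cvg_cst].
  exact.
pose F (t : R) y := Df (Phi (clamp t) x) y.
have Fc (phi : R -> 'rV[R]_m) : continuous phi -> continuous (fun t => F t (phi t)).
  move=> cphi t; rewrite /F /total_derivative.
  suff : Ck_on 0 (setT : set R^o) (fun t : R^o =>
      \sum_i phi t 0 i *: 'D_(delta_mx 0 i) f (Phi (clamp t) x)) by move=> [+ _]; exact.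
  apply: Ck_on_sum; first exact: openT.
  move=> i; apply: Ck_onZ; first exact: openT.
    split=> // s _; apply: (continuous_comp (f := phi) (g := fun M : 'rV[R]_m => M 0 i)).
      exact: cphi.
    exact: coord_continuous.
  split=> // s _; have [Us ds] := (flow Wx).2 _ (clampT s).
  apply: (continuous_comp (f := fun t => Phi (clamp t) x) (g := 'D_(delta_mx 0 i) f)).
    apply: (continuous_comp (f := clamp) (g := Phi^~ x)); first exact: cclamp.
    exact: is_derive_continuous ds.
  by have [_ /(_ (delta_mx 0 i))[_ [c1 _]]] := fC1; exact: c1.
have FL t y y' : `|F t y - F t y'| <= r^-1 * `|y - y'|.
  have lin := total_derivative_linear f (Phi (clamp t) x).
  have -> : F t y - F t y' = F t (y - y').
    have := lin (-1) y' y; rewrite !scaleN1r [- y' + y]addrC => E.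
    by rewrite /F E addrC.
  by have [_ ->] := tube _ (clampT t).
have FB t : `|F t w| <= r^-1 * `|w| by have [_ ->] := tube _ (clampT t).
have r10 : 0 <= r^-1 by rewrite invr_ge0 ltW.
have T1 : 0 < T + 1 by rewrite ltr_wpDl.
have [Y [Y0 Yd]] := picard r10 T1 Fc FL FB.
exists Y; split=> // t tT; have := Yd t.
rewrite /F clamp_id//; apply; move/andP: tT => [t0 tT].
by rewrite ger0_norm// (le_trans tT)// lerDl.
Qed.

(** The first-order error of the flow solves the variational equation up to a source [eta], the
    first-order error of [f]. A first tube bounds the distance between the trajectories, a second
    and finer one bounds the source, and comparison bounds the solution. *)
Lemma flow_is_derive x w (Y : R -> 'rV[R]_m) : W x -> Y 0 = w ->
  (forall t : R, 0 <= t <= T -> is_derive t 1 Y (Df (Phi t x) (Y t))) ->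
  forall t, 0 <= t <= T -> is_derive x w (Phi t) (Y t).
Proof.
move=> Wx Y0 Yd t tT; apply/is_deriveP => e e0.
have [r1 r10 tube1] := flow_tube Wx ltr01.
pose L := r1^-1; have L0 : 0 <= L by rewrite invr_ge0 ltW.
pose E1 := expR ((L + 1) * T); have E10 : 0 < E1 by exact: expR_gt0.
(* Beyond the Lipschitz constant [L], the rate [L + 2] leaves room for the source term and for
   strictness. *)
pose E2 := expR ((L + 2) * T); have E20 : 0 < E2 by exact: expR_gt0.
have w0 : 0 < `|w| + 1 by rewrite ltr_wpDl.
(* Chosen so that the final bound [e2 * (a * E1) * E2] is exactly [e] times the absolute value of
   [h]. *)
pose e2 := e / ((`|w| + 1) * E1 * E2).
have e20 : 0 < e2 by rewrite divr_gt0// !mulr_gt0.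
have [r2 r20 tube2] := flow_tube Wx e20.
pose rho := Num.min r1 r2 / ((`|w| + 1) * E1).
have rho0 : 0 < rho by rewrite divr_gt0 ?lt_min ?r10// mulr_gt0.
have cW : (x + h *: w) @[h --> (0 : R)] --> x.
  rewrite -[X in _ --> X]addr0 -(scale0r w).
  by apply: cvgD; [exact: cvg_cst|apply: cvgZl; exact: cvg_id].
near=> h.
have [->|h0] := eqVneq h 0; first by rewrite !scale0r addr0 !subrr !normr0 mulr0.
have hrho : `|h| <= rho by near: h; exact: (@nbhs0_le _ R).
have Wh : W (x + h *: w) by near: h; apply: cW; exact: open_nbhs_nbhs.
pose a := `|h| * (`|w| + 1).
have a0 : 0 < a by rewrite mulr_gt0// normr_gt0.
have aE : a * E1 <= Num.min r1 r2.
  by rewrite /a -mulrA -ler_pdivlMr// mulr_gt0.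
have aE1 : a * E1 <= r1 by rewrite (le_trans aE)// ge_min lexx.
have aE2 : a * E1 <= r2 by rewrite (le_trans aE)// ge_min lexx orbT.
have yx : `|x + h *: w - x| <= a.
  by rewrite [x + _]addrC addrK normrZ ler_wpM2l// lerDl.
have G := flow_gronwall Wx Wh tube1 r10 a0 yx aE1.
pose eta := e2 * (a * E1); have eta0 : 0 < eta by apply: mulr_gt0 => //; exact: mulr_gt0.
have dL s : 0 <= s <= T -> linear (Df (Phi s x)) by move=> _; exact: total_derivative_linear.
have H : `|Phi t (x + h *: w) - Phi t x - h *: Y t| <= eta * expR ((L + 2) * t).
  apply: (norm_le_comparison (u := fun s => Phi s (x + h *: w) - Phi s x - h *: Y s)
    (u' := fun s => f (Phi s (x + h *: w)) - f (Phi s x) - h *: Df (Phi s x) (Y s))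
    (w := fun s => eta * expR ((L + 2) * s))
    (w' := fun s => eta * ((L + 2) * expR ((L + 2) * s))) (a := 0) (b := T)) => //.
  - move=> s sT; apply: is_deriveB; last by apply: is_deriveZ; exact: Yd.
    by apply: is_deriveB; [have [] := (flow Wh).2 s sT|have [] := (flow Wx).2 s sT].
  - by move=> s _; apply: (is_deriveZ (f := fun s : R => expR ((L + 2) * s))); exact: is_derive_expRM.
  - rewrite (flow Wh).1 (flow Wx).1 Y0 [x + _]addrC addrK subrr normr0.
    by rewrite mulr_ge0// ?expR_ge0// ltW.
  - move=> s /andP[s0 sT] us.
    have sT' : 0 <= s <= T by rewrite s0 ltW.
    set p := Phi s (x + h *: w); set q := Phi s x.
    have [tub _] := tube2 s sT'; have [_ dq] := tube1 s sT'.
    have [_ K _] := tub p (le_trans (G s sT') aE2).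
    have -> : f p - f q - h *: Df q (Y s) = (f p - f q - Df q (p - q)) + Df q (p - q - h *: Y s).
      have lin := dL s sT'.
      have := lin (- h) (Y s) (p - q); rewrite scaleNr [- _ + (p - q)]addrC => ->.
      by rewrite scaleNr; apply/rowP => i; rewrite !mxE; ring.
    apply: (le_lt_trans (ler_normD _ _)).
    have K2 : `|f p - f q - Df q (p - q)| <= eta.
      by apply: (le_trans K); rewrite ler_wpM2l ?(ltW e20)//; exact: G.
    have K3 := le_trans (dq (p - q - h *: Y s)) (ler_wpM2l L0 us).
    apply: (le_lt_trans (lerD K2 K3)).
    set X := expR _; have X1 : 1 <= X by rewrite -expR0 ler_expR mulr_ge0// addr_ge0.
    have -> : eta * ((L + 2) * X) = eta * (2 * X) + L * (eta * X) by ring.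
    rewrite ltrD2r -[ltLHS]mulr1 ltr_pM2l//; lra.
apply: (le_trans H); move/andP: tT => [t0 tT].
apply: (@le_trans _ _ (eta * E2)).
  by rewrite ler_wpM2l ?(ltW eta0)// ler_expR ler_wpM2l// addr_ge0.
rewrite /eta /e2 /a le_eqVlt; apply/orP; left; apply/eqP; field.
by rewrite !gt_eqF.
Unshelve. all: by end_near. Qed.

End Flow.

Lemma Ck_on_row_mx (R : realType) (V : normedModType R) m n1 n2 k (U : set V)
    (A : V -> 'M[R]_(m, n1)) (B : V -> 'M[R]_(m, n2)) : open U ->
  Ck_on k U A -> Ck_on k U B -> Ck_on k U (fun x => row_mx (A x) (B x)).
Proof.
move=> oU /(Ck_on_mxP _ _ oU) hA /(Ck_on_mxP _ _ oU) hB.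
apply/(Ck_on_mxP _ _ oU) => i j; case: (split_ordP j) => l ->.
  by under eq_fun do rewrite row_mxEl; exact: hA.
by under eq_fun do rewrite row_mxEr; exact: hB.
Qed.

Lemma Ck_on_mxsub (R : realType) (V : normedModType R) m n m' n' k (U : set V)
    (A : V -> 'M[R]_(m, n)) (B : V -> 'M[R]_(m', n')) (p : 'I_m' -> 'I_m) (q : 'I_n' -> 'I_n) :
  open U -> (forall x i j, B x i j = A x (p i) (q j)) -> Ck_on k U A -> Ck_on k U B.
Proof.
move=> oU BA /(Ck_on_mxP _ _ oU) hA; apply/(Ck_on_mxP _ _ oU) => i j.
by under eq_fun do rewrite BA; exact: hA.
Qed.

Lemma Ck_on_lsubmx (R : realType) (V : normedModType R) m n1 n2 k (U : set V)
    (A : V -> 'M[R]_(m, n1 + n2)) : open U ->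
  Ck_on k U A -> Ck_on k U (fun x => lsubmx (A x)).
Proof. by move=> oU; apply: Ck_on_mxsub => // x i j; rewrite mxE. Qed.

Lemma Ck_on_rsubmx (R : realType) (V : normedModType R) m n1 n2 k (U : set V)
    (A : V -> 'M[R]_(m, n1 + n2)) : open U ->
  Ck_on k U A -> Ck_on k U (fun x => rsubmx (A x)).
Proof. by move=> oU; apply: Ck_on_mxsub => // x i j; rewrite mxE. Qed.

Lemma is_derive_row_mx (R : realType) (V : normedModType R) m n1 n2 
    (A : V -> 'M[R]_(m, n1)) (B : V -> 'M[R]_(m, n2)) x v dA dB :
  is_derive x v A dA -> is_derive x v B dB ->
  is_derive x v (fun x => row_mx (A x) (B x)) (row_mx dA dB).
Proof.
move=> /is_derive_mxP hA /is_derive_mxP hB; apply/is_derive_mxP => i j.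
case: (split_ordP j) => l ->.
  by rewrite row_mxEl; under eq_fun do rewrite row_mxEl; exact: hA.
by rewrite row_mxEr; under eq_fun do rewrite row_mxEr; exact: hB.
Qed.

Lemma open_preimage_Ck (R : realType) (V W : normedModType R) k (U : set V) (f : V -> W)
    (B : set W) : open U -> open B -> Ck_on k U f -> open (U `&` f @^-1` B).
Proof.
move=> oU oB fk; rewrite openE => x [Ux Bx]; apply: filterI; first exact: open_nbhs_nbhs.
by have := Ck_on_continuous fk Ux; apply; exact: open_nbhs_nbhs.
Qed.

Lemma total_derivative_smooth (R : realType) n (V W : normedModType R) (U : set V) (O : set 'rV[R]_n)
    (f : 'rV[R]_n -> W) (p q : V -> 'rV[R]_n) : open U -> open O ->
  smooth_on O f -> smooth_on U p -> smooth_on U q -> (forall x, U x -> O (p x)) ->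
  smooth_on U (fun x => total_derivative f (p x) (q x)).
Proof.
move=> oU oO fs ps qs UO k; apply: Ck_on_sum => // i; apply: Ck_onZ => //.
  exact: (Ck_on_mxP _ _ oU).1.
apply: (@Ck_on_comp _ _ _ _ _ _ _ p ('D_(delta_mx 0 i) f) oU oO UO (ps k)); have [_ /(_ (delta_mx 0 i))[]] := fs k.+1.
by [].
Qed.

(* The derivative of the flow of [f] in the initial condition is a component of the flow of
   the tangent field [(x, w) |-> (f x, Df x w)], which allows an induction on the order. *)
Theorem flow_Ck (R : realType) k m (U : set 'rV[R]_m) (f : 'rV[R]_m -> 'rV[R]_m)
    (W : set 'rV[R]_m) (T : R) (Phi : R -> 'rV[R]_m -> 'rV[R]_m) :
  open U -> smooth_on U f -> open W -> 0 <= T -> is_flow U f W T Phi ->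
  forall t, 0 <= t <= T -> Ck_on k W (Phi t).
Proof.
(* The dimension is generalized because the induction hypothesis is applied to the tangent field, in
   dimension [m + m]. *)
elim: k m U f W Phi => [|k IH] m U f W Phi oU fs oW T0 flow t tT.
  by split=> // x Wx; exact: (flow_continuous oU (fs 1%N) oW flow Wx tT).
pose l (z : 'rV[R]_(m + m)) : 'rV[R]_m := lsubmx z.
pose r (z : 'rV[R]_(m + m)) : 'rV[R]_m := rsubmx z.
pose preim (A : set 'rV[R]_m) := setT `&` l @^-1` A.
have oTT : open (setT : set 'rV[R]_(m + m)) by exact: openT.
have ls : smooth_on setT l by move=> j; apply: Ck_on_lsubmx => //; exact: Ck_on_id.
have rs : smooth_on setT r by move=> j; apply: Ck_on_rsubmx => //; exact: Ck_on_id.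
have opre A : open A -> open (preim A) by move=> oA; apply: open_preimage_Ck (ls 0%N).
pose f2 z := row_mx (f (l z)) (total_derivative f (l z) (r z)).
have f2s : smooth_on (preim U) f2.
  move=> j; apply: Ck_on_row_mx; first exact: opre.
    apply: (Ck_on_comp _ oU _ _ (fs j)); [exact: opre|by move=> x []|].
    by apply: Ck_on_sub (ls j).
  suff : smooth_on (preim U) (fun z => total_derivative f (l z) (r z)) by exact.
  apply: (total_derivative_smooth (opre _ oU) oU fs); [| |by move=> x []].
    by move=> i; apply: Ck_on_sub (ls i).
  by move=> i; apply: Ck_on_sub (rs i).
have /choice[Y HY] (z : 'rV[R]_(m + m)) : exists Y : R -> 'rV[R]_m, W (l z) -> Y 0 = r z /\
    forall t : R, 0 <= t <= T -> is_derive t 1 Y (total_derivative f (Phi t (l z)) (Y t)).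
  have [Wz|nW] := pselect (W (l z)); last by exists (cst 0).
  by have [Y HY] := variational_ex oU (fs 1%N) T0 flow (r z) Wz; exists Y.
pose Phi2 t z := row_mx (Phi t (l z)) (Y z t).
have flow2 : is_flow (preim U) f2 (preim W) T Phi2.
  move=> z [_ Wz]; have [Y0 Yd] := HY z Wz; have [p0 pd] := flow _ Wz; split.
    by rewrite /Phi2 Y0 p0 hsubmxK.
  move=> s sT; have [Us ds] := pd s sT; split.
    by split=> //; rewrite /= /l /Phi2 row_mxKl.
  rewrite /f2 /l /r /Phi2 row_mxKl row_mxKr.
  by apply: is_derive_row_mx => //; exact: Yd.
pose emb w (x : 'rV[R]_m) : 'rV[R]_(m + m) := row_mx x w.
have embW w x : W x -> preim W (emb w x) by move=> Wx; split=> //; rewrite /= /l row_mxKl.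
apply: (@Ck_onS _ _ _ _ _ _ (fun w x => r (Phi2 t (emb w x)))) => //.
- by move=> x Wx; exact: (flow_continuous oU (fs 1%N) oW flow Wx tT).
- move=> x w Wx; have [_ Wz] := embW w x Wx; have [Y0 Yd] := HY _ Wz.
  rewrite /r /Phi2 row_mxKr.
  move: Y0 Yd; rewrite /l /r /emb row_mxKl row_mxKr => Y0 Yd.
  exact: (flow_is_derive oU (fs 1%N) oW flow Wx Y0 Yd).
- move=> w; apply: Ck_on_rsubmx => //.
  apply: (Ck_on_comp oW (opre _ oW) (embW w)); last exact: (IH _ _ _ _ _ (opre _ oU) f2s (opre _ oW) T0 flow2).
  by apply: Ck_on_row_mx => //; [exact: Ck_on_id|exact: Ck_on_cst].
Qed.

(** * Inverse functions near the identity *)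

Section CkMatrix.
Context {R : realType} {V : normedModType R}.
Variables (U : set V) (oU : open U) (k : nat).

Lemma Ck_on_mulmx m n p (A : V -> 'M[R]_(m, n)) (B : V -> 'M[R]_(n, p)) :
  Ck_on k U A -> Ck_on k U B -> Ck_on k U (fun x => A x *m B x).
Proof.
move=> /(Ck_on_mxP _ _ oU) hA /(Ck_on_mxP _ _ oU) hB; apply/(Ck_on_mxP _ _ oU) => i j.
under eq_fun do rewrite mxE.
by apply: Ck_on_sum => // l; exact: Ck_onM.
Qed.

Lemma Ck_on_trmx m n (A : V -> 'M[R]_(m, n)) :
  Ck_on k U A -> Ck_on k U (fun x => (A x)^T).
Proof.
move=> /(Ck_on_mxP _ _ oU) hA; apply/(Ck_on_mxP _ _ oU) => i j.
by under eq_fun do rewrite mxE.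
Qed.

Lemma Ck_on_det n (A : V -> 'M[R]_n) : Ck_on k U A -> Ck_on k U (fun x => \det (A x) : R^o).
Proof.
move=> /(Ck_on_mxP _ _ oU) hA; apply: Ck_on_sum => // s.
by apply: Ck_onM => //; [exact: Ck_on_cst|exact: Ck_on_prod].
Qed.

Lemma Ck_on_invmx n (A : V -> 'M[R]_n) : (forall x, U x -> A x \in unitmx) ->
  Ck_on k U A -> Ck_on k U (fun x => invmx (A x)).
Proof.
move=> Au hA.
apply: (@Ck_on_eq _ _ _ _ _ (fun x => (\det (A x))^-1 *: \adj (A x))) => //.
  by move=> x /Au Ax; rewrite /invmx Ax.
apply: Ck_onZ => //.
  apply: Ck_onV => //; last exact: Ck_on_det.
  by move=> x /Au; rewrite unitmxE unitfE.
apply/(Ck_on_mxP _ _ oU) => i j; under eq_fun do rewrite mxE.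
apply: Ck_onM => //; first exact: Ck_on_cst.
apply: Ck_on_det; apply: (Ck_on_mxsub (A := A) (p := lift j) (q := lift i)) => // x a b.
by rewrite !mxE.
Qed.

End CkMatrix.

Lemma mulmx_norm_le (R : realType) m n (A : 'M[R]_(m, n)) :
  exists2 K : R, 0 < K & forall v : 'rV[R]_m, `|v *m A| <= K * `|v|.
Proof.
exists (\sum_i \sum_j `|A i j| + 1).
  by rewrite ltr_wpDl// sumr_ge0// => i _; rewrite sumr_ge0.
move=> v; apply/mx_norm_leP; first by rewrite mulr_ge0// addr_ge0// sumr_ge0// => i _; rewrite sumr_ge0.
move=> a j; rewrite ord1 mxE.
apply: (le_trans (ler_norm_sum _ _ _)); rewrite mulrDl mul1r -[leLHS]addr0 lerD// mulr_suml.
apply: ler_sum => i _; rewrite normrM mulrC ler_pM// ?le_mx_norm//.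
by rewrite (bigD1 j)//= lerDl sumr_ge0.
Qed.

Definition jacobian_mx (R : realType) m n (f : 'rV[R]_m -> 'rV[R]_n) (x : 'rV[R]_m) : 'M[R]_(m, n) :=
  \matrix_(i, j) ('D_(delta_mx 0 i) f x) 0 j.

Lemma total_derivative_mx (R : realType) m n (f : 'rV[R]_m -> 'rV[R]_n) x v :
  total_derivative f x v = v *m jacobian_mx f x.
Proof.
apply/rowP => j; rewrite /total_derivative summxE !mxE; apply: eq_bigr => i _.
by rewrite !mxE.
Qed.

Lemma jacobian_smooth (R : realType) m n (U : set 'rV[R]_m) (f : 'rV[R]_m -> 'rV[R]_n) :
  open U -> smooth_on U f -> smooth_on U (jacobian_mx f).
Proof.
move=> oU fs k; apply/(Ck_on_mxP _ _ oU) => i j; under eq_fun do rewrite mxE.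
have [_ /(_ (delta_mx 0 i))[_ H]] := fs k.+1.
exact: (Ck_on_mxP _ _ oU).1 H 0 j.
Qed.

(* Fixed point iteration [x |-> x + (y - f x)]. *)
Lemma near_identity_surjective (R : realType) n (f : 'rV[R]_n -> 'rV[R]_n) x0 (rho : R) :
  (forall x y, `|x - x0| <= rho -> `|y - x0| <= rho ->
     `|f y - f x - (y - x)| <= 2^-1 * `|y - x|) ->
  forall y, `|y - f x0| <= rho / 2 -> exists x, `|x - x0| <= rho /\ f x = y.
Proof.
move=> fc y yr.
have rho0 : 0 <= rho by have := le_trans (normr_ge0 _) yr; rewrite pmulr_lge0// invr_gt0.
pose u := fix u (k : nat) := if k is k'.+1 then u k' + (y - f (u k')) else x0.
have q0 k : 0 <= (2^-1 : R) ^+ k by rewrite exprn_ge0// invr_ge0.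
(* The increments halve only while the iterates stay in the ball of radius [rho], and they stay
   there because the increments sum to less than [rho]; both claims are therefore proved
   together. *)
have uk k : `|u k.+1 - u k| <= rho / 2 * 2^-1 ^+ k /\ `|u k - x0| <= rho * (1 - 2^-1 ^+ k)
    /\ `|u k.+1 - x0| <= rho * (1 - 2^-1 ^+ k.+1).
  elim: k => [|k [IH1 [IH2 IH3]]].
    have E : u 1%N - u 0%N = y - f x0 by rewrite /= [x0 + _]addrC addrK.
    rewrite E expr0 mulr1 [1 - 1]subrr mulr0 expr1; split=> //.
    split; first by rewrite /= subrr normr0.
    apply: (le_trans yr); rewrite le_eqVlt; apply/orP; left; apply/eqP; by field.
  have ball z l : `|z - x0| <= rho * (1 - 2^-1 ^+ l) -> `|z - x0| <= rho.
    by move=> /le_trans; apply; rewrite ler_piMr// gerBl.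
  have E : u k.+2 - u k.+1 = - (f (u k.+1) - f (u k) - (u k.+1 - u k)).
    by rewrite /= -/(u k.+1) /=; apply/rowP => i; rewrite !mxE; ring.
  have H : `|u k.+2 - u k.+1| <= rho / 2 * 2^-1 ^+ k.+1.
    rewrite E normrN; apply: (le_trans (fc _ _ (ball _ _ IH2) (ball _ _ IH3))).
    by rewrite exprS mulrCA ler_wpM2l// invr_ge0.
  split=> //; split=> //.
  rewrite -(subrK (u k.+1) (u k.+2)) -addrA; apply: (le_trans (ler_normD _ _)).
  apply: (le_trans (lerD H IH3)); rewrite [2^-1 ^+ k.+2]exprS le_eqVlt.
  by apply/orP; left; apply/eqP; field.
have [l Hl] := geometric_cvg (fun k => (uk k).1).
have small e : 0 < e -> exists k : nat, rho * 2^-1 ^+ k <= e.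
  move=> e0; have := @cvg_geometric R rho 2^-1.
  rewrite ger0_norm ?invr_ge0// => /(_ ltac:(rewrite invf_lt1 ?ltr1n//)).
  move/cvgrPdist_le => /(_ e e0) [k _ /(_ k (leqnn k))].
  rewrite /geometric /= sub0r normrN ger0_norm; first by exists k.
  exact: mulr_ge0.
have Hl' k : `|l - u k| <= rho * 2^-1 ^+ k.
  by apply: (le_trans (Hl k)); rewrite mulrC [2 * _]mulrC divfK// mulrC.
have lx : `|l - x0| <= rho by have := Hl' 0%N; rewrite expr0 mulr1.
exists l; split=> //; apply/eqP; rewrite -subr_eq0 -normr_le0.
apply/ler_addgt0Pr => e e0; rewrite add0r.
have e30 : 0 < e / 3 by rewrite divr_gt0.
have [k ke] := small _ e30.
have [U1 [U2 _]] := uk k.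
have ux : `|u k - x0| <= rho by apply: (le_trans U2); rewrite ler_piMr// gerBl.
have -> : f l - y = (f l - f (u k) - (l - u k)) + (l - u k) - (u k.+1 - u k).
  by rewrite /= -/(u k); apply/rowP => i; rewrite !mxE; ring.
apply: (le_trans (ler_normB _ _)); have := ler_normD (f l - f (u k) - (l - u k)) (l - u k).
have := fc _ _ ux lx; have := le_trans (Hl' k) ke.
have U1' : rho / 2 * 2^-1 ^+ k <= e / 3 / 2 by rewrite mulrAC ler_wpM2r// invr_ge0.
have := le_trans U1 U1'.
move: (`|u k.+1 - u k|) (`|l - u k|) (`|f l - f (u k) - (l - u k)|) (`|_ + _|) => a b c d.
lra.
Qed.

Section InverseFunction.
Context {R : realType} {n : nat}.
Variables (U : set 'rV[R]_n) (f G : 'rV[R]_n -> 'rV[R]_n).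
Hypotheses (oU : open U) (fs : smooth_on U f).
Hypothesis fid : forall x y, U x -> U y -> `|f y - f x - (y - x)| <= 2^-1 * `|y - x|.
Hypothesis fG : forall x, U x -> G (f x) = x.

(** A map that differs from the identity by a half-Lipschitz error contracts distances by at most a
    factor 2. This gives injectivity and the continuity of the inverse. *)
Lemma near_identity_expand x y : U x -> U y -> `|y - x| <= 2 * `|f y - f x|.
Proof.
move=> Ux Uy; have H := fid Ux Uy.
have : `|y - x| <= `|f y - f x| + `|f y - f x - (y - x)|.
  have {1}-> : y - x = (f y - f x) - (f y - f x - (y - x)) by apply/rowP => i; rewrite !mxE; ring.
  exact: ler_normB.
move: H; move: (`|y - x|) (`|f y - f x|) (`|_ - _|) => a b c; lra.
Qed.

Lemma near_identity_open : open (f @` U).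
Proof.
apply: open_distP => _ [x Ux <-].
have [d d0 dU] := open_ball_ex oU Ux.
have b z : `|z - x| <= d / 2 -> U z by move=> zd; apply: dU; apply: (le_lt_trans zd); lra.
have H := @near_identity_surjective R n f x (d / 2) (fun a c ax cx => fid (b _ ax) (b _ cx)).
exists (d / 2 / 2); first by rewrite !divr_gt0.
move=> y yd; have [z [zx <-]] := H y (ltW yd).
by exists z => //; exact: b.
Qed.

Lemma derive_near_identity x v : U x -> `|'D_v f x - v| <= 2^-1 * `|v|.
Proof.
move=> Ux; apply/ler_addgt0Pr => e e0.
have := (is_deriveP _ _ _ _).1 (Ck_is_derive v (fs 1%N) Ux) e e0 => dh.
have cU : (x + h *: v) @[h --> (0 : R)] --> x.
  rewrite -[X in _ --> X]addr0 -(scale0r v).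
  by apply: cvgD; [exact: cvg_cst|apply: cvgZl; exact: cvg_id].
have Uh : \forall h \near (0 : R), U (x + h *: v) by apply: cU; exact: open_nbhs_nbhs.
have : \forall h \near (0 : R)^', [/\ h != 0, U (x + h *: v) &
    `|f (x + h *: v) - f x - h *: 'D_v f x| <= e * `|h|].
  near=> h; split; near: h; [exact: nbhs_dnbhs_neq|exact: cvg_within|exact: cvg_within].
move=> /filter_ex[h [h0 Uxh dxh]].
have h1 : 0 < `|h| by rewrite normr_gt0.
rewrite -(ler_pM2l h1) -normrZ scalerBr.
have := fid Ux Uxh; rewrite [x + _]addrC addrK normrZ addrC => F.
have -> : h *: 'D_v f x - h *: v = (f (x + h *: v) - f x - h *: v) -
    (f (x + h *: v) - f x - h *: 'D_v f x).
  by apply/rowP => i; rewrite !mxE; ring.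
apply: (le_trans (ler_normB _ _)).
rewrite mulrDr [X in _ <= _ + X]mulrC mulrCA lerD//.
Unshelve. all: by end_near. Qed.

(** By [derive_near_identity] a vector of the kernel has a norm at most half of itself. *)
Lemma jacobian_unit x : U x -> jacobian_mx f x \in unitmx.
Proof.
move=> Ux; rewrite -row_free_unit; apply: inj_row_free => v.
rewrite -total_derivative_mx -(derive_total oU (fs 1%N) v Ux) => D0.
have := derive_near_identity v Ux; rewrite D0 sub0r normrN => H.
by apply/eqP; rewrite -normr_le0; lra.
Qed.

(** The strict expansion of [f] between two preimages is multiplied by the inverse Jacobian. The
    expansion bound makes the distance of the preimages linear in [h], so the error remains of
    smaller order. *)
Lemma inverse_is_derive x w : U x ->
  is_derive (f x) w G (w *m invmx (jacobian_mx f x)).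
Proof.
move=> Ux; apply/is_deriveP => e e0.
have [K K0 HK] := mulmx_norm_le (invmx (jacobian_mx f x)).
(* [K] bounds the inverse Jacobian, and the second factor bounds the distance of the preimages per
   unit of [h]. *)
pose e1 := e / (K * (2 * (`|w| + 1))).
have w0 : 0 < `|w| + 1 by rewrite ltr_wpDl.
have e10 : 0 < e1 by rewrite divr_gt0// !mulr_gt0.
have [r r0 [_ fr]] := C1_strict_expansion oU Ux (fs 1%N) e10.
have cU : (f x + h *: w) @[h --> (0 : R)] --> f x.
  rewrite -[X in _ --> X]addr0 -(scale0r w).
  by apply: cvgD; [exact: cvg_cst|apply: cvgZl; exact: cvg_id].
have Uh : \forall h \near (0 : R), (f @` U) (f x + h *: w).
  by apply: cU; apply: open_nbhs_nbhs; split; [exact: near_identity_open|exists x].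
have r1 : 0 < r / (2 * (`|w| + 1)) by rewrite divr_gt0// mulr_gt0.
near=> h.
have : (f @` U) (f x + h *: w) by near: h.
move=> [x' Ux' fx']; rewrite -fx' !fG//.
have hr : `|h| < r / (2 * (`|w| + 1)) by near: h; exact: (@nbhs0_lt _ R).
have fxx : f x' - f x = h *: w by rewrite fx' [f x + _]addrC addrK.
have xx : `|x' - x| <= `|h| * (2 * (`|w| + 1)).
  apply: (le_trans (near_identity_expand Ux Ux')); rewrite fxx normrZ mulrCA.
  by rewrite !ler_wpM2l// lerDl.
have xr : `|x' - x| < r by apply: (le_lt_trans xx); rewrite -ltr_pdivlMr// mulr_gt0.
have := fr x x' ltac:(by rewrite subrr normr0) xr.
rewrite -/(total_derivative f x (x' - x)) total_derivative_mx fxx => F.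
have Ju := jacobian_unit Ux.
have -> : x' - x - h *: (w *m invmx (jacobian_mx f x)) =
    - ((h *: w - (x' - x) *m jacobian_mx f x) *m invmx (jacobian_mx f x)).
  by rewrite mulmxBl mulmxK// opprB scalemxAl.
rewrite normrN; apply: (le_trans (HK _)).
apply: (le_trans (ler_wpM2l (ltW K0) (le_trans F (ler_wpM2l (ltW e10) xx)))).
rewrite /e1 le_eqVlt; apply/orP; left; apply/eqP; field.
by rewrite !gt_eqF.
Unshelve. all: by end_near. Qed.

(** The formula for the derivative involves [G] only through the composition of [G] with a smooth
    map, so each order of regularity yields the next. *)
Lemma inverse_smooth : smooth_on (f @` U) G.
Proof.
have Gc x : (f @` U) x -> {for x, continuous G}.
  move=> [z Uz <-]; apply/continuous_distP => e e0.
  have Uf : (f @` U) (f z) by exists z.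
  have [d d0 dU] := open_ball_ex near_identity_open Uf.
  exists (Num.min d (e / 2)); first by rewrite lt_min d0 divr_gt0.
  move=> y; rewrite lt_min => /andP[/dU[z' Uz' <-] ye].
  rewrite !fG//; apply: (le_trans (near_identity_expand Uz Uz')); lra.
elim=> [|k IH]; first by split.
apply: (@Ck_onS _ _ _ _ _ _ (fun w y => w *m invmx (jacobian_mx f (G y)))) => //.
- exact: near_identity_open.
- by move=> _ w [z Uz <-]; rewrite fG//; exact: inverse_is_derive.
- move=> w; apply: Ck_on_mulmx; [exact: near_identity_open|exact: Ck_on_cst|].
  apply: Ck_on_invmx; [exact: near_identity_open|by move=> _ [z Uz <-]; rewrite fG//; exact: jacobian_unit|].
  apply: (Ck_on_comp near_identity_open oU _ IH); last exact: jacobian_smooth.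
  by move=> _ [z Uz <-]; rewrite fG.
Qed.

End InverseFunction.

(** * Bilinear forms and Euler-Lagrange expressions *)

Section FormAlgebra.
Context {R : realType} {n : nat}.
Implicit Types (A B : 'M[R]_n) (u v w : 'rV[R]_n).

Lemma formDl A u v w : form A (u + v) w = form A u w + form A v w.
Proof. by rewrite /form !mulmxDl mxE. Qed.
Lemma formDr A u v w : form A u (v + w) = form A u v + form A u w.
Proof. by rewrite /form linearD /= mulmxDr mxE. Qed.
Lemma formZl A a u v : form A (a *: u) v = a * form A u v.
Proof. by rewrite /form -!scalemxAl mxE. Qed.
Lemma formZr A a u v : form A u (a *: v) = a * form A u v.
Proof. by rewrite /form linearZ /= -scalemxAr mxE. Qed.
Lemma formDm A B u v : form (A + B) u v = form A u v + form B u v.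
Proof. by rewrite /form mulmxDr mulmxDl mxE. Qed.
Lemma formZm A a u v : form (a *: A) u v = a * form A u v.
Proof. by rewrite /form -scalemxAr -scalemxAl mxE. Qed.
Lemma form0l A v : form A 0 v = 0.
Proof. by rewrite /form !mul0mx mxE. Qed.
Lemma form0r A v : form A v 0 = 0.
Proof. by rewrite /form trmx0 mulmx0 mxE. Qed.
Lemma form0m u v : form (0 : 'M[R]_n) u v = 0.
Proof. by rewrite /form mulmx0 mul0mx mxE. Qed.
Lemma formNl A u v : form A (- u) v = - form A u v.
Proof. by rewrite -scaleN1r formZl mulN1r. Qed.
Lemma formNr A u v : form A u (- v) = - form A u v.
Proof. by rewrite -scaleN1r formZr mulN1r. Qed.

Lemma form_trmx A u v : form A^T u v = form A v u.
Proof.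
rewrite /form; transitivity ((v *m A *m u^T)^T 0 0); last by rewrite mxE.
by rewrite !trmx_mul trmxK mulmxA.
Qed.

Lemma form_sym A u v : A^T = A -> form A u v = form A v u.
Proof. by move=> {1}<-; rewrite form_trmx. Qed.

Lemma form_delta A i j : form A (delta_mx 0 i) (delta_mx 0 j) = A i j.
Proof. by rewrite /form -rowE trmx_delta -colE !mxE. Qed.

Lemma formE A u v : form A u v = \sum_i \sum_j u 0 i * v 0 j * A i j.
Proof.
rewrite /form mxE exchange_big /=; apply: eq_bigr => j _; rewrite !mxE mulr_suml.
by apply: eq_bigr => i _; rewrite mulrAC.
Qed.

Lemma form_suml A (I : Type) (r : seq I) (F : I -> 'rV[R]_n) v :
  form A (\sum_(i <- r) F i) v = \sum_(i <- r) form A (F i) v.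
Proof. by elim/big_rec2 : _ => [|i x y _ <-]; [rewrite form0l|rewrite formDl]. Qed.

Lemma form_sumr A (I : Type) (r : seq I) (F : I -> 'rV[R]_n) v :
  form A v (\sum_(i <- r) F i) = \sum_(i <- r) form A v (F i).
Proof. by elim/big_rec2 : _ => [|i x y _ <-]; [rewrite form0r|rewrite formDr]. Qed.

Lemma form_summ (I : Type) (r : seq I) (F : I -> 'M[R]_n) u v :
  form (\sum_(i <- r) F i) u v = \sum_(i <- r) form (F i) u v.
Proof.
by elim/big_rec2 : _ => [|i x y _ <-]; [rewrite form0m|rewrite formDm].
Qed.

Lemma form_deltar A u l : form A u (delta_mx 0 l) = \sum_b u 0 b * A b l.
Proof. by rewrite /form trmx_delta -colE !mxE. Qed.

Lemma form_inj A B : (forall u v, form A u v = form B u v) -> A = B.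
Proof. by move=> AB; apply/matrixP => i j; rewrite -!form_delta AB. Qed.

Definition posdef A := A^T = A /\ forall u, u != 0 -> 0 < form A u u.

Lemma posdef_ge0 A u : posdef A -> 0 <= form A u u.
Proof.
move=> [_ A0]; have [->|u0] := eqVneq u 0; first by rewrite form0l.
exact/ltW/A0.
Qed.

Lemma form_cauchy_schwarz A u v : posdef A ->
  form A u v ^+ 2 <= form A u u * form A v v.
Proof.
move=> pA; have [As A0] := pA.
have [->|v0] := eqVneq v 0; first by rewrite !form0r expr0n/= mulr0.
have vv := A0 _ v0.
(* Up to the factor [form A v v], this is the component of [u] orthogonal to [v]; its square is
   [form A v v] times the difference of the two sides. *)
have := posdef_ge0 (form A v v *: u - form A u v *: v) pA.
rewrite formDl !formDr !(formZl, formNl, formZr, formNr) (form_sym v u As).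
set a := form A u u; set b := form A u v; set c := form A v v => H.
have : 0 <= c * (a * c - b ^+ 2) by apply: le_trans H _; rewrite le_eqVlt; apply/orP; left; apply/eqP; ring.
by rewrite pmulr_rge0// subr_ge0.
Qed.

Lemma posdef_unit A : posdef A -> A \in unitmx.
Proof.
move=> [_ A0]; rewrite -row_free_unit; apply: inj_row_free => v vA.
apply/eqP; apply: contraTT isT => v0; have := A0 _ v0.
by rewrite /form vA mul0mx mxE ltxx.
Qed.

(* [u 0 i = form A u (delta_mx 0 i *m invmx A)], to which Cauchy-Schwarz applies. *)
Lemma posdef_lower A : posdef A ->
  exists2 c, 0 < c & forall u, c * `|u| ^+ 2 <= form A u u.
Proof.
move=> pA; have [As A0] := pA; have Au := posdef_unit pA.
pose w i : 'rV[R]_n := delta_mx 0 i *m invmx A.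
have wE u i : form A u (w i) = u 0 i.
  by rewrite form_sym// /form /w mulmxKV// -rowE !mxE.
pose S := \sum_i form A (w i) (w i) + 1.
have S0 : 0 < S by rewrite ltr_wpDl// sumr_ge0// => i _; exact: posdef_ge0.
exists S^-1; first by rewrite invr_gt0.
move=> u; rewrite mulrC ler_pdivrMr//.
have fS0 : 0 <= form A u u * S by rewrite mulr_ge0 ?posdef_ge0// ltW.
rewrite -(sqr_sqrtr fS0) ler_sqr ?nnegrE ?sqrtr_ge0//.
apply/mx_norm_leP; first exact: sqrtr_ge0.
move=> a i; rewrite ord1 -wE -(@ler_sqr R) ?nnegrE ?sqrtr_ge0// sqr_sqrtr// real_normK ?num_real//.
apply: (le_trans (form_cauchy_schwarz _ _ pA)); rewrite ler_wpM2l ?posdef_ge0//.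
rewrite /S (bigD1 i)//= -addrA lerDl addr_ge0// sumr_ge0// => j _; exact: posdef_ge0.
Qed.

End FormAlgebra.

Section FormCalculus.
Context {R : realType} {V : normedModType R}.

Lemma is_derive_mulmx m n p (A : V -> 'M[R]_(m, n)) (B : V -> 'M[R]_(n, p)) x v dA dB :
  is_derive x v A dA -> is_derive x v B dB ->
  is_derive x v (fun y => A y *m B y) (dA *m B x + A x *m dB).
Proof.
move=> /is_derive_mxP hA /is_derive_mxP hB; apply/is_derive_mxP => i j.
under eq_fun do rewrite mxE.
have -> : (fun y => \sum_k A y i k * B y k j) = \sum_k (fun y => A y i k * B y k j).
  by apply/funext => y; rewrite fct_sumE.
rewrite !mxE -big_split /=; apply: is_derive_sum => k.
have := is_deriveZf (hA i k) (hB k j); rewrite /GRing.scale /= => H.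
by rewrite addrC.
Qed.

Lemma is_derive_form n (A : V -> 'M[R]_n) (p q : V -> 'rV[R]_n) x v dA dp dq :
  is_derive x v A dA -> is_derive x v p dp -> is_derive x v q dq ->
  is_derive x v (fun y => form (A y) (p y) (q y) : R^o)
    (form dA (p x) (q x) + form (A x) dp (q x) + form (A x) (p x) dq).
Proof.
move=> hA hp hq.
have hqT : is_derive x v (fun y => (q y)^T) dq^T.
  move/is_derive_mxP: hq => hq; apply/is_derive_mxP => i j; rewrite mxE.
  by under eq_fun do rewrite mxE; exact: hq.
have := is_derive_mulmx (is_derive_mulmx hp hA) hqT => /is_derive_mxP/(_ 0 0) H.
suff E : ((dp *m A x + p x *m dA) *m (q x)^T + p x *m A x *m dq^T) 0 0 =
  form dA (p x) (q x) + form (A x) dp (q x) + form (A x) (p x) dq by rewrite -E.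
by rewrite mxE; congr (_ + _); rewrite mulmxDl mxE addrC.
Qed.

Lemma Ck_on_form n k (U : set V) (A : V -> 'M[R]_n) (p q : V -> 'rV[R]_n) : open U ->
  Ck_on k U A -> Ck_on k U p -> Ck_on k U q -> Ck_on k U (fun y => form (A y) (p y) (q y) : R^o).
Proof.
move=> oU hA hp hq; have H := Ck_on_mulmx oU (Ck_on_mulmx oU hp hA) (Ck_on_trmx oU hq).
exact: ((Ck_on_mxP _ _ oU).1 H 0 0).
Qed.

End FormCalculus.

(** * Naturality of the Euler-Lagrange expression *)

Section EulerLagrange.
Context {R : realType} {n : nat}.
Implicit Types (A B : 'rV[R]_n -> 'M[R]_n) (x v a w : 'rV[R]_n).

(* The Euler-Lagrange expression of the energy [form (A x) v v / 2] along a curve through [x]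
   with velocity [v] and acceleration [a], evaluated at [w]. *)
Definition euler_lagrange A x v a w : R :=
  form (A x) a w + form ('D_v A x) v w - 2^-1 * form ('D_w A x) v v.

(** The terms in which the differential of the map is itself differentiated towards [w] cancel, by
    symmetry of [M] and of second derivatives. Only [dvv] survives, as a correction of the
    acceleration. *)
Lemma pullback_cancel (M M1 M2 : 'M[R]_n) (a y w dvv dvw dwv : 'rV[R]_n) :
  M^T = M -> dvw = dwv ->
  form M a w + (form M1 y w + form M dvv w + form M y dvw) -
    2^-1 * (form M2 y y + form M dwv y + form M y dwv) =
  form M (a + dvv) w + form M1 y w - 2^-1 * form M2 y y.
Proof.
by move=> Ms ->; rewrite formDl (form_sym dwv y Ms); field.
Qed.

(** This takes the place of the transformation law of Christoffel symbols, and is applied to changes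
    of charts as well as to normal coordinates. The acceleration on the right is that of the image
    curve. *)
Lemma euler_lagrange_pullback (U U' : set 'rV[R]_n) A B (phi : 'rV[R]_n -> 'rV[R]_n) x v a w :
  open U -> open U' -> (forall y, U y -> U' (phi y)) ->
  Ck_on 2 U phi -> Ck_on 1 U' A -> Ck_on 1 U B -> (forall y, U' y -> (A y)^T = A y) ->
  (forall y u u', U y -> form (B y) u u' = form (A (phi y)) ('D_u phi y) ('D_u' phi y)) ->
  U x ->
  euler_lagrange B x v a w = euler_lagrange A (phi x) ('D_v phi x)
    ('D_a phi x + 'D_v ('D_v phi) x) ('D_w phi x).
Proof.
move=> oU oU' UU' phi2 A1 B1 As BE Ux.
have phi1 := Ck_onW phi2.
have dB z u u' : is_derive x z (fun y => form (B y) u u' : R^o) (form ('D_z B x) u u').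
  have := is_derive_form (Ck_is_derive z B1 Ux) (is_derive_cst u x z) (is_derive_cst u' x z).
  by rewrite form0l form0r !addr0.
have dA z u u' : form ('D_z B x) u u' =
    form ('D_('D_z phi x) A (phi x)) ('D_u phi x) ('D_u' phi x) +
    form (A (phi x)) ('D_z ('D_u phi) x) ('D_u' phi x) +
    form (A (phi x)) ('D_u phi x) ('D_z ('D_u' phi) x).
  have D2 u0 : is_derive x z ('D_u0 phi) ('D_z ('D_u0 phi) x).
    exact: (Ck_is_derive z (Ck_on_derive u0 phi2) Ux).
  have DA := is_derive_compD oU' A1 (Ck_is_derive z phi1 Ux) (UU' _ Ux).
  have H := is_derive_form DA (D2 u) (D2 u').
  apply: is_derive_unique (dB z u u') _.
  apply: near_eq_is_derive H; apply: (open_near oU Ux) => y Uy /=.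
  by rewrite BE.
rewrite /euler_lagrange BE// (dA v v w) (dA w v v).
have S := derive_sym w v oU phi2 Ux.
exact: (pullback_cancel ('D_('D_v phi x) A (phi x)) ('D_('D_w phi x) A (phi x))
  ('D_a phi x) ('D_v phi x) ('D_w phi x) ('D_v ('D_v phi) x) (As _ (UU' _ Ux)) S).
Qed.

(* [spray_covector A x v] collects the terms of the Euler-Lagrange expression without
   acceleration, so that the geodesic equation reads [a = - spray_covector A x v *m invmx (A x)]. *)
Definition spray_covector A x v : 'rV[R]_n :=
  \row_l (form (total_derivative A x v) v (delta_mx 0 l) -
    2^-1 * form ('D_(delta_mx 0 l) A x) v v).

Lemma euler_lagrangeE (U : set 'rV[R]_n) A x v a w : open U -> Ck_on 1 U A -> U x ->
  euler_lagrange A x v a w = ((a *m A x + spray_covector A x v) *m w^T) 0 0.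
Proof.
move=> oU A1 Ux; rewrite mulmxDl mxE -/(form (A x) a w) /euler_lagrange -addrA; congr (_ + _).
rewrite (derive_total oU A1 v Ux) (derive_total oU A1 w Ux).
rewrite mxE {1}(row_sum_delta w) form_sumr.
have -> : form (total_derivative A x w) v v = \sum_l w 0 l * form ('D_(delta_mx 0 l) A x) v v.
  rewrite /total_derivative; elim/big_rec2 : _ => [|l y B _ <-].
    by rewrite form0m.
  by rewrite formDm formZm.
rewrite mulr_sumr -sumrB; apply: eq_bigr => l _; rewrite !mxE formZr.
by ring.
Qed.

Lemma euler_lagrange_eq0 (U : set 'rV[R]_n) A x v a : open U -> Ck_on 1 U A -> U x ->
  A x \in unitmx ->
  (forall w, euler_lagrange A x v a w = 0) <-> a = - (spray_covector A x v *m invmx (A x)).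
Proof.
move=> oU A1 Ux Au; split=> [H|-> w].
  have E : a *m A x + spray_covector A x v = 0.
    apply/rowP => l; have := H (delta_mx 0 l).
    by rewrite (euler_lagrangeE _ _ _ oU A1 Ux) trmx_delta -colE !mxE.
  move/eqP: E; rewrite addr_eq0 => /eqP/(congr1 (mulmx^~ (invmx (A x)))) /=.
  by rewrite mulmxK// mulNmx.
by rewrite (euler_lagrangeE _ _ _ oU A1 Ux) mulNmx mulmxKV// addNr mul0mx mxE.
Qed.

End EulerLagrange.

Section CurveTransform.
Context {R : realType} {n : nat}.

Lemma second_derivative_comp (U : set 'rV[R]_n) (phi : 'rV[R]_n -> 'rV[R]_n)
    (x : R -> 'rV[R]_n) (dx : R -> 'rV[R]_n) (ddx : 'rV[R]_n) (t : R) :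
  open U -> Ck_on 2 U phi -> U (x t) ->
  (\forall s \near t, is_derive (s : R) 1 x (dx s)) -> is_derive t 1 dx ddx ->
  is_derive t 1 (derive1 (phi \o x)) ('D_ddx phi (x t) + 'D_(dx t) ('D_(dx t) phi) (x t)).
Proof.
move=> oU phi2 Ux xd dxd; have phi1 := Ck_onW phi2.
have dxt : is_derive t 1 x (dx t) by exact: nbhs_singleton xd.
have cx := is_derive_continuous dxt.
have Unear : \forall s \near t, U (x s) by apply: cx; exact: open_nbhs_nbhs.
have E : \forall s \near t, total_derivative phi (x s) (dx s) = derive1 (phi \o x) s.
  near=> s; have Us : U (x s) by near: s.
  have ds : is_derive s 1 x (dx s) by near: s.
  have [_ <-] := is_derive_comp oU phi1 ds Us.
  by rewrite derive1E.
apply: near_eq_is_derive E _.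
rewrite (derive_total oU phi1 ddx Ux).
have Dphi1 := Ck_on_derive (dx t) phi2.
rewrite (derive_total oU Dphi1 (dx t) Ux) /total_derivative -big_split /=.
have -> : (fun s => \sum_i dx s 0 i *: 'D_(delta_mx 0 i) phi (x s)) =
    \sum_i (fun s => dx s 0 i *: 'D_(delta_mx 0 i) phi (x s)).
  by apply/funext => s; rewrite fct_sumE.
apply: is_derive_sum => i.
have Di := Ck_on_derive (delta_mx 0 i) phi2.
have H := is_derive_compD oU Di dxt Ux.
have Hi := (is_derive_mxP _ _ _ _).1 dxd 0 i.
apply: is_derive_eq; first exact: (is_deriveZf Hi H).
(* The product rule differentiates the partial derivatives of [phi] in the direction [dx t];
   Schwarz's theorem exchanges the two differentiations. *)
by rewrite addrC (derive_sym _ _ oU phi2 Ux).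
Unshelve. all: by end_near. Qed.

End CurveTransform.

(** * Charts and geodesics *)

Lemma open_setI_preimage (S T : topologicalType) (F : S -> T) (U : set S) (B : set T) :
  open U -> open B -> (forall x, U x -> {for x, continuous F}) -> open (U `&` F @^-1` B).
Proof.
move=> oU oB cF; rewrite openE => x [Ux Bx]; apply: filterI.
  exact: open_nbhs_nbhs.
by apply: (cF _ Ux); exact: open_nbhs_nbhs.
Qed.

Arguments chart_im_open {R n} M i : rename.
Arguments chart_transition_smooth {R n} M i j k : rename.

Section Charts.
Context {R : realType} {n : nat} (M : smooth_manifold R n).
Local Notation im i := (chart M i @` chart_dom M i).
Local Notation transition i j := (chart M j \o chart_inv M i).
Local Notation overlap i j := (chart M i @` (chart_dom M i `&` chart_dom M j)).

Lemma chart_imageP i (B : set M) :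
  chart M i @` (B `&` chart_dom M i) = im i `&` chart_inv M i @^-1` B.
Proof.
apply/seteqP; split=> [_ [q [Bq dq] <-]|x [[q dq <-]]].
  by split; [exists q|rewrite /= chartK].
by rewrite /= chartK// => Bq; exists q.
Qed.

Lemma open_chart_image i (B : set M) : open B -> open (chart M i @` (B `&` chart_dom M i)).
Proof.
move=> oB; rewrite chart_imageP; apply: open_setI_preimage => //; first exact: chart_im_open.
exact: chart_inv_continuous.
Qed.

Lemma overlapE i j : overlap i j = im i `&` chart_inv M i @^-1` chart_dom M j.
Proof. by rewrite setIC chart_imageP. Qed.

Lemma open_overlap i j : open (overlap i j).
Proof. rewrite setIC; apply: open_chart_image; exact: chart_dom_open. Qed.
Arguments open_overlap i j : clear implicits.

Lemma chart_invK i x : im i x -> chart M i (chart_inv M i x) = x.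
Proof. by move=> [q dq <-]; rewrite chartK. Qed.

Lemma chart_inv_dom i x : im i x -> chart_dom M i (chart_inv M i x).
Proof. by move=> [q dq <-]; rewrite chartK. Qed.

Lemma chart_im_mem i q : chart_dom M i q -> im i (chart M i q).
Proof. by exists q. Qed.

Lemma overlap_mem i j q : chart_dom M i q -> chart_dom M j q -> overlap i j (chart M i q).
Proof. by move=> di dj; exists q. Qed.

Lemma transition_chart i j q : chart_dom M i q -> transition i j (chart M i q) = chart M j q.
Proof. by move=> dq; rewrite /= chartK. Qed.

Lemma is_derive_chart (V : normedModType R) (F : V -> M) i j x u du :
  {for x, continuous F} -> chart_dom M i (F x) -> chart_dom M j (F x) ->
  is_derive x u (chart M i \o F) du ->
  is_derive x u (chart M j \o F) ('D_du (transition i j) (chart M i (F x))).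
Proof.
move=> cF di dj dF.
have H := is_derive_compD (open_overlap i j) (chart_transition_smooth M i j 1%N) dF
  (overlap_mem di dj).
apply: near_eq_is_derive H.
have : \forall y \near x, chart_dom M i (F y).
  by apply: cF; apply: open_nbhs_nbhs; split => //; exact: chart_dom_open.
by apply: filterS => y dy; rewrite /= chartK.
Qed.

(** The opposite transition map is an inverse, so by the chain rule its differential sends
    ['D_u (transition i j) x] back to [u]. *)
Lemma transition_derive_inj i j x u : overlap i j x ->
  'D_u (transition i j) x = 0 -> u = 0.
Proof.
move=> [q [di dj] <-] D0.
have ti := Ck_is_derive u (chart_transition_smooth M i j 1%N) (overlap_mem di dj).
have H : is_derive (chart M i q) u (transition j i \o transition i j) 0.
  have := is_derive_compD (open_overlap j i) (chart_transition_smooth M j i 1%N) ti.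
  rewrite transition_chart// D0 derive0; apply; exact: overlap_mem.
have : is_derive (chart M i q) u id 0.
  apply: near_eq_is_derive H; apply: (open_near (open_overlap i j) (overlap_mem di dj)).
  by move=> _ [q' [di' dj'] <-] /=; rewrite !chartK.
by move=> H0; rewrite (is_derive_unique H0 (is_derive_id _ _)).
Qed.

End Charts.
Arguments open_overlap {R n} M i j.

Section MetricInCharts.
Context {R : realType} {n : nat} {M : smooth_manifold R n} (g : riemannian_metric M).
Local Notation im i := (chart M i @` chart_dom M i).
Local Notation transition i j := (chart M j \o chart_inv M i).
Local Notation overlap i j := (chart M i @` (chart_dom M i `&` chart_dom M j)).
Local Notation G i := (coord_gram g i).

(** The definition reads derivatives in the chart distinguished by [F x], which need not vary
    continuously. This passes to a fixed chart: the differential of the transition is absorbed by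
    [coord_gram]. *)
Lemma pullback_form_chart (V : normedModType R) (F : V -> M) i x u v du dv :
  {for x, continuous F} -> chart_dom M i (F x) ->
  is_derive x u (chart M i \o F) du -> is_derive x v (chart M i \o F) dv ->
  pullback_form g F x u v = form (G i (chart M i (F x))) du dv.
Proof.
move=> cF di dFu dFv; set j := chart_at M (F x).
have dj : chart_dom M j (F x) by exact: chart_at_mem.
have [_ Du] := is_derive_chart cF di dj dFu.
have [_ Dv] := is_derive_chart cF di dj dFv.
rewrite /pullback_form /diff_to -/j Du Dv.
have oo := open_overlap M i j; have ts := chart_transition_smooth M i j 1%N.
have om := overlap_mem di dj.
rewrite (derive_total oo ts _ om) (derive_total oo ts _ om) /total_derivative.
rewrite form_suml formE; apply: eq_bigr => a _; rewrite form_sumr; apply: eq_bigr => b _.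
by rewrite mxE /pullback_form /diff_to chartK// formZl formZr mulrA.
Qed.

Lemma pullback_form_chart_inv i x u v : im i x ->
  pullback_form g (chart_inv M i) x u v = form (G i x) u v.
Proof.
move=> ix; rewrite -{2}(chart_invK ix).
have D w : is_derive x w (chart M i \o chart_inv M i) w.
  apply: near_eq_is_derive (is_derive_id x w).
  by apply: (open_near (chart_im_open M i) ix) => y iy /=; rewrite chart_invK.
apply: pullback_form_chart => //; first exact: chart_inv_continuous.
exact: chart_inv_dom.
Qed.

Lemma coord_gram_transition i j x u v : overlap i j x ->
  form (G i x) u v =
  form (G j (transition i j x)) ('D_u (transition i j) x) ('D_v (transition i j) x).
Proof.
move=> ox; have [q [di dj] xq] := ox; have ix : im i x by exists q.
rewrite -(pullback_form_chart_inv u v ix).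
have D w : is_derive x w (chart M j \o chart_inv M i) ('D_w (transition i j) x).
  exact: (Ck_is_derive w (chart_transition_smooth M i j 1%N)).
apply: pullback_form_chart => //; first exact: chart_inv_continuous.
by rewrite -xq chartK.
Qed.

Lemma coord_gram_at p : G (chart_at M p) (chart M (chart_at M p) p) = g p.
Proof.
have dp := chart_at_mem p; have ip := chart_im_mem dp.
apply: form_inj => u v; rewrite -pullback_form_chart_inv// /pullback_form /diff_to chartK//.
have D w : 'D_w (chart M (chart_at M p) \o chart_inv M (chart_at M p)) (chart M (chart_at M p) p) = w.
  rewrite -[RHS](derive_id (chart M (chart_at M p) p)); apply: near_eq_derive.
  by apply: (open_near (chart_im_open M _) ip) => y iy /=; rewrite chart_invK.
by rewrite !D.
Qed.

Lemma coord_gram_posdef i x : im i x -> posdef (G i x).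
Proof.
move=> ix; split.
  by apply/matrixP => a b; rewrite !mxE /pullback_form (form_sym _ _ (gram_sym g _)).
move=> u u0; rewrite -pullback_form_chart_inv// /pullback_form; apply: gram_pos.
apply: contra_neq u0; apply: transition_derive_inj.
by rewrite overlapE; split=> //=; exact: chart_at_mem.
Qed.

(** The only place where Christoffel symbols are unfolded: contracted twice with the velocity, they
    become the spray covector with its index raised. *)
Lemma christoffel_spray i (x v : 'rV[R]_n) k : im i x ->
  \sum_a \sum_b christoffel g i k a b x * v 0 a * v 0 b =
  (spray_covector (G i) x v *m invmx (G i x)) 0 k.
Proof.
move=> ix; have [Gs _] := coord_gram_posdef ix.
have G1 : Ck_on 1 (im i) (G i) by exact: gram_smooth.
have oi := chart_im_open M i.
pose d l a b := 'D_(delta_mx 0 l) (fun y => G i y a b : R^o) x.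
have DG l a b : ('D_(delta_mx 0 l) (G i) x) a b = d l a b.
  rewrite derive_mx ?mxE//; first exact: (G1.2 _).1.
have dsym l a b : d l a b = d l b a.
  rewrite /d; congr ('D__ _ x); apply/funext => y.
  by rewrite !mxE /pullback_form (form_sym _ _ (gram_sym g _)).
have spr l : (spray_covector (G i) x v) 0 l =
    \sum_a \sum_b 2^-1 * (d a b l + d b a l - d l a b) * v 0 a * v 0 b.
  rewrite mxE /total_derivative.
  have -> : form (\sum_i0 v 0 i0 *: 'D_(delta_mx 0 i0) (G i) x) v (delta_mx 0 l) =
      \sum_a \sum_b v 0 a * v 0 b * d a b l.
    rewrite form_summ; apply: eq_bigr => a _; rewrite formZm form_deltar mulr_sumr.
    by apply: eq_bigr => b _; rewrite DG mulrA.
  have -> : form ('D_(delta_mx 0 l) (G i) x) v v = \sum_a \sum_b v 0 a * v 0 b * d l a b.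
    by rewrite formE; apply: eq_bigr => a _; apply: eq_bigr => b _; rewrite DG.
  (* Exchanging the summation indices identifies the first two terms of the Christoffel symbol, so
     the factor one half remains only on the third. *)
  have S2 : \sum_a \sum_b v 0 a * v 0 b * d a b l = \sum_a \sum_b v 0 a * v 0 b * d b a l.
    by rewrite exchange_big; apply: eq_bigr => a _; apply: eq_bigr => b _; rewrite [v 0 b * _]mulrC.
  transitivity (2^-1 * (\sum_a \sum_b v 0 a * v 0 b * d a b l + \sum_a \sum_b v 0 a * v 0 b * d b a l
    - \sum_a \sum_b v 0 a * v 0 b * d l a b)); first by rewrite -S2; field.
  rewrite -big_split -sumrB mulr_sumr; apply: eq_bigr => a _ /=.
  rewrite -big_split -sumrB mulr_sumr; apply: eq_bigr => b _ /=; ring.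
have -> : (spray_covector (G i) x v *m invmx (G i x)) 0 k =
    \sum_l (spray_covector (G i) x v) 0 l * invmx (G i x) k l.
  rewrite mxE; apply: eq_bigr => l _; congr (_ * _).
  by rewrite -[in LHS]Gs -trmx_inv mxE.
under [RHS]eq_bigr do rewrite spr mulr_suml.
rewrite [RHS]exchange_big; apply: eq_bigr => a _ /=.
under [RHS]eq_bigr do rewrite mulr_suml.
rewrite [RHS]exchange_big; apply: eq_bigr => b _ /=.
rewrite /christoffel mulr_sumr !mulr_suml; apply: eq_bigr => l _; rewrite /d; ring.
Qed.

Lemma geodesic_equationP i (x v a : 'rV[R]_n) : im i x ->
  (forall k, a 0 k + \sum_(b < n) \sum_(c < n) christoffel g i k b c x * v 0 b * v 0 c = 0) <->
  forall w, euler_lagrange (G i) x v a w = 0.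
Proof.
move=> ix; have oi := chart_im_open M i.
have G1 : Ck_on 1 (im i) (G i) by exact: gram_smooth.
have Gu := posdef_unit (coord_gram_posdef ix).
rewrite (euler_lagrange_eq0 _ _ oi G1 ix Gu); split=> [H|-> k].
  by apply/rowP => k; have /eqP := H k; rewrite christoffel_spray// addr_eq0 => /eqP->; rewrite [RHS]mxE.
by rewrite christoffel_spray// mxE addNr.
Qed.

(** [geodesic_on] asks for the equation in every chart; naturality of the Euler-Lagrange expression
    carries it over from the single chart [i]. *)
Lemma geodesic_of_chart (J : set R) (c : R -> M) i (dx ddx : R -> 'rV[R]_n) :
  open (J : set R^o) -> (forall t, J t -> chart_dom M i (c t)) ->
  (forall t, J t -> {for t, continuous c}) ->
  smooth_on (J : set R^o) (chart M i \o c) ->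
  (forall t : R, J t -> is_derive t 1 (chart M i \o c) (dx t)) ->
  (forall t : R, J t -> is_derive t 1 dx (ddx t)) ->
  (forall t, J t -> forall w, euler_lagrange (G i) (chart M i (c t)) (dx t) (ddx t) w = 0) ->
  geodesic_on g J c.
Proof.
move=> oJ Ji cc xs xd xdd el; split.
  split=> // j k.
  have oJj : open ((J : set R^o) `&` c @^-1` chart_dom M j).
    by apply: open_setI_preimage => //; exact: chart_dom_open.
  apply: (@Ck_on_eq _ _ _ _ _ (transition i j \o (chart M i \o c))) => //.
    by move=> t [Jt _]; rewrite /= chartK//; exact: Ji.
  apply: (Ck_on_comp oJj (open_overlap M i j) (f := chart M i \o c)).
  - by move=> t [Jt dj]; exact: overlap_mem (Ji _ Jt) dj.
  - by apply: Ck_on_sub (xs k) => t [].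
  - exact: chart_transition_smooth.
move=> j t Jt dj x k.
have di := Ji _ Jt; have om := overlap_mem di dj.
have oo := open_overlap M i j.
have t2 := chart_transition_smooth M i j 2%N; have t1 := Ck_onW t2.
have Jnear : \forall s \near t, J s by exact: (open_near oJ Jt).
have xE : \forall s \near t, (transition i j \o (chart M i \o c)) s = x s.
  by apply: filterS Jnear => s Js; rewrite /x /= chartK//; exact: Ji.
have xE2 : \forall s \near t, derive1 (transition i j \o (chart M i \o c)) s = derive1 x s.
  apply: filterS Jnear => s Js; rewrite !derive1E; apply: near_eq_derive.
  by apply: (open_near oJ Js) => r Jr; rewrite /x /= chartK//; exact: Ji.
have H1 := is_derive_compD oo t1 (xd _ Jt) om.
have H2 : is_derive t 1 (derive1 (transition i j \o (chart M i \o c)))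
    ('D_(ddx t) (transition i j) (chart M i (c t)) +
     'D_(dx t) ('D_(dx t) (transition i j)) (chart M i (c t))).
  apply: (second_derivative_comp oo t2 om _ (xdd _ Jt)).
  by apply: filterS Jnear => s Js; exact: xd.
have [_ D1] := near_eq_is_derive xE H1.
have [_ D2] := near_eq_is_derive xE2 H2.
have -> : derive1 x t = 'D_(dx t) (transition i j) (chart M i (c t)) by rewrite derive1E.
have -> : derive1n 2 x t = 'D_(ddx t) (transition i j) (chart M i (c t)) +
     'D_(dx t) ('D_(dx t) (transition i j)) (chart M i (c t)).
  by rewrite derive1nS derive1n1 derive1E.
have jx : im j (x t) by exact: chart_im_mem.
move: k; apply/(geodesic_equationP _ _ jx) => w.
have xt : x t = transition i j (chart M i (c t)) by rewrite transition_chart.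
(* The differential of the transition is onto, so every test vector [w] of the chart [j] comes from
   one of the chart [i]. *)
pose w' := 'D_w (transition j i) (x t).
have ww : 'D_w' (transition i j) (chart M i (c t)) = w.
  have om' := overlap_mem dj di.
  have dw := Ck_is_derive w (chart_transition_smooth M j i 1%N) om'.
  have := is_derive_compD oo t1 dw.
  rewrite transition_chart// => /(_ om) H.
  apply: (is_derive_unique (f := id)); last exact: (is_derive_id (x t) w).
  apply: near_eq_is_derive H; apply: (open_near (open_overlap M j i) om').
  by move=> _ [q' [dj' di'] <-] /=; rewrite !chartK.
rewrite xt -ww.
rewrite -(@euler_lagrange_pullback _ _ (overlap i j) (im j) (G j) (G i) (transition i j)) //.
- exact: el.
- exact: chart_im_open.
- by move=> _ [q [di' dj'] <-]; rewrite transition_chart//; exact: chart_im_mem.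
- exact: gram_smooth.
- apply: (@Ck_on_sub _ _ _ _ (im i)); last exact: gram_smooth.
  by move=> _ [q [di' _] <-]; exact: chart_im_mem.
- by move=> y /coord_gram_posdef[].
- by move=> y u u' oy; exact: coord_gram_transition.
Qed.

End MetricInCharts.

(** * Solutions near an equilibrium over a prescribed time *)

Section Equilibrium.
Context {R : realType} {m : nat}.

(** Retraction onto the closed sup-norm ball, taken coordinatewise so that it is 1-Lipschitz. It
    turns a field that is Lipschitz on the ball into a globally Lipschitz one. *)
Definition box_clamp (z0 : 'rV[R]_m) (rho : R) (z : 'rV[R]_m) : 'rV[R]_m :=
  \row_i Num.max (z0 0 i - rho) (Num.min (z 0 i) (z0 0 i + rho)).

Lemma scalar_clampP (c s rho : R) : 0 <= rho ->
  exists2 p, p = Num.max (c - rho) (Num.min s (c + rho)) & c - rho <= p <= c + rho /\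
    [\/ p = s, p = c - rho /\ s <= c - rho | p = c + rho /\ c + rho <= s].
Proof.
move=> rho0; have [sc|sc] := leP s (c + rho).
  have [cs|cs] := leP (c - rho) s.
    by exists s => //; split; [rewrite cs|constructor 1].
  by exists (c - rho) => //; split; [rewrite lexx/=; lra|constructor 2; rewrite ltW].
have cc : c - rho <= c + rho by lra.
rewrite (max_idPr cc); exists (c + rho) => //; split; first by rewrite cc lexx.
by constructor 3; rewrite ltW.
Qed.

Lemma box_clamp_lipschitz z0 rho x y : 0 <= rho ->
  `|box_clamp z0 rho x - box_clamp z0 rho y| <= `|x - y|.
Proof.
move=> rho0; apply/mx_norm_leP => // a i; rewrite !mxE.
apply: (@le_trans _ _ `|x 0 i - y 0 i|); last by have := le_mx_norm (x - y) 0 i; rewrite !mxE.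
move: (x 0 i) (y 0 i) (z0 0 i) => s t c.
have clampP := scalar_clampP c _ rho0.
have := ler_norm (s - t); have := ler_norm (t - s); rewrite distrC => H1 H2.
move: (clampP s) (clampP t) => [p <- [/andP[p1 p2] p3]] [q <- [/andP[q1 q2] q3]].
rewrite ler_norml; apply/andP; split; case: p3 => [?|[? ?]|[? ?]]; case: q3 => [?|[? ?]|[? ?]]; lra.
Qed.

Lemma box_clamp_near z0 rho z : 0 <= rho -> `|box_clamp z0 rho z - z0| <= rho.
Proof.
move=> rho0; apply/mx_norm_leP => // a i; rewrite ord1 !mxE.
move: (z 0 i) (z0 0 i) => s c.
have [p <- [/andP[p1 p2] _]] := scalar_clampP c s rho0.
by rewrite ler_norml; apply/andP; split; lra.
Qed.

Lemma box_clamp_id z0 rho z : 0 <= rho -> `|z - z0| <= rho -> box_clamp z0 rho z = z.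
Proof.
move=> rho0 /(mx_norm_leP _ rho0) zr; apply/rowP => i; rewrite mxE.
have := zr 0 i; rewrite !mxE ler_norml => /andP[H1 H2].
by rewrite (min_idPl _) ?(max_idPr _)//; lra.
Qed.

Lemma linear_growth (W : normedModType R) (u u' : R -> W) (L T a : R) : 0 < a -> 0 <= L ->
  (forall t : R, 0 <= t <= T -> is_derive t 1 u (u' t)) -> `|u 0| <= a ->
  (forall t, 0 <= t <= T -> `|u' t| <= L * `|u t|) ->
  forall t, 0 <= t <= T -> `|u t| <= a * expR ((L + 1) * t).
Proof.
move=> a0 L0 du u0 uL.
apply: (norm_le_comparison (u' := u') (w := fun t => a * expR ((L + 1) * t))
  (w' := fun t => a * ((L + 1) * expR ((L + 1) * t)))) => //.
- by move=> t _; apply: (is_deriveZ (f := fun s : R => expR ((L + 1) * s))); exact: is_derive_expRM.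
- by rewrite mulr0 expR0 mulr1.
- move=> t /andP[t0 tT] ut; apply: (le_lt_trans (uL t _)); first by rewrite t0 ltW.
  apply: (le_lt_trans (ler_wpM2l L0 ut)).
  by rewrite mulrCA ltr_pM2l// ltr_pM2r ?expR_gt0// ltrDl.
Qed.

(** The truncated field is solved globally by [picard]. It vanishes at [z0], so distances to [z0]
    grow at most exponentially, and solutions starting within [rho / E] stay up to time [T] in the
    box, where the truncation changes nothing. *)
Lemma equilibrium_flow (U : set 'rV[R]_m) (f : 'rV[R]_m -> 'rV[R]_m) z0 (T : R) :
  open U -> Ck_on 1 U f -> U z0 -> f z0 = 0 -> 0 < T ->
  exists2 d : R, 0 < d & exists Phi : R -> 'rV[R]_m -> 'rV[R]_m,
    forall z, `|z - z0| < d -> Phi 0 z = z /\ forall t : R, `|t| <= T ->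
      U (Phi t z) /\ is_derive t 1 (Phi^~ z) (f (Phi t z)).
Proof.
move=> oU f1 Uz fz T0.
have [r r0 [rU fr]] := C1_strict_expansion oU Uz f1 ltr01.
pose K := \sum_i `|'D_(delta_mx 0 i) f z0|; pose L := K + 1.
have K0 : 0 <= K by rewrite sumr_ge0.
have L0 : 0 <= L by rewrite addr_ge0.
pose rho := r / 2; have rho0 : 0 < rho by rewrite divr_gt0.
have rr : rho < r by rewrite /rho; lra.
have fL x y : `|x - z0| <= rho -> `|y - z0| <= rho -> `|f y - f x| <= L * `|y - x|.
  move=> /le_lt_trans/(_ rr) xr /le_lt_trans/(_ rr) yr.
  rewrite -(subrK (total_derivative f z0 (y - x)) (f y - f x)).
  apply: (le_trans (ler_normD _ _)); rewrite /L mulrDl addrC lerD//; last exact: fr.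
  exact: total_derivative_bound.
pose pr := box_clamp z0 rho.
have prn z : `|pr z - z0| <= rho by apply: box_clamp_near; exact: ltW.
pose F (t : R) z := f (pr z).
have FL t x y : `|F t x - F t y| <= L * `|x - y|.
  apply: (le_trans (fL _ _ (prn _) (prn _))); rewrite ler_wpM2l//.
  by apply: box_clamp_lipschitz; exact: ltW.
have Fc (phi : R -> 'rV[R]_m) : continuous phi -> continuous (fun t => F t (phi t)).
  move=> cphi t; apply/(@continuous_distP R R^o) => e e0.
  have eL : 0 < e / (L + 1) by rewrite divr_gt0// ltr_wpDl.
  have /(@continuous_distP R R^o)/(_ _ eL)[d d0 dphi] := cphi t.
  exists d => // s sd; apply: (le_trans (FL 0 _ _)).
  apply: (@le_trans _ _ ((L + 1) * `|phi s - phi t|)); first by rewrite ler_wpM2r// lerDl.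
  by rewrite mulrC -ler_pdivlMr ?ltr_wpDl//; exact: dphi.
have /choice[Phi HPhi] (z : 'rV[R]_m) : exists phi : R -> 'rV[R]_m, phi 0 = z /\
    forall t : R, `|t| <= T -> is_derive t 1 phi (F t (phi t)).
  exact: (picard (B := `|F 0 z|) L0 T0 Fc FL).
pose E := expR ((L + 1) * T); have E0 : 0 < E by exact: expR_gt0.
exists (rho / E); first by rewrite divr_gt0.
exists (fun t z => Phi z t) => z zd; have [p0 pd] := HPhi z; split=> // t tT.
have Fb s x : `|F s x| <= L * `|x - z0|.
  have -> : F s x = F s x - F s z0 by rewrite [F s z0]/F /pr box_clamp_id ?fz ?subr0// ?subrr ?normr0 ltW.
  exact: FL.
have a0 : 0 < rho / E by rewrite divr_gt0.
have bound s : 0 <= s <= T -> rho / E * expR ((L + 1) * s) <= rho.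
  move=> /andP[s0 sT]; rewrite mulrAC ler_pdivrMr// ler_wpM2l ?(ltW rho0)//.
  by rewrite ler_expR ler_wpM2l// addr_ge0.
have near : `|Phi z t - z0| <= rho.
  move: tT; have [t0 tT|t0] := leP 0 t.
    rewrite ger0_norm// in tT.
    have tt : 0 <= t <= T by rewrite t0.
    apply: le_trans (bound t tt).
    apply: (linear_growth (u := fun s => Phi z s - z0) (u' := fun s => F s (Phi z s)) a0 L0) tt => //.
    - move=> s /andP[s0 sT]; rewrite -[F s _]subr0; apply: is_deriveB.
      by apply: pd; rewrite ger0_norm.
    - by rewrite p0 ltW.
  rewrite ltr0_norm// => tT.
  have tt : 0 <= - t <= T by rewrite tT oppr_ge0 ltW.
  apply: le_trans (bound _ tt).
  have := linear_growth (u := fun s => Phi z (- s) - z0) (u' := fun s => - F (- s) (Phi z (- s))) a0 L0 _ _ _ tt.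
  rewrite opprK; apply.
  - move=> s /andP[s0 sT]; rewrite -[- F _ _]subr0; apply: is_deriveB.
    by apply: is_derive_opp; apply: pd; rewrite normrN ger0_norm.
  - by rewrite oppr0 p0 ltW.
  - by move=> s _; rewrite normrN.
split; first by apply: rU; exact: le_lt_trans rr.
have := pd t tT; rewrite /F /pr box_clamp_id//; exact: ltW.
Qed.

End Equilibrium.

Section PhaseField.
Context {R : realType} {n : nat}.
Variables (U : set 'rV[R]_n) (A : 'rV[R]_n -> 'M[R]_n).
Hypotheses (oU : open U) (As : smooth_on U A) (Au : forall x, U x -> A x \in unitmx).

Definition phase_field (z : 'rV[R]_(n + n)) : 'rV[R]_(n + n) :=
  row_mx (rsubmx z)
    (- (spray_covector A (lsubmx z) (rsubmx z) *m invmx (A (lsubmx z)))).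

Definition phase_domain : set 'rV[R]_(n + n) := [set z | U (lsubmx z)].

Lemma open_phase_domain : open phase_domain.
Proof.
have l0 : Ck_on 0 (setT : set 'rV[R]_(n + n)) (fun z => lsubmx z).
  by apply: Ck_on_lsubmx; [exact: openT|apply: Ck_on_id; exact: openT].
by have := open_preimage_Ck openT oU l0; rewrite setTI.
Qed.

Lemma phase_field_smooth : smooth_on phase_domain phase_field.
Proof.
have oP := open_phase_domain.
have ls : smooth_on phase_domain (fun z => lsubmx z).
  by move=> k; apply: Ck_on_lsubmx => //; exact: Ck_on_id.
have rs : smooth_on phase_domain (fun z => rsubmx z).
  by move=> k; apply: Ck_on_rsubmx => //; exact: Ck_on_id.
have lU z : phase_domain z -> U (lsubmx z) by [].
move=> k; apply: Ck_on_row_mx => //.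
have -> : (fun z : 'rV[R]_(n + n) => - (spray_covector A (lsubmx z) (rsubmx z) *m invmx (A (lsubmx z)))) =
    (fun z => (-1 : R^o) *: (spray_covector A (lsubmx z) (rsubmx z) *m invmx (A (lsubmx z)))).
  by apply/funext => z; rewrite scaleN1r.
apply: Ck_onZ => //; first exact: Ck_on_cst.
apply: Ck_on_mulmx => //; last first.
  apply: Ck_on_invmx => //; first by move=> z /lU; exact: Au.
  exact: (Ck_on_comp oP oU lU (ls k) (As k)).
apply/(Ck_on_mxP _ _ oP) => i l; under eq_fun do rewrite mxE.
apply: Ck_onD => //.
  apply: Ck_on_form => //; last exact: Ck_on_cst.
  exact: (total_derivative_smooth oP oU As ls rs lU k).
apply: Ck_onN => //; apply: Ck_onM => //; first exact: Ck_on_cst.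
apply: Ck_on_form => //.
apply: (@Ck_on_comp _ _ _ _ _ _ _ (fun z => lsubmx z) ('D_(delta_mx 0 l) A) oP oU lU (ls k)).
exact: (Ck_on_derive _ (As k.+1)).
Qed.

(** Degree two in the velocity is what allows the time of a geodesic to be rescaled. *)
Lemma spray_covectorZ x v t : spray_covector A x (t *: v) = t ^+ 2 *: spray_covector A x v.
Proof.
apply/rowP => l; rewrite !mxE !(formZl, formZr).
have := total_derivative_linear A x t v 0.
have -> : total_derivative A x 0 = 0.
  by rewrite /total_derivative big1// => i _; rewrite mxE scale0r.
rewrite !addr0 => ->; rewrite formZm; ring.
Qed.

End PhaseField.

Lemma is_derive_lsubmx (R : realType) (V : normedModType R) m n1 n2 (z : V -> 'M[R]_(m, n1 + n2))
    x v dz : is_derive x v z dz -> is_derive x v (fun y => lsubmx (z y)) (lsubmx dz).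
Proof.
move=> /is_derive_mxP H; apply/is_derive_mxP => i j; rewrite mxE.
by under eq_fun do rewrite mxE; exact: H.
Qed.

Lemma is_derive_rsubmx (R : realType) (V : normedModType R) m n1 n2 (z : V -> 'M[R]_(m, n1 + n2))
    x v dz : is_derive x v z dz -> is_derive x v (fun y => rsubmx (z y)) (rsubmx dz).
Proof.
move=> /is_derive_mxP H; apply/is_derive_mxP => i j; rewrite mxE.
by under eq_fun do rewrite mxE; exact: H.
Qed.

(** * Uniqueness of geodesics *)

Section GeodesicUniqueness.
Context {R : realType} {n : nat} {M : smooth_manifold R n} (g : riemannian_metric M).
Local Notation im i := (chart M i @` chart_dom M i).
Local Notation G i := (coord_gram g i).

Lemma geodesic_phase (J : set R) (c : R -> M) i t : open (J : set R^o) ->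
  geodesic_on g J c -> J t -> chart_dom M i (c t) ->
  is_derive t 1 (fun s => row_mx (chart M i (c s)) (derive1 (chart M i \o c) s))
    (phase_field (G i) (row_mx (chart M i (c t)) (derive1 (chart M i \o c) t))).
Proof.
move=> oJ [[cc cs] ceq] Jt dt.
have oJi : open ((J : set R^o) `&` c @^-1` chart_dom M i).
  by apply: open_setI_preimage => //; exact: chart_dom_open.
have Jit : (J `&` c @^-1` chart_dom M i) t by [].
have D1 := Ck_is_derive (1 : R^o) (cs i 2%N) Jit.
have D2 := Ck_is_derive (1 : R^o) (Ck_on_derive (1 : R^o) (cs i 2%N)) Jit.
have E : derive1 (chart M i \o c) = 'D_(1 : R^o) (chart M i \o c).
  by apply/funext => s; rewrite derive1E.
have it := chart_im_mem dt.
rewrite /phase_field row_mxKl row_mxKr; apply: is_derive_row_mx; rewrite E//.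
have G1 : Ck_on 1 (im i) (G i) by exact: gram_smooth.
have Gu := posdef_unit (coord_gram_posdef g it).
have := (geodesic_equationP g _ _ it).1 (ceq i t Jt dt).
move/(euler_lagrange_eq0 _ _ (chart_im_open M i) G1 it Gu).
by rewrite derive1nS derive1n1 E derive1E => <-.
Qed.

(** Where the curves agree, [c2] also lies in the chart, and uniqueness for the phase equation
    extends the agreement to the right. At a limit time, where [c2] could a priori be elsewhere, the
    Hausdorff property identifies the two limits from the left. *)
Lemma geodesic_unique (J1 J2 : set R) (c1 c2 : R -> M) i :
  open (J1 : set R^o) -> open (J2 : set R^o) ->
  geodesic_on g J1 c1 -> geodesic_on g J2 c2 ->
  (forall t, 0 <= t <= 1 -> [/\ J1 t, J2 t & chart_dom M i (c1 t)]) ->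
  c1 0 = c2 0 -> derive1 (chart M i \o c1) 0 = derive1 (chart M i \o c2) 0 ->
  forall t, 0 <= t <= 1 -> c1 t = c2 t.
Proof.
move=> oJ1 oJ2 g1 g2 H c0 v0.
apply: real_induction => //.
- move=> t /andP[t0 t1] eqs.
  have [J1t J2t d1t] := H t ltac:(by rewrite t0 ltW).
  have ct : c1 t = c2 t by apply: eqs; rewrite t0 lexx.
  have oJ1i : open ((J1 : set R^o) `&` c1 @^-1` chart_dom M i).
    by apply: open_setI_preimage => //; [exact: chart_dom_open|exact: g1.1.1].
  have oJ2i : open ((J2 : set R^o) `&` c2 @^-1` chart_dom M i).
    by apply: open_setI_preimage => //; [exact: chart_dom_open|exact: g2.1.1].
  have [r1 r10 H1] := open_ball_ex oJ1i (conj J1t d1t).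
  have d2t : chart_dom M i (c2 t) by rewrite -ct.
  have [r2 r20 H2] := open_ball_ex oJ2i (conj J2t d2t).
  pose r := Num.min r1 r2; have r0 : 0 < r by rewrite lt_min r10.
  (* The phase equation is restarted before [t]: agreement on the left of [t] gives equal velocities
     at an interior time at once, while at [t] itself [derive1] looks to both sides. If [t'] is 0,
     the velocities agree by hypothesis. *)
  pose t' := Num.max 0 (t - r / 2).
  have t't : t' <= t by rewrite ge_max t0/=; lra.
  have t'r : t - r / 2 <= t' by rewrite le_max lexx orbT.
  have t'0 : 0 <= t' by rewrite le_max lexx.
  pose z (c : R -> M) s := row_mx (chart M i (c s)) (derive1 (chart M i \o c) s).
  have zt' : z c1 t' = z c2 t'.
    rewrite /z eqs ?t'0//; congr row_mx.
    have [->//|t'n0] := eqVneq t' 0.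
    have t'p : 0 < t' by rewrite lt_neqAle eq_sym t'n0.
    have t'lt : t' < t.
      have -> : t' = t - r / 2 by apply/eqP; move: t'n0; rewrite /t'; case: (leP 0 (t - r/2)); rewrite ?eqxx.
      lra.
    rewrite !derive1E; apply: near_eq_derive.
    apply: (open_near (U := `]0, t[%classic)); first exact: interval_open.
      by rewrite /= in_itv/= t'p.
    by move=> s; rewrite /= in_itv/= => /andP[s0 st]; rewrite /= eqs// !ltW.
  have in1 s : `|s - t| < r -> J1 s /\ chart_dom M i (c1 s).
    by rewrite lt_min => /andP[/H1[]].
  have in2 s : `|s - t| < r -> J2 s /\ chart_dom M i (c2 s).
    by rewrite lt_min => /andP[_ /H2[]].
  pose T := t - t' + r / 2.
  have inT s : 0 <= s <= T -> `|s + t' - t| < r.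
    by move=> /andP[s0]; rewrite /T => sT; rewrite ltr_norml; apply/andP; split; lra.
  have U := @ode_unique R _ (phase_domain (im i)) (phase_field (G i))
    (open_phase_domain (chart_im_open M i)) _ T (fun s => z c1 (s + t')) (fun s => z c2 (s + t')).
  have {}U : forall s, 0 <= s <= T -> z c1 (s + t') = z c2 (s + t').
    apply: U.
    - apply: phase_field_smooth; [exact: chart_im_open|exact: gram_smooth|].
      by move=> x ix; exact: posdef_unit (coord_gram_posdef g ix).
    - move=> s sT; have [Js ds] := in1 _ (inT s sT); split.
        by rewrite /phase_domain /= row_mxKl; exact: chart_im_mem.
      by apply: is_derive_translate; exact: geodesic_phase g1 Js ds.
    - move=> s sT; have [Js ds] := in2 _ (inT s sT).
      by apply: is_derive_translate; exact: geodesic_phase g2 Js ds.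
    - by rewrite add0r.
  exists (r / 2); first by rewrite divr_gt0.
  move=> s /andP[ts str] _.
  have sT : 0 <= s - t' <= T by apply/andP; rewrite /T; split; lra.
  have := U _ sT; rewrite subrK => /(congr1 (fun z => chart_inv M i (lsubmx z))).
  have sr : `|s - t| < r by rewrite ltr_norml; apply/andP; split; lra.
  rewrite /z !row_mxKl !chartK//; [by have [] := in2 s sr|by have [] := in1 s sr].
- move=> t /andP[t0 t1] eqs.
  have [J1t J2t _] := H t ltac:(by rewrite ltW).
  apply: manifold_hausdorff => A B nA nB.
  have n1 := g1.1.1 _ J1t _ nA; have n2 := g2.1.1 _ J2t _ nB.
  have : \forall s \near t^'-, [/\ 0 < s, s < t, A (c1 s) & B (c2 s)].
    near=> s; split.
    + near: s; exact: nbhs_left_gt.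
    + near: s; exact: nbhs_left_lt.
    + near: s; exact: cvg_within.
    + near: s; exact: cvg_within.
  move=> /filter_ex[s [s0 st As Bs]].
  by exists (c1 s); split=> //; rewrite eqs// st ltW.
Unshelve. all: by end_near. Qed.

End GeodesicUniqueness.

(** * Normal coordinates and the Gauss lemma *)

Lemma open_norm_ball (R : realType) (V : normedModType R) (x : V) (r : R) :
  open [set y | `|y - x| < r].
Proof.
apply: open_distP => y /= yr; exists (r - `|y - x|); first by rewrite subr_gt0.
move=> z zy; rewrite -(subrK y z) -addrA; apply: (le_lt_trans (ler_normD _ _)); lra.
Qed.

Section RadialSolutions.
Context {R : realType} {n : nat}.
Variables (U : set 'rV[R]_n) (A : 'rV[R]_n -> 'M[R]_n) (x0 : 'rV[R]_n).
Hypotheses (oU : open U) (As : smooth_on U A) (Au : forall x, U x -> A x \in unitmx).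
Hypothesis Ux0 : U x0.
Let f := phase_field A.
Let emb (v : 'rV[R]_n) := row_mx x0 v.

(* [E v] is the position at time 1 of the solution with initial position [x0] and initial
   velocity [v]; by homogeneity [t |-> E (t *: v)] is the whole solution. *)
Lemma radial_solutions : exists2 r : R, 0 < r & exists E : 'rV[R]_n -> 'rV[R]_n,
  [/\ smooth_on [set v | `|v| < r] E, forall v, `|v| < r -> U (E v), E 0 = x0,
     forall v, is_derive 0 v E v &
     forall (v : 'rV[R]_n) (t : R), `|v| < r -> `|t| < 2 -> `|t *: v| < r -> forall w,
       euler_lagrange A (E (t *: v)) ('D_v E (t *: v)) ('D_v ('D_v E) (t *: v)) w = 0].
Proof.
have oP := open_phase_domain oU.
have fs : smooth_on (phase_domain U) f by exact: phase_field_smooth.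
have z0P : phase_domain U (emb 0) by rewrite /phase_domain /= row_mxKl.
have f0 : f (emb 0) = 0.
  rewrite /f /phase_field row_mxKl row_mxKr -[in spray_covector _ _ 0](scale0r 0).
  by rewrite spray_covectorZ expr0n/= scale0r mul0mx oppr0 row_mx0.
(* Any time beyond 1 would do: [exp_rel] asks for geodesics on an open interval around the segment
   from 0 to 1. *)
have [d d0 [Phi HPhi]] := equilibrium_flow oP (fs 1%N) z0P f0 (ltr0n R 2).
pose W := [set z | `|z - emb 0| < d].
have embW v : `|v| < d -> W (emb v).
  move=> vd; apply: le_lt_trans vd; apply/mx_norm_leP => // i j; rewrite /emb.
  case: (split_ordP j) => k ->; rewrite !mxE ?(row_mxEl,row_mxEr).
    by rewrite (unsplitK (inl k)) subrr normr0.
  by rewrite (unsplitK (inr k)) !mxE subr0 le_mx_norm.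
have oW : open W by exact: open_norm_ball.
have oB : open [set v : 'rV[R]_n | `|v| < d].
  by have := open_norm_ball (0 : 'rV[R]_n) d; under eq_set do rewrite subr0.
have T01 t : 0 <= t <= 1 -> `|t| <= 2 :> R.
  by move=> /andP[t0 t1]; rewrite ger0_norm// (le_trans t1)// ler1n.
have flow : is_flow (phase_domain U) f W 1 Phi.
  by move=> z Wz; have [p0 pd] := HPhi z Wz; split=> // t /T01; exact: pd.
have PhiC k := flow_Ck k oP fs oW ler01 flow (t := 1) ltac:(by rewrite ler01 lexx).
pose E v := lsubmx (Phi 1 (emb v)) : 'rV[R]_n.
have Es : smooth_on [set v | `|v| < d] E.
  move=> k; apply: Ck_on_lsubmx => //; apply: (Ck_on_comp oB oW _ _ (PhiC k)) => //.
  by apply: Ck_on_row_mx => //; [exact: Ck_on_cst|exact: Ck_on_id].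
have hom (v : 'rV[R]_n) (t : R) : `|v| < d -> `|t| <= 2 -> `|t *: v| < d ->
    E (t *: v) = lsubmx (Phi t (emb v)).
  move=> vd t2 tvd.
  have [q0 qd] := HPhi _ (embW _ vd); have [p0 pd] := HPhi _ (embW _ tvd).
  (* The trajectory of [emb v] run at speed [t], with its velocity component multiplied accordingly.
     By homogeneity of the spray it solves the phase equation from [emb (t *: v)], and time 1 gives
     the claim. *)
  pose psi (s : R) := row_mx (lsubmx (Phi (t * s) (emb v))) (t *: rsubmx (Phi (t * s) (emb v)))
    : 'rV[R]_(n + n).
  have := @ode_unique R _ (phase_domain U) f oP (fs 1%N) 1 (Phi^~ (emb (t *: v))) psi.
  have psid (s : R) : 0 <= s <= 1 -> is_derive s 1 psi (f (psi s)).
    move=> /andP[s0 s1].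
    have ts2 : `|t * s| <= 2.
      by rewrite normrM (ger0_norm s0) (le_trans _ t2)// ler_piMr.
    have [_ dts] := qd _ ts2.
    have dg : is_derive s 1 (fun s : R => t * s) t.
      by apply: is_derive_exact => h; rewrite /GRing.scale/= mulr1 mulrDr [t * h]mulrC.
    have D := is_derive_comp1 dg dts.
    have -> : f (psi s) = row_mx (lsubmx (t *: f (Phi (t * s) (emb v))))
        (t *: rsubmx (t *: f (Phi (t * s) (emb v)))).
      rewrite /f /phase_field /psi !row_mxKl !row_mxKr !linearZ /= row_mxKl row_mxKr.
      by rewrite spray_covectorZ scalerN -scalemxAl scalerN scalerA expr2.
    apply: is_derive_row_mx; first exact: (is_derive_lsubmx D).
    by apply: is_deriveZ; exact: (is_derive_rsubmx D).
  move=> /(_ (fun s sT => pd s (T01 s sT)) psid) H.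
  have := H _ 1; rewrite /E => ->; rewrite ?ler01 ?lexx//.
    by rewrite /psi mulr1 row_mxKl.
  by rewrite p0 /psi mulr0 q0 /emb row_mxKl row_mxKr.
have DE (v : 'rV[R]_n) (t : R) : `|v| < d -> `|t| < 2 -> `|t *: v| < d ->
    \forall s \near t, `|s| < 2 /\ `|s *: v| < d.
  move=> vd t2 tvd; near=> s; split.
    near: s; apply: (open_near (U := [set s : R^o | `|s| < 2])) => //.
    by have := open_norm_ball (0 : R^o) 2; under eq_set do rewrite subr0.
  near: s.
  have cs : s *: v @[s --> t] --> t *: v by apply: cvgZl; exact: cvg_id.
  by apply: (cs [set w : 'rV[R]_n | `|w| < d]); apply: open_nbhs_nbhs; split.
have D1 (v : 'rV[R]_n) (s : R) : `|v| < d -> `|s| < 2 -> `|s *: v| < d ->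
    'D_v E (s *: v) = rsubmx (Phi s (emb v)).
  move=> vd s2 svd.
  have [_ dP] := (HPhi _ (embW _ vd)).2 s (ltW s2).
  have := is_derive_lsubmx dP; rewrite /f /phase_field row_mxKl => H1.
  have H2 : is_derive s 1 (fun s => E (s *: v)) (rsubmx (Phi s (emb v))).
    apply: near_eq_is_derive H1; have := DE v s vd s2 svd; apply: filterS => r [r2 rv].
    by rewrite hom// ltW.
  have := Ck_is_derive v (Es 1%N) svd; rewrite -[s *: v]add0r => /is_derive_line H3.
  apply: is_derive_unique _ H2.
  by under eq_fun do rewrite -[_ *: v]add0r; exact: H3.
exists d => //; exists E; split=> //.
- move=> v vd; have [_ /(_ 1)] := HPhi _ (embW _ vd).
  by rewrite normr1 ler1n => /(_ isT)[].
- have z0 : `|0 : 'rV[R]_n| < d by rewrite normr0.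
  have := hom 0 0 z0; rewrite normr0 scale0r => /(_ (ler0n _ _) z0) ->.
  by rewrite (HPhi _ (embW _ z0)).1 row_mxKl.
- move=> v.
  (* [D1] only concerns directions in the ball of radius [d]; an arbitrary [v] is first scaled into
     it. *)
  pose l := d / (2 * (`|v| + 1)); have v1 : 0 < `|v| + 1 by rewrite ltr_wpDl.
  have l0 : 0 < l by rewrite divr_gt0// mulr_gt0.
  have lv : `|l *: v| < d.
    rewrite normrZ gtr0_norm// /l mulrAC ltr_pdivrMr ?mulr_gt0// ltr_pM2l//; lra.
  have z0 : `|0 : 'rV[R]_n| < d by rewrite normr0.
  have Ed := Ck_is_derive v (Es 1%N) z0.
  suff H : 'D_v E 0 = v by case: Ed => dE _; split.
  have := D1 (l *: v) 0 lv; rewrite normr0 scale0r => /(_ (ltr0n _ _) z0).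
  rewrite (HPhi _ (embW _ lv)).1 /emb row_mxKr.
  have [_ ->] := is_derive_dirZ l Ed => /eqP.
  by rewrite -subr_eq0 -scalerBr scaler_eq0 gt_eqF//= subr_eq0 => /eqP.
- move=> v t vd t2 tvd.
  have Ut : U (E (t *: v)).
    have [_ /(_ 1)] := HPhi _ (embW _ tvd).
    by rewrite normr1 ler1n => /(_ isT)[].
  apply/(euler_lagrange_eq0 _ _ oU (As 1%N) Ut (Au Ut)).
  have [_ dP] := (HPhi _ (embW _ vd)).2 t (ltW t2).
  have := is_derive_rsubmx dP; rewrite /f /phase_field row_mxKr => H1.
  have H2 : is_derive t 1 (fun s => 'D_v E (s *: v)) ('D_v ('D_v E) (t *: v)).
    have := Ck_is_derive v (Ck_on_derive v (Es 2%N)) tvd; rewrite -[t *: v]add0r => /is_derive_line H3.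
    by under eq_fun do rewrite -[_ *: v]add0r; exact: H3.
  have H3 : is_derive t 1 (fun s => 'D_v E (s *: v))
      (- (spray_covector A (lsubmx (Phi t (emb v))) (rsubmx (Phi t (emb v))) *m
          invmx (A (lsubmx (Phi t (emb v)))))).
    apply: near_eq_is_derive H1; have := DE v t vd t2 tvd; apply: filterS => r [r2 rv].
    by rewrite D1.
  by rewrite (is_derive_unique H2 H3) D1// -hom// ltW.
Unshelve. all: by end_near. Qed.

End RadialSolutions.

Lemma open_centered_ball (R : realType) (V : normedModType R) (r : R) :
  open [set v : V | `|v| < r].
Proof. by have := open_norm_ball (0 : V) r; under eq_set do rewrite subr0. Qed.

Definition pullback_gram (R : realType) n (A : 'rV[R]_n -> 'M[R]_n) (E : 'rV[R]_n -> 'rV[R]_n)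
    (w : 'rV[R]_n) : 'M[R]_n :=
  jacobian_mx E w *m A (E w) *m (jacobian_mx E w)^T.

Section PullbackGram.
Context {R : realType} {n : nat}.
Variables (U B : set 'rV[R]_n) (A : 'rV[R]_n -> 'M[R]_n) (E : 'rV[R]_n -> 'rV[R]_n).
Hypotheses (oU : open U) (oB : open B) (As : smooth_on U A) (Es : smooth_on B E).
Hypothesis EU : forall w, B w -> U (E w).
Local Notation H := (pullback_gram A E).

Lemma form_pullback_gram w u v : B w -> form (H w) u v = form (A (E w)) ('D_u E w) ('D_v E w).
Proof.
move=> Bw; rewrite !(derive_total oB (Es 1%N) _ Bw) !total_derivative_mx.
by rewrite /form /pullback_gram trmx_mul !mulmxA.
Qed.

Lemma pullback_gram_smooth : smooth_on B H.
Proof.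
move=> k; have Js := jacobian_smooth oB Es.
apply: Ck_on_mulmx => //; last exact: Ck_on_trmx.
apply: Ck_on_mulmx => //.
exact: (Ck_on_comp oB oU EU (Es k) (As k)).
Qed.

End PullbackGram.

(** Seen through [E], rays are straight lines run at constant velocity, so the pulled back
    expression has acceleration 0 and only derivatives of [H] remain. *)
Lemma euler_lagrange_radial (R : realType) n (U B : set 'rV[R]_n) (A H : 'rV[R]_n -> 'M[R]_n)
    (E : 'rV[R]_n -> 'rV[R]_n) x v w :
  open U -> open B -> smooth_on U A -> smooth_on B H -> smooth_on B E ->
  (forall w, B w -> U (E w)) -> (forall y, U y -> (A y)^T = A y) ->
  (forall y u u', B y -> form (H y) u u' = form (A (E y)) ('D_u E y) ('D_u' E y)) -> B x ->
  euler_lagrange A (E x) ('D_v E x) ('D_v ('D_v E) x) ('D_w E x) = 0 ->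
  form ('D_v H x) v w = 2^-1 * form ('D_w H x) v v.
Proof.
move=> oU oB As Hs Es EU Asym HE Bx.
have := euler_lagrange_pullback v 0 w oB oU EU (Es 2%N) (As 1%N) (Hs 1%N) Asym HE Bx.
rewrite derive0 add0r => <-.
by rewrite /euler_lagrange form0l add0r => /eqP; rewrite subr_eq0 => /eqP.
Qed.

Section Gauss.
Context {R : realType} {n : nat}.
Variables (r : R) (H : 'rV[R]_n -> 'M[R]_n).
Local Notation B := [set v : 'rV[R]_n | `|v| < r].
Hypotheses (r0 : 0 < r) (Hs : smooth_on B H) (Hsym : forall x, B x -> (H x)^T = H x).
Hypothesis Hray : forall (v : 'rV[R]_n) (t : R) w, B v -> `|t| < 2 -> B (t *: v) ->
  form ('D_v H (t *: v)) v w = 2^-1 * form ('D_w H (t *: v)) v v.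

Lemma form_derive (x w u v : 'rV[R]_n) : B x ->
  is_derive x w (fun y => form (H y) u v : R^o) (form ('D_w H x) u v).
Proof.
move=> Bx; have oB := @open_centered_ball R 'rV[R]_n r.
have := is_derive_form (Ck_is_derive w (Hs 1%N) Bx) (is_derive_cst u x w) (is_derive_cst v x w).
by rewrite form0l form0r !addr0.
Qed.

Lemma ray_in (w : 'rV[R]_n) (t : R) : B w -> 0 <= t <= 1 -> `|t| < 2 /\ B (t *: w).
Proof.
move=> Bw /andP[t0 t1]; rewrite /= normrZ (ger0_norm t0); split.
  by rewrite (le_lt_trans t1)// ltr1n.
by apply: le_lt_trans Bw; rewrite ler_piMl.
Qed.

Lemma ray_derive (w u v : 'rV[R]_n) (t : R) : B w -> 0 <= t <= 1 ->
  is_derive t 1 (fun t => form (H (t *: w)) u v : R^o) (form ('D_w H (t *: w)) u v).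
Proof.
move=> Bw t01; have [_ Btw] := ray_in Bw t01.
have := form_derive w u v Btw; rewrite -[t *: w]add0r => /is_derive_line.
by under eq_fun do rewrite add0r.
Qed.

(** Testing [Hray] against the velocity itself equates [form ('D_w H (t *: w)) w w] with its half,
    so the squared speed is constant along the ray. *)
Lemma radial_norm w : B w -> form (H w) w w = form (H 0) w w.
Proof.
move=> Bw; apply/eqP; rewrite -subr_eq0 -normr_le0.
have := @mean_value_le R R^o (fun t => form (H (t *: w)) w w) (fun=> 0) 0 0 1 ler01.
rewrite scale1r scale0r mul0r; apply; last by move=> *; rewrite normr0.
move=> t t01; have [t2 Btw] := ray_in Bw t01.
have K := Hray w Bw t2 Btw.
have <- : form ('D_w H (t *: w)) w w = 0 by lra.
exact: ray_derive.
Qed.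

(** [radial_norm] is an identity between functions of the point; this is its derivative in the
    direction [u], transverse to the ray. *)
Lemma radial_norm_derive x u : B x ->
  form ('D_u H x) x x + 2 * form (H x) x u = 2 * form (H 0) x u.
Proof.
move=> Bx; have oB := @open_centered_ball R 'rV[R]_n r.
have B0 : B 0 by rewrite /= normr0.
have D1 := is_derive_form (Ck_is_derive u (Hs 1%N) Bx) (is_derive_id x u) (is_derive_id x u).
have D2 := is_derive_form (is_derive_cst (H 0) x u) (is_derive_id x u) (is_derive_id x u).
have := is_derive_unique (near_eq_is_derive (open_near oB Bx radial_norm) D1) D2.
rewrite /= {4}/form mulmx0 mul0mx mxE.
rewrite (form_sym u x (Hsym Bx)) (form_sym u x (Hsym B0)); lra.
Qed.

Lemma gauss_lemma w u : B w -> form (H w) w u = form (H 0) w u.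
Proof.
move=> Bw.
(* The factor [t] makes the derivative vanish: [Hray] turns [t * form ('D_w H (t *: w)) w u] into
   half of [t * form ('D_u H (t *: w)) w w], and [radial_norm_derive] at [t *: w] says that this is
   minus the difference in parentheses. *)
pose phi (t : R) : R^o := t * (form (H (t *: w)) w u - form (H 0) w u).
have dphi (t : R) : 0 <= t <= 1 -> is_derive t 1 phi 0.
  move=> t01; have [t2 Btw] := ray_in Bw t01.
  have D2 : is_derive t 1 (fun t => form (H (t *: w)) w u - form (H 0) w u : R^o)
      (form ('D_w H (t *: w)) w u - 0) by apply: is_deriveB; exact: ray_derive.
  have := is_deriveZf (is_derive_id t (1 : R)) D2; rewrite /GRing.scale/=.
  suff -> : t * (form ('D_w H (t *: w)) w u - 0) + 1 * (form (H (t *: w)) w u - form (H 0) w u) = 0.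
    by [].
  rewrite subr0 mul1r (Hray u Bw t2 Btw).
  have [t0|tn0] := eqVneq t 0; first by rewrite t0 scale0r mul0r subrr addr0.
  have := radial_norm_derive u Btw; rewrite !(formZl,formZr) => K.
  apply: (mulfI tn0); rewrite mulr0; lra.
have := @mean_value_le R R^o phi (fun=> 0) 0 0 1 ler01 dphi.
rewrite /phi mul0r scale1r mul1r mul0r subr0 => K.
by apply/eqP; rewrite -subr_eq0 -normr_le0; apply: K => *; rewrite normr0.
Qed.

End Gauss.

(** The radius refers to the sup norm of coordinates. [normal_expand] is the quantitative hypothesis
    from which injectivity, openness and smoothness of the inverse are drawn. *)
Record is_normal_chart (R : realType) (n : nat) (M : smooth_manifold R n)
    (g : riemannian_metric M) (p : M) (r : R) (E : 'rV[R]_n -> 'rV[R]_n) : Prop := {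
  normal_radius : 0 < r;
  normal_smooth : smooth_on [set v | `|v| < r] E;
  normal_im : forall v, `|v| < r ->
    (chart M (chart_at M p) @` chart_dom M (chart_at M p)) (E v);
  normal_center : E 0 = chart M (chart_at M p) p;
  normal_derive0 : forall v, is_derive 0 v E v;
  normal_expand : forall x y, `|x| < r -> `|y| < r ->
    `|E y - E x - (y - x)| <= 2^-1 * `|y - x|;
  normal_geodesic : forall (v : 'rV[R]_n) (t : R), `|v| < r -> `|t| < 2 -> `|t *: v| < r ->
    forall w, euler_lagrange (coord_gram g (chart_at M p)) (E (t *: v))
      ('D_v E (t *: v)) ('D_v ('D_v E) (t *: v)) w = 0
}.

Section NormalChart.
Context {R : realType} {n : nat} {M : smooth_manifold R n} (g : riemannian_metric M) (p : M).
Local Notation i0 := (chart_at M p).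
Local Notation A := (coord_gram g i0).
Local Notation im i := (chart M i @` chart_dom M i).

Lemma normal_chart_ex : exists r E, is_normal_chart g p r E.
Proof.
have ip := chart_im_mem (chart_at_mem p).
have Au x (ix : im i0 x) := posdef_unit (coord_gram_posdef g ix).
have [r r0 [E [Es Ei E0 Ed Eg]]] :=
  radial_solutions (chart_im_open M i0) (@gram_smooth _ _ _ g i0) Au ip.
have oB := @open_centered_ball R 'rV[R]_n r.
have z0 : `|0 : 'rV[R]_n| < r by rewrite normr0.
have h2 : 0 < (2^-1 : R) by rewrite invr_gt0.
(* The differential of [E] at 0 is the identity, so the strict expansion there with error one half
   is [normal_expand]. *)
have [s s0 [_ Hs]] := C1_strict_expansion oB z0 (Es 1%N) h2.
pose d := Num.min r s.
have dr v : `|v| < d -> `|v| < r by rewrite lt_min => /andP[].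
have ds v : `|v| < d -> `|v - 0| < s by rewrite lt_min subr0 => /andP[].
exists d, E; split.
- by rewrite lt_min r0.
- by move=> k; apply: Ck_on_sub (Es k) => v; exact: dr.
- by move=> v /dr; exact: Ei.
- exact: E0.
- exact: Ed.
- move=> x y /ds xs /ds ys; have := Hs x y xs ys.
  rewrite -/(total_derivative E 0 (y - x)) -(derive_total oB (Es 1%N) _ z0).
  by have [_ ->] := Ed (y - x).
- by move=> v t /dr vr t2 /dr; exact: Eg.
Qed.

Variables (r : R) (E : 'rV[R]_n -> 'rV[R]_n).
Hypothesis nE : is_normal_chart g p r E.
Local Notation B := [set v : 'rV[R]_n | `|v| < r].

Let oB : open B. Proof. exact: open_centered_ball. Qed.
Let Es : smooth_on B E. Proof. exact: normal_smooth nE. Qed.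
Let r0 : 0 < r. Proof. exact: normal_radius nE. Qed.
Let B0 : B 0. Proof. by rewrite /= normr0. Qed.

Definition normal_metric : 'rV[R]_n -> 'M[R]_n := pullback_gram A E.
Local Notation H := normal_metric.

Lemma form_normal_metric w u v : B w -> form (H w) u v = form (A (E w)) ('D_u E w) ('D_v E w).
Proof. exact: form_pullback_gram oB Es _ _ _. Qed.

Lemma normal_metric_smooth : smooth_on B H.
Proof.
exact: (pullback_gram_smooth (chart_im_open M i0) oB (@gram_smooth _ _ _ g i0) Es (normal_im nE)).
Qed.

Lemma normal_metric_posdef w : B w -> posdef (H w).
Proof.
move=> Bw; have [As A0] := coord_gram_posdef g (normal_im nE Bw).
split; first by rewrite /normal_metric /pullback_gram !trmx_mul trmxK As mulmxA.
move=> u u0; rewrite form_normal_metric//; apply: A0.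
apply: contra_neq u0 => D0.
have := derive_near_identity oB Es (normal_expand nE) u Bw; rewrite D0 sub0r normrN => h.
by apply/eqP; rewrite -normr_le0; lra.
Qed.

Lemma normal_metric0 : H 0 = g p.
Proof.
apply: form_inj => u v; rewrite form_normal_metric// (normal_center nE).
by have [_ ->] := normal_derive0 nE u; have [_ ->] := normal_derive0 nE v; rewrite coord_gram_at.
Qed.

Theorem normal_gauss w u : B w -> form (H w) w u = form (g p) w u.
Proof.
move=> Bw; rewrite -normal_metric0; apply: (gauss_lemma r0 normal_metric_smooth) => //.
  by move=> x /normal_metric_posdef[].
move=> v t w' Bv t2 Btv.
apply: (euler_lagrange_radial (chart_im_open M i0) oB (@gram_smooth _ _ _ g i0)
  normal_metric_smooth Es (normal_im nE) _ form_normal_metric Btv).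
  by move=> y /(coord_gram_posdef g)[].
exact: normal_geodesic nE v t Bv t2 Btv _.
Qed.

End NormalChart.

(** * The exponential map in normal coordinates *)

Section ExpMap.
Context {R : realType} {n : nat} {M : smooth_manifold R n} (g : riemannian_metric M) (p : M).
Local Notation i0 := (chart_at M p).
Local Notation im i := (chart M i @` chart_dom M i).
Variables (r : R) (E : 'rV[R]_n -> 'rV[R]_n).
Hypothesis nE : is_normal_chart g p r E.
Local Notation B := [set v : 'rV[R]_n | `|v| < r].

Let oB : open B. Proof. exact: open_centered_ball. Qed.
Let Es : smooth_on B E. Proof. exact: normal_smooth nE. Qed.
Let Ei v : B v -> im i0 (E v). Proof. by move=> Bv; exact: (normal_im nE Bv). Qed.

Definition normal_exp (v : 'rV[R]_n) : M := chart_inv M i0 (E v).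
Local Notation F := normal_exp.

Lemma normal_exp_dom v : B v -> chart_dom M i0 (F v).
Proof. by move=> /Ei; exact: chart_inv_dom. Qed.

Lemma chart_normal_exp v : B v -> chart M i0 (F v) = E v.
Proof. by move=> /Ei; exact: chart_invK. Qed.

Lemma normal_exp0 : F 0 = p.
Proof. by rewrite /normal_exp (normal_center nE) chartK//; exact: chart_at_mem. Qed.

Lemma normal_exp_continuous v : B v -> {for v, continuous F}.
Proof.
move=> Bv; apply: (continuous_comp (f := E) (g := chart_inv M i0)).
  exact: (Ck_on_continuous (Es 0%N) Bv).
exact: chart_inv_continuous (Ei Bv).
Qed.

Lemma radial_domain (v : 'rV[R]_n) : B v -> exists2 e : R, 0 < e < 1 &
  forall t, t \in `]- e, 1 + e[ -> `|t| < 2 /\ B (t *: v).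
Proof.
rewrite /= => vr; have r0 := normal_radius nE.
(* With this choice [1 + e] times the norm of [v] is at most the midpoint between that norm and [r];
   moreover [e < 1] keeps times below 2. *)
pose e := (r - `|v|) / (2 * r).
have e0 : 0 < e by rewrite divr_gt0 ?subr_gt0// mulr_gt0.
have e1 : e < 1 by rewrite ltr_pdivrMr ?mulr_gt0//; have := normr_ge0 v; lra.
have er : e * r = (r - `|v|) / 2 by rewrite /e; field; rewrite gt_eqF.
exists e; first by rewrite e0.
move=> t; rewrite in_itv/= => /andP[t1 t2].
have te : `|t| < 1 + e by rewrite ltr_norml; apply/andP; split; lra.
split; first by lra.
rewrite normrZ; apply: (@le_lt_trans _ _ ((1 + e) * `|v|)); first by rewrite ler_wpM2r// ltW.
rewrite mulrDl mul1r; have : e * `|v| <= e * r by rewrite ler_wpM2l ?(ltW e0)// ltW.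
lra.
Qed.

Lemma radial_is_derive (f : 'rV[R]_n -> 'rV[R]_n) v (t : R) d :
  is_derive (t *: v) v f d -> is_derive t 1 (fun s : R => f (s *: v)) d.
Proof.
rewrite -[t *: v]add0r => /is_derive_line.
by under eq_fun do rewrite add0r.
Qed.

Lemma radial_geodesic v e : B v -> 0 < e < 1 ->
  (forall t, t \in `]- e, 1 + e[ -> `|t| < 2 /\ B (t *: v)) ->
  geodesic_on g `]- e, 1 + e[ (fun t : R => F (t *: v)).
Proof.
move=> Bv /andP[e0 e1] HJ.
have oJ : open (`]- e, 1 + e[%classic : set R^o) by exact: interval_open.
have Bt t : `]- e, 1 + e[%classic t -> B (t *: v) by move=> /HJ[].
have scal t : {for t, continuous (fun s : R => s *: v)}.
  by apply: cvgZl; exact: cvg_id.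
have chE t : `]- e, 1 + e[%classic t -> E (t *: v) = (chart M i0 \o (fun t : R => F (t *: v))) t.
  by move=> Jt; rewrite /= chart_normal_exp//; exact: Bt.
apply: (@geodesic_of_chart _ _ _ _ _ _ i0 (fun t => 'D_v E (t *: v)) (fun t => 'D_v ('D_v E) (t *: v)) oJ).
- by move=> t Jt; exact: normal_exp_dom (Bt _ Jt).
- move=> t Jt; apply: (continuous_comp (f := fun s : R => s *: v) (g := F)); first exact: scal.
  exact: normal_exp_continuous (Bt _ Jt).
- move=> k; apply: (Ck_on_eq oJ chE).
  apply: (Ck_on_comp oJ oB Bt _ (Es k)).
  by apply: Ck_onZ => //; [exact: Ck_on_id|exact: Ck_on_cst].
- move=> t Jt; apply: near_eq_is_derive (open_near oJ Jt chE) _.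
  by apply: radial_is_derive; exact: (Ck_is_derive v (Es 1%N) (Bt _ Jt)).
- by move=> t Jt; exact: (@radial_is_derive ('D_v E) v t _
    (Ck_is_derive v (Ck_on_derive v (Es 2%N)) (Bt _ Jt))).
- move=> t Jt w; rewrite chart_normal_exp; last exact: Bt.
  by have [t2 _] := HJ t Jt; exact: (normal_geodesic nE Bv t2 (Bt _ Jt)).
Qed.

Lemma radial_velocity0 v : B v -> derive1 (chart M i0 \o (fun t : R => F (t *: v))) 0 = v.
Proof.
move=> Bv; have [e e01 HJ] := radial_domain Bv.
have oJ : open (`]- e, 1 + e[%classic : set R^o) by exact: interval_open.
have J0 : `]- e, 1 + e[%classic (0 : R).
  by rewrite /= in_itv/=; move: e01 => /andP[e0 e1]; apply/andP; split; lra.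
rewrite derive1E.
have H : is_derive (0 : R) 1 (chart M i0 \o (fun t : R => F (t *: v))) v; last by have [_ ->] := H.
apply: (@near_eq_is_derive _ _ _ (fun t : R => E (t *: v))).
  apply: (open_near oJ J0) => t /HJ[_ Bt]; by rewrite /= chart_normal_exp.
by apply: radial_is_derive; rewrite scale0r; exact: (normal_derive0 nE).
Qed.

Lemma exp_rel_normal v : B v -> exp_rel g p v (F v).
Proof.
move=> Bv; have [e e01 HJ] := radial_domain Bv.
exists e, (fun t : R => F (t *: v)); split.
- by move: e01 => /andP[].
- exact: radial_geodesic.
- by rewrite scale0r normal_exp0.
- exact: radial_velocity0.
- by rewrite scale1r.
Qed.

(** [exp_map] selects the endpoint of some geodesic with initial velocity [v]. The radial one stays
    in the chart, so [geodesic_unique] identifies its endpoint with the selected one. *)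
Lemma exp_map_normal v : B v -> exp_map g p v = F v.
Proof.
move=> Bv; have H := xgetPex p (ex_intro _ _ (exp_rel_normal Bv)).
rewrite -/(exp_map g p v) in H.
have [e' [c [e'0 gc c0 v0 <-]]] := H.
have [e e01 HJ] := radial_domain Bv; have [e0 e1] := andP e01.
rewrite -[v in RHS]scale1r; apply/esym.
have in01 (s : R) : 0 < s -> forall t, 0 <= t <= 1 -> `]- s, 1 + s[%classic t.
  by move=> s0 t /andP[t0 t1]; rewrite /= in_itv/=; apply/andP; split; lra.
apply: (geodesic_unique (J1 := `]- e, 1 + e[%classic) (J2 := `]- e', 1 + e'[%classic)
  (i := i0) _ _ (radial_geodesic Bv e01 HJ) gc).
- exact: interval_open.
- exact: interval_open.
- move=> t t01; split; [exact: in01|exact: in01|].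
  by apply: normal_exp_dom; have [] := HJ t (in01 _ e0 _ t01).
- by rewrite scale0r normal_exp0.
- by rewrite radial_velocity0.
- by rewrite ler01 lexx.
Qed.

Definition normal_log (q : M) : 'rV[R]_n :=
  xget 0 [set x | B x /\ E x = chart M i0 q].
Local Notation L := normal_log.

Let Einv (y : 'rV[R]_n) : 'rV[R]_n := xget 0 [set x | B x /\ E x = y].

Let EinvK x : B x -> Einv (E x) = x.
Proof.
move=> Bx; have [By EyE] : B (Einv (E x)) /\ E (Einv (E x)) = E x.
  by apply: (xgetPex 0 (P := [set z | B z /\ E z = E x])); exists x.
have := near_identity_expand (normal_expand nE) Bx By; rewrite EyE subrr normr0 mulr0.
by rewrite normr_le0 subr_eq0 => /eqP.
Qed.

Lemma normal_expK v : B v -> L (F v) = v.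
Proof. by move=> Bv; rewrite /normal_log chart_normal_exp//; exact: EinvK. Qed.

Lemma Einv_smooth : smooth_on (E @` B) Einv.
Proof. exact: (inverse_smooth oB Es (normal_expand nE) EinvK). Qed.

Lemma open_normal_image (D : set 'rV[R]_n) : open D -> D `<=` B -> open (F @` D).
Proof.
move=> oD DB.
have oED : open (E @` D).
  apply: (near_identity_open oD) => x y Dx Dy; apply: (normal_expand nE); exact: DB.
have -> : F @` D = chart_dom M i0 `&` chart M i0 @^-1` (E @` D).
  apply/seteqP; split=> [_ [v Dv <-]|q [dq [v Dv Evq]]].
    split; first exact: normal_exp_dom (DB _ Dv).
    by rewrite /= chart_normal_exp; [exists v|exact: DB].
  by exists v => //; rewrite /normal_exp Evq chartK.
apply: open_setI_preimage => //; first exact: chart_dom_open.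
exact: chart_continuous.
Qed.

Lemma normal_log_smooth (D : set 'rV[R]_n) : open D -> D `<=` B ->
  smooth_from (F @` D) L.
Proof.
move=> oD DB j k.
have oFD := open_normal_image oD DB.
have oj : open (chart M j @` (F @` D `&` chart_dom M j)) by exact: open_chart_image.
have oEB : open (E @` B) by exact: (near_identity_open oB (normal_expand nE)).
apply: (@Ck_on_eq _ _ _ _ _ (Einv \o (chart M i0 \o chart_inv M j))) => //.
apply: (Ck_on_comp oj oEB (f := chart M i0 \o chart_inv M j)); last exact: Einv_smooth.
  move=> _ [q [[v Dv <-] dq] <-]; rewrite transition_chart// chart_normal_exp; last exact: DB.
  by exists v => //; exact: DB.
apply: Ck_on_sub (chart_transition_smooth M j i0 k) => _ [q [[v Dv <-] dq] <-].
by apply: overlap_mem => //; exact: normal_exp_dom (DB _ Dv).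
Qed.

Lemma normal_exp_smooth (D : set 'rV[R]_n) : open D -> D `<=` B -> smooth_to D F.
Proof.
move=> oD DB; split; first by move=> v /DB; exact: normal_exp_continuous.
move=> j k.
have cF v : D v -> {for v, continuous F} by move=> /DB; exact: normal_exp_continuous.
have oDj : open (D `&` F @^-1` chart_dom M j).
  by apply: open_setI_preimage => //; exact: chart_dom_open.
apply: (@Ck_on_comp _ _ _ _ _ _ _ E (chart M j \o chart_inv M i0) oDj (open_overlap M i0 j)).
- move=> v [Dv dj]; rewrite -chart_normal_exp; last exact: DB.
  by apply: overlap_mem => //; exact: normal_exp_dom (DB _ Dv).
- by apply: Ck_on_sub (Es k) => v [/DB].
- exact: chart_transition_smooth.
Qed.

End ExpMap.

(** * Lengths of curves and geodesic balls *)

Lemma clamp_interval_continuous (R : realType) (g : R -> R) (a b : R) : a <= b ->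
  (forall t, a <= t <= b -> {for t, continuous g}) ->
  continuous (fun t => g (Num.max a (Num.min t b))).
Proof.
move=> ab cg t.
apply: (continuous_comp (f := fun t => Num.max a (Num.min t b)) (g := g)).
  apply: continuous_max; first exact: cst_continuous.
  by apply: continuous_min; [exact: cvg_id|exact: cst_continuous].
by apply: cg; rewrite le_max lexx/= ge_max ab ge_min lexx orbT.
Qed.

(** [g] is first extended by constants beyond the segment, so that [W] has two-sided derivatives at
    the endpoints too, as the growth comparisons require. *)
Lemma integral_primitive (R : realType) (g : R -> R) (a b : R) : a < b ->
  (forall t, a <= t <= b -> {for t, continuous g}) ->
  exists2 W : R -> R, (forall t, a <= t <= b -> is_derive t 1 W (g t)) &
    (\int[lebesgue_measure]_(t in `[a, b]) (g t)%:E = (W b - W a)%:E)%E.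
Proof.
move=> ab cg.
have T0 : 0 < `|a| + `|b| + 1 by have := normr_ge0 a; have := normr_ge0 b; lra.
have [W _ dW] := ex_primitive T0 (clamp_interval_continuous (ltW ab) cg).
have dWg t : a <= t <= b -> is_derive t 1 W (g t).
  move=> /andP[at_ tb].
  have tT : `|t| < `|a| + `|b| + 1.
    rewrite ltr_norml; have := ler_norm b; have := ler_norm (- a); rewrite normrN.
    have := normr_ge0 a; have := normr_ge0 b; move=> ? ? ? ?; apply/andP; split; lra.
  by have := dW t tT; rewrite (min_idPl tb) (max_idPr at_).
exists W => //; rewrite EFinB; apply: continuous_FTC2 => //.
- by apply: continuous_in_subspaceT => t; rewrite inE/= in_itv/=; exact: cg.
- have cW t : a <= t <= b -> {for t, continuous W}.
    by move=> tab; exact: is_derive_continuous (dWg t tab).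
  split.
  + by move=> t; rewrite in_itv/= => /andP[at_ tb]; have [] := dWg t ltac:(by rewrite !ltW).
  + by apply: cvg_at_right_filter; apply: cW; rewrite lexx ltW.
  + by apply: cvg_at_left_filter; apply: cW; rewrite lexx ltW.
- move=> t; rewrite in_itv/= => /andP[at_ tb]; rewrite derive1E.
  by have [_ ->] := dWg t ltac:(by rewrite !ltW).
Qed.

(** At a breakpoint the velocity of a piecewise smooth curve has no meaning, so agreement with a
    continuous function is asked for in the interior only. Half-open intervals fit the concatenation
    of pieces. *)
Lemma integral_primitive_oc (R : realType) (f g : R -> R) (a b : R) : a < b ->
  (forall t, a <= t <= b -> {for t, continuous g}) ->
  (forall t, a < t < b -> f t = g t) ->
  exists W : R -> R, [/\ forall t, a <= t <= b -> is_derive t 1 W (g t),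
    measurable_fun `[a, b] f &
    (\int[lebesgue_measure]_(t in `]a, b]) (f t)%:E = (W b - W a)%:E)%E].
Proof.
move=> ab cg fg; have [W dW intW] := integral_primitive ab cg.
have mg : measurable_fun `]a, b[ g.
  apply: measurable_realfun.open_continuous_measurable_fun; first exact: interval_open.
  by move=> t; rewrite inE/= in_itv/= => /andP[? ?]; apply: cg; rewrite !ltW.
have fgE t : t \in `]a, b[%classic -> f t = g t by rewrite inE/= in_itv/=; exact: fg.
have mf : measurable_fun `]a, b[ f.
  by apply: eq_measurable_fun mg => t /fgE ->.
exists W; split; [exact: dW|exact: measurable_realfun.measurable_fun_itv_cc mf|].
rewrite -intW (@integral_itv_bndoo _ _ _ (fun t => (f t)%:E) false false); last exact/measurable_realfun.measurable_EFinP.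
rewrite (@integral_itv_bndoo _ _ _ (fun t => (g t)%:E) true false); last exact/measurable_realfun.measurable_EFinP.
by apply: eq_integral => t /fgE ->.
Qed.

Section Speed.
Context {R : realType} {n : nat} {M : smooth_manifold R n} (g : riemannian_metric M).

Definition speed (c : R -> M) (t : R) : R := gnorm g (c t) (velocity c t).

Lemma speed_ge0 c t : 0 <= speed c t. Proof. exact: sqrtr_ge0. Qed.

Lemma speed_chart (c : R^o -> M) i (t : R) dx :
  {for t, continuous c} -> chart_dom M i (c t) ->
  is_derive t 1 (chart M i \o c : R -> 'rV[R]_n) dx ->
  speed c t = Num.sqrt (form (coord_gram g i (chart M i (c t))) dx dx).
Proof.
move=> cc di dc; rewrite /speed /gnorm /inner -(pullback_form_chart g cc di dc dc).
by rewrite /pullback_form /diff_to /velocity derive1E.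
Qed.

Lemma near_eq_speed (c c' : R -> M) (t : R) :
  (\forall s \near t, c s = c' s) -> speed c t = speed c' t.
Proof.
move=> cc; have ct : c t = c' t := nbhs_singleton cc.
rewrite /speed /velocity -ct; congr (gnorm g _ _); rewrite !derive1E.
by apply: near_eq_derive; apply: filterS cc => s /= ->.
Qed.

(** [velocity] is read in a chart depending on the time; in the single chart at [c t] the speed
    becomes the root of a continuous function. *)
Lemma speed_continuous (O : set R^o) (c : R^o -> M) (t : R) :
  open O -> smooth_to O c -> O t -> {for t, continuous (speed c : R -> R)}.
Proof.
move=> oO [cc cs] Ot; set i := chart_at M (c t).
pose O' := O `&` c @^-1` chart_dom M i.
have oO' : open O' by apply: open_setI_preimage => //; exact: chart_dom_open.
have O't : O' t by split=> //; exact: chart_at_mem.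
have xs := cs i.
have G0 : Ck_on 0 O' (coord_gram g i \o (chart M i \o c)).
  apply: (Ck_on_comp oO' (chart_im_open M i)); [|exact: xs|exact: gram_smooth].
  by move=> s [_ ds]; exists (c s).
have C0 := Ck_on_continuous (Ck_on_form oO' G0 (Ck_on_derive (1 : R^o) (xs 1%N)) (Ck_on_derive (1 : R^o) (xs 1%N))) O't.
have : {for t, continuous (Num.sqrt \o (fun s : R^o => form (coord_gram g i (chart M i (c s)))
   ('D_1 (chart M i \o c) s) ('D_1 (chart M i \o c) s)))}.
  by apply: continuous_comp; [exact: C0|exact: sqrt_continuous].
apply: continuous_near_eq; apply: (open_near oO' O't) => s [Os ds] /=.
by apply/esym/speed_chart => //; [exact: cc|exact: (Ck_is_derive (1 : R^o) (xs 1%N))].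
Qed.

Lemma speed_primitive (O : set R^o) (c c' : R -> M) (a b : R) : a < b ->
  open O -> `[a, b] `<=` O -> smooth_to O (c' : R^o -> M) ->
  (forall s, s \in `[a, b] -> c s = c' s) ->
  exists W : R -> R, [/\ forall t, a <= t <= b -> is_derive t 1 W (speed c' t),
    measurable_fun `[a, b] (speed c) &
    (\int[lebesgue_measure]_(t in `]a, b]) (speed c t)%:E = (W b - W a)%:E)%E].
Proof.
move=> ab oO abO cs cc'.
have cg t : a <= t <= b -> {for t, continuous (speed c' : R -> R)}.
  by move=> tab; apply: (speed_continuous oO cs); apply: abO; rewrite /= in_itv.
have ooab : open (`]a, b[%classic : set R) by exact: interval_open.
apply: (integral_primitive_oc ab cg) => t abt.
have abt' : `]a, b[%classic t by rewrite /= in_itv.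
apply: near_eq_speed; apply: (open_near ooab abt') => s /= abs; apply: cc'.
by move: abs; rewrite !in_itv/= => /andP[? ?]; rewrite !ltW.
Qed.

End Speed.

Lemma sqrtr_le (R : realType) (x y : R) : 0 <= y -> x <= y ^+ 2 -> Num.sqrt x <= y.
Proof.
by move=> y0 xy; rewrite -[leRHS](ger0_norm y0) -sqrtr_sqr ler_sqrt// sqr_ge0.
Qed.

Section TangentNorm.
Context {R : realType} {n : nat} {M : smooth_manifold R n} (g : riemannian_metric M) (p : M).

Lemma gram_posdef : posdef (g p).
Proof. by split; [exact: gram_sym|exact: gram_pos]. Qed.

Lemma gnorm_ge0 v : 0 <= gnorm g p v. Proof. exact: sqrtr_ge0. Qed.

Lemma gnorm_sqr v : gnorm g p v ^+ 2 = form (g p) v v.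
Proof. by rewrite sqr_sqrtr//; apply: posdef_ge0; exact: gram_posdef. Qed.

Lemma gnormZ (t : R) v : gnorm g p (t *: v) = `|t| * gnorm g p v.
Proof.
rewrite /gnorm /inner formZl formZr mulrA -expr2 sqrtrM ?sqr_ge0//.
by rewrite sqrtr_sqr.
Qed.

Lemma gnorm0 : gnorm g p 0 = 0.
Proof. by rewrite /gnorm /inner form0l sqrtr0. Qed.

Lemma gnorm_eq0 v : gnorm g p v = 0 -> v = 0.
Proof.
move=> v0; apply/eqP/negPn/negP => vn0; have [_ P] := gram_posdef.
by have := P v vn0; rewrite -gnorm_sqr v0 expr0n ltxx.
Qed.

Lemma gnorm_continuous : continuous (gnorm g p : 'rV[R]_n -> R^o).
Proof.
move=> v; apply: (@continuous_comp _ _ _ (fun v : 'rV[R]_n => form (g p) v v : R) Num.sqrt); last exact: sqrt_continuous.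
have id0 : Ck_on 0 setT (fun v : 'rV[R]_n => v) by exact: (Ck_on_id 0 openT).
have H := Ck_on_form openT (Ck_on_cst 0 setT (g p)) id0 id0.
exact: (Ck_on_continuous H I).
Qed.

Lemma open_tangent_ball d : open (tangent_ball g p d).
Proof.
apply: (@open_comp _ _ (gnorm g p : 'rV[R]_n -> R) [set x : R | x < d]); last exact: open_lt.
by move=> v _; exact: gnorm_continuous.
Qed.

Lemma closed_gnorm_le m : closed [set v : 'rV[R]_n | gnorm g p v <= m].
Proof.
apply: (@preimage_closed _ _ (gnorm g p : 'rV[R]_n -> R) [set x : R | x <= m]); last exact: closed_le.
by move=> v _; exact: gnorm_continuous.
Qed.

Lemma tangent_ball_sub (r : R) : 0 < r ->
  exists2 d, 0 < d & tangent_ball g p d `<=` [set v | `|v| < r].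
Proof.
move=> r0; have [c c0 Hc] := posdef_lower gram_posdef.
exists (Num.sqrt c * r); first by rewrite mulr_gt0// sqrtr_gt0.
move=> v /= vd.
have c1 : 0 <= Num.sqrt c * r by rewrite mulr_ge0// ?sqrtr_ge0// ltW.
have : gnorm g p v ^+ 2 < (Num.sqrt c * r) ^+ 2 by rewrite ltr_pXn2r// nnegrE gnorm_ge0.
rewrite gnorm_sqr exprMn sqr_sqrtr ?(ltW c0)// => h.
have : c * `|v| ^+ 2 < c * r ^+ 2 by apply: le_lt_trans (Hc v) h.
by rewrite ltr_pM2l// ltr_pXn2r// nnegrE// ltW.
Qed.

End TangentNorm.

Section NormalDistance.
Context {R : realType} {n : nat} {M : smooth_manifold R n} (g : riemannian_metric M) (p : M).
Local Notation i0 := (chart_at M p).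
Variables (r : R) (E : 'rV[R]_n -> 'rV[R]_n).
Hypothesis nE : is_normal_chart g p r E.
Local Notation B := [set v : 'rV[R]_n | `|v| < r].
Local Notation F := (normal_exp p E).
Local Notation L := (normal_log p r E).
Local Notation H := (normal_metric g p E).
Local Notation nrm := (gnorm g p).

Let oB : open B. Proof. exact: open_centered_ball. Qed.
Let Es : smooth_on B E. Proof. exact: normal_smooth nE. Qed.

Lemma normal_logK q : (F @` B) q -> B (L q) /\ F (L q) = q.
Proof. by move=> [v Bv <-]; rewrite (normal_expK nE). Qed.

Lemma normal_log_curve (O : set R^o) (c : R^o -> M) (t : R) :
  open O -> smooth_to O c -> O t -> (F @` B) (c t) ->
  exists2 dy, is_derive t 1 (L \o c : R -> 'rV[R]_n) dy &
    speed g c t = Num.sqrt (form (H (L (c t))) dy dy).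
Proof.
move=> oO [cc cs] Ot Ft.
have oFB := open_normal_image nE oB (@subset_refl _ B).
have [Bt FLt] := normal_logK Ft.
have d0 : chart_dom M i0 (c t) by rewrite -FLt; exact: (normal_exp_dom nE Bt).
have cct := cc t Ot.
have oO' : open (O `&` c @^-1` chart_dom M i0).
  by apply: open_setI_preimage => //; exact: chart_dom_open.
have dx := Ck_is_derive (1 : R^o) (cs i0 1%N) (conj Ot d0).
have oj : open (chart M i0 @` (F @` B `&` chart_dom M i0)) by exact: open_chart_image.
have mt : (chart M i0 @` (F @` B `&` chart_dom M i0)) (chart M i0 (c t)) by exists (c t).
have dy := is_derive_compD oj (normal_log_smooth nE oB (@subset_refl _ B) i0 1%N) dx mt.
set y' := ('D_ _ _ _) in dy.
have dLc : is_derive t 1 (L \o c : R -> 'rV[R]_n) y'.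
  apply: near_eq_is_derive dy; apply: (open_near oO' (conj Ot d0)) => s [_ ds].
  by rewrite /= chartK.
clear dy; clearbody y'; exists y'; first exact: dLc.
have dEL := is_derive_compD oB (Es 1%N) dLc Bt.
have oO'' : open (O `&` c @^-1` (F @` B)) by exact: open_setI_preimage.
have dx' : is_derive t 1 (chart M i0 \o c : R -> 'rV[R]_n) ('D_y' E (L (c t))).
  apply: near_eq_is_derive dEL; apply: (open_near oO'' (conj Ot Ft)) => s [_ Fs].
  by have [Bs FLs] := normal_logK Fs; rewrite /= -{2}FLs (chart_normal_exp nE).
rewrite (speed_chart g cct d0 dx') (form_normal_metric nE y' y' Bt).
have -> : chart M i0 (c t) = E (L (c t)) by rewrite -{1}FLt (chart_normal_exp nE Bt).
by [].
Qed.

(* The Gauss lemma and Cauchy-Schwarz give [|rho'| <= speed] for the radial distance [rho]; replacing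
   [rho] by [sqrt (rho ^+ 2 + e ^+ 2)] makes it differentiable at the center. *)
Lemma radial_rate (O : set R^o) (c : R^o -> M) (t e : R) :
  open O -> smooth_to O c -> O t -> (F @` B) (c t) -> 0 < e ->
  exists2 D : R, is_derive t 1 (fun s => Num.sqrt (form (g p) (L (c s)) (L (c s)) + e ^+ 2) : R) D &
    `|D| <= speed g c t.
Proof.
move=> oO cs Ot Ft e0; have [Bt FLt] := normal_logK Ft.
have [y' dy sp] := normal_log_curve oO cs Ot Ft.
set y := L (c t) in Bt FLt sp.
have pH := normal_metric_posdef nE Bt.
have N0 : 0 <= form (g p) y y by apply: posdef_ge0; exact: gram_posdef.
have rho0 : 0 < form (g p) y y + e ^+ 2 by rewrite ltr_wpDl// exprn_gt0.
have dN : is_derive t 1 (fun s : R => form (g p) (L (c s)) (L (c s)) + e ^+ 2 : R^o)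
    (2 * form (g p) y y').
  have D1 := is_derive_form (is_derive_cst (g p) t 1) dy dy.
  have D2 := is_deriveD D1 (is_derive_cst (e ^+ 2 : R^o) t 1).
  rewrite (_ : 2 * _ = form 0 y y + form (g p) y' y + form (g p) y y' + 0); first exact: D2.
  rewrite form0m (form_sym y' y (gram_sym g p)); ring.
exists ((2 * form (g p) y y') *: (2 * Num.sqrt (form (g p) y y + e ^+ 2))^-1).
  exact: (is_derive_comp1 (f := Num.sqrt) dN (is_derive1_sqrt rho0)).
set rho := Num.sqrt (form (g p) y y + e ^+ 2).
have rp : 0 < rho by rewrite sqrtr_gt0.
rewrite /GRing.scale/= invfM mulrACA mulfV ?mul1r ?pnatr_eq0// normrM normfV (gtr0_norm rp).
rewrite ler_pdivrMr// -sqrtr_sqr; apply: sqrtr_le.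
  by rewrite mulr_ge0 ?speed_ge0// ltW.
(* The Gauss lemma acts twice: here it moves the product of [y] and [y'] from [g p] to the metric at
   [y], and after Cauchy-Schwarz it moves the square of [y] back. *)
rewrite -(normal_gauss nE y' Bt) sp exprMn !sqr_sqrtr ?(ltW rho0) ?posdef_ge0//.
apply: (le_trans (form_cauchy_schwarz _ _ pH)); rewrite (normal_gauss nE y Bt) mulrC.
by rewrite ler_wpM2l ?posdef_ge0// lerDl sqr_ge0.
Qed.

(** The regularized distance exceeds the radial one by at most [e], so its growth bound passes to
    the limit. *)
Lemma radial_growth (O : set R^o) (c : R^o -> M) (W : R -> R) (a b : R) :
  open O -> smooth_to O c -> a <= b ->
  (forall t, a <= t <= b -> O t /\ (F @` B) (c t)) ->
  (forall t, a <= t <= b -> is_derive t 1 W (speed g c t)) ->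
  nrm (L (c b)) <= nrm (L (c a)) + (W b - W a).
Proof.
move=> oO cs ab HO dW; apply/ler_addgt0Pr => e e0.
pose u s : R := Num.sqrt (form (g p) (L (c s)) (L (c s)) + e ^+ 2).
have du t : a <= t <= b -> is_derive t 1 u ('D_1 u t) /\ `|'D_1 u t| <= speed g c t.
  move=> tab; have [Ot Ft] := HO t tab.
  have [D dD Dle] := radial_rate oO cs Ot Ft e0.
  by rewrite -/u in dD; have [_ DE] := dD; rewrite DE.
have G : `|u b - u a| <= W b - W a.
  apply: (@mean_value_growth _ R^o u (fun t => 'D_1 u t) W (speed g c)) => //.
    by move=> t /du[].
  by move=> t /du[].
have ub : nrm (L (c b)) <= u b by rewrite /u /gnorm /inner ler_wsqrtr// lerDl sqr_ge0.
have ua : u a <= nrm (L (c a)) + e.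
  have na : 0 <= nrm (L (c a)) by exact: gnorm_ge0.
  apply: sqrtr_le; first by rewrite addr_ge0// ltW.
  rewrite -gnorm_sqr sqrrD lerD2r lerDl mulrn_wge0// mulr_ge0// ltW//.
have := ler_norm (u b - u a); lra.
Qed.

Variable d : R.
Hypothesis dB : tangent_ball g p d `<=` B.

(** A compact set in a Hausdorff space. Its complement is open, so a curve outside of it at some
    time is already outside slightly earlier. *)
Lemma closed_normal_image (m : R) : m < d -> closed (F @` [set v | nrm v <= m]).
Proof.
move=> md; have mB v : nrm v <= m -> B v by move=> vm; apply: dB; exact: le_lt_trans vm md.
apply: compact_closed; first exact: manifold_hausdorff.
apply: continuous_compact.
  apply: continuous_in_subspaceT => v; rewrite inE => /= vm.
  exact: (normal_exp_continuous nE (mB _ vm)).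
apply: bounded_closed_compact; last exact: closed_gnorm_le.
exists r; split; first exact: num_real.
by move=> x rx v /= /mB vr; apply: ltW; exact: lt_trans vr rx.
Qed.

(* A first exit point is excluded because until then the curve stays in the closed image of a
   ball of radius less than [d]. *)
Lemma short_curve_reach (O : set R^o) (c : R^o -> M) (W : R -> R) (a b S : R) v :
  open O -> smooth_to O c -> a <= b -> `[a, b] `<=` O ->
  (forall t, a <= t <= b -> is_derive t 1 W (speed g c t)) ->
  c a = F v -> nrm v <= S -> S + (W b - W a) < d ->
  exists2 v', nrm v' <= S + (W b - W a) & c b = F v'.
Proof.
move=> oO cs ab abO dW ca vS md; set m := S + (W b - W a) in md *.
have Wle s : a <= s <= b -> W s <= W b.
  move=> /andP[as_ sb]; rewrite -subr_ge0.
  have G : `|(cst 0 : R -> R^o) b - (cst 0 : R -> R^o) s| <= W b - W s.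
    apply: (@mean_value_growth _ R^o (cst 0) (cst 0) W (speed g c)) => // t /andP[st tb].
      by apply: dW; rewrite tb (le_trans as_ st).
    by rewrite normr0; exact: speed_ge0.
  exact: le_trans (normr_ge0 _) G.
have Wab : W a <= W b by apply: Wle; rewrite lexx.
have oFT : open (F @` tangent_ball g p d).
  by apply: (open_normal_image nE) => //; exact: open_tangent_ball.
have Bv : B v by apply: dB; rewrite /tangent_ball/=; apply: le_lt_trans md; rewrite /m; lra.
have Oab t : a <= t <= b -> O t by move=> tab; apply: abO; rewrite /= in_itv.
have TF q : (F @` tangent_ball g p d) q -> (F @` B) q by move=> [w /dB Bw <-]; exists w.
have grow t : a <= t <= b -> (forall s, a <= s <= t -> (F @` tangent_ball g p d) (c s)) ->
    nrm (L (c t)) <= m /\ F (L (c t)) = c t.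
  move=> /andP[at_ tb] Hs.
  have [_ FLt] := normal_logK (TF _ (Hs t ltac:(by rewrite at_ lexx))).
  split=> //; apply: (@le_trans _ _ (nrm (L (c a)) + (W t - W a))).
    apply: (radial_growth oO cs at_) => s /andP[as_ st].
      split; first by apply: Oab; rewrite as_ (le_trans st tb).
      by apply/TF/Hs; rewrite as_.
    by apply: dW; rewrite as_ (le_trans st tb).
  rewrite ca (normal_expK nE Bv); have := Wle t ltac:(by rewrite at_); rewrite /m; lra.
have P t : a <= t <= b -> (F @` tangent_ball g p d) (c t).
  apply: (@real_induction R a b (fun t => (F @` tangent_ball g p d) (c t))).
  - by rewrite ca; exists v => //; rewrite /tangent_ball/=; apply: le_lt_trans md; rewrite /m; lra.
  - move=> {}t /andP[at_ tb] /(_ t); rewrite at_ lexx => /(_ isT) Ft.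
    have oo : open (O `&` c @^-1` (F @` tangent_ball g p d)).
      by apply: open_setI_preimage => //; case: cs.
    have Ot : O t by apply: Oab; rewrite at_ ltW.
    have [e e0 He] := open_ball_ex oo (conj Ot Ft : (O `&` c @^-1` (F @` tangent_ball g p d)) t).
    exists e => // s /andP[ts ste] _; apply: (He s _).2.
    by rewrite ltr_norml; apply/andP; split; lra.
  - move=> {}t /andP[at_ tb] Hs.
    have Ot : O t by apply: Oab; rewrite tb ltW.
    suff [w wm <-] : (F @` [set v | nrm v <= m]) (c t).
      by exists w => //; exact: le_lt_trans wm md.
    apply: contrapT => nK.
    have oo : open (O `&` c @^-1` (~` (F @` [set v | nrm v <= m]))).
      apply: open_setI_preimage => //; last by case: cs.
      by apply: closed_openC; exact: closed_normal_image.
    have [e e0 He] := open_ball_ex oo (conj Ot nK : (O `&` c @^-1` (~` (F @` [set v | nrm v <= m]))) t).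
    (* An earlier time at which the curve is still off the closed image, whereas [grow] places it
       inside. *)
    pose s := Num.max a (t - e / 2).
    have as_ : a <= s by rewrite le_max lexx.
    have st : s < t by rewrite gt_max at_/=; lra.
    have se : t - e / 2 <= s by rewrite le_max lexx orbT.
    have [] := He s; first by rewrite ltr_norml; apply/andP; split; lra.
    move=> _; apply; have [] := grow s; first by rewrite as_ (le_trans (ltW st) tb).
      move=> s' /andP[as' ss']; apply: Hs; rewrite as'/=; exact: le_lt_trans ss' st.
    by move=> sm FLs; exists (L (c s)).
exists (L (c b)); have [] := grow b; rewrite ?ab ?lexx//.
Qed.

End NormalDistance.

Lemma integral_itv_split (R : realType) (f : R -> R) (a b c S T : R) : a <= b < c ->
  (forall t, 0 <= f t) -> measurable_fun `[a, b] f -> measurable_fun `[b, c] f ->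
  (\int[lebesgue_measure]_(t in `[a, b]) (f t)%:E = S%:E)%E ->
  (\int[lebesgue_measure]_(t in `]b, c]) (f t)%:E = T%:E)%E ->
  measurable_fun `[a, c] f /\ (\int[lebesgue_measure]_(t in `[a, c]) (f t)%:E = (S + T)%:E)%E.
Proof.
move=> /andP[ab bc] f0 mab mbc iS iT.
have acE : `[a, c]%classic = `[a, b] `|` `]b, c].
  by rewrite -itv_bndbnd_setU// bnd_simp// ltW.
have mbc' : measurable_fun `]b, c] f.
  by apply: measurable_funS mbc => //; apply: subset_itvr; rewrite bnd_simp.
have mac : measurable_fun `[a, c] f.
  by rewrite acE; apply/measurable_funU.
split=> //; rewrite acE ge0_integral_setU//=.
- by rewrite iS iT EFinD.
- by apply/measurable_realfun.measurable_EFinP; rewrite -acE.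
- by move=> t _; rewrite lee_fin.
- apply/disj_set2P/seteqP; split=> // t [] /=; rewrite !in_itv/= => /andP[_ tb] /andP[bt _].
  by move: (lt_le_trans bt tb); rewrite ltxx.
Qed.

Section GeodesicBall.
Context {R : realType} {n : nat} {M : smooth_manifold R n} (g : riemannian_metric M) (p : M).
Local Notation i0 := (chart_at M p).
Variables (r : R) (E : 'rV[R]_n -> 'rV[R]_n).
Hypothesis nE : is_normal_chart g p r E.
Local Notation B := [set v : 'rV[R]_n | `|v| < r].
Local Notation F := (normal_exp p E).
Local Notation nrm := (gnorm g p).
Let oB : open B. Proof. exact: open_centered_ball. Qed.
Let Es : smooth_on B E. Proof. exact: normal_smooth nE. Qed.

(** The induction carries the length [S] of the part already run. Reaching is claimed only under
    [S < d], as the whole curve may be long, and measurability is carried for the additivity of the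
    integral. *)
Lemma piecewise_reach (d : R) (c : R -> M) (N : nat) (t : nat -> R) :
  tangent_ball g p d `<=` B -> c 0 = p -> t 0%N = 0 ->
  (forall k, (k < N)%N -> t k < t k.+1) ->
  (forall k, (k < N)%N -> exists (O : set R^o) (c' : R^o -> M),
        [/\ open O, `[t k, t k.+1] `<=` O, smooth_to O c' &
            forall s, s \in `[t k, t k.+1] -> c s = c' s]) ->
  forall k, (k <= N)%N -> 0 <= t k /\ measurable_fun `[0, t k] (speed g c) /\
    exists2 S : R, (\int[lebesgue_measure]_(s in `[0%R, t k]) (speed g c s)%:E = S%:E)%E &
      S < d -> exists2 v, nrm v <= S & c (t k) = F v.
Proof.
move=> dB c0 t0 tS tP; elim=> [|k IH] kN.
  rewrite t0 set_itv1; split=> //; split; first exact: measurable_fun_set1.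
  exists 0; first by rewrite integral_set1.
  by move=> _; exists 0; rewrite ?gnorm0// (normal_exp0 nE) c0.
have [tk0 [mk [S iS HS]]] := IH (ltnW kN).
have tkS := tS k kN.
have [D [c' [oO tO cs' cc']]] := tP k kN.
have [W [dW mW iW]] := speed_primitive g tkS oO tO cs' cc'.
have tkk : 0 <= t k < t k.+1 by rewrite tk0.
have [mS iSS] := integral_itv_split tkk (speed_ge0 g c) mk mW iS iW.
split; first exact: ltW (le_lt_trans tk0 tkS).
split=> //; exists (S + (W (t k.+1) - W (t k))) => // Sd.
have W0 : 0 <= W (t k.+1) - W (t k).
  rewrite -lee_fin -iW; apply: integral_ge0 => s _; rewrite lee_fin; exact: speed_ge0.
have [|v vS ck] := HS; first lra.
rewrite (cc' (t k.+1)); last by rewrite in_itv/= lexx ltW.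
apply: (short_curve_reach nE dB oO cs' (ltW tkS) tO dW _ vS Sd).
by rewrite -cc' ?ck// in_itv/= lexx ltW.
Qed.

Lemma riemannian_dist_reach (d : R) q : tangent_ball g p d `<=` B ->
  geodesic_ball g p d q -> exists2 v, nrm v < d & q = F v.
Proof.
move=> dB /ereal_inf_lt[_ [c [[N [t [t0 t1 tS tP]]] c0 c1] <-]] Ld.
have [_ [_ [S iS HS]]] := piecewise_reach dB c0 t0 tS tP (leqnn N).
rewrite t1 in iS HS; move: Ld; rewrite /curve_length -/(speed g c).
under eq_integral do rewrite -/(speed g c _).
rewrite iS lte_fin => Sd; have [v vS cv] := HS Sd.
by exists v; [exact: le_lt_trans vS Sd|rewrite -c1].
Qed.

Lemma radial_smooth v e : B v -> 0 < e < 1 ->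
  (forall t, t \in `]- e, 1 + e[ -> `|t| < 2 /\ B (t *: v)) ->
  smooth_to (`]- e, 1 + e[%classic : set R^o) (fun t : R^o => F (t *: v)).
Proof. by move=> Bv e01 HJ; have [] := radial_geodesic nE Bv e01 HJ. Qed.

Lemma radial_speed v (t : R) : B (t *: v) -> speed g (fun s => F (s *: v)) t = nrm v.
Proof.
move=> Bt.
have cF : {for t, continuous (fun s : R^o => F (s *: v))}.
  apply: (continuous_comp (f := fun s : R^o => s *: v) (g := F)); last exact: normal_exp_continuous nE _ Bt.
  by apply: cvgZl; exact: cvg_id.
have oO : open ((fun s : R^o => s *: v) @^-1` B).
  by apply: open_comp => // s _; apply: cvgZl; exact: cvg_id.
have dx : is_derive t 1 (chart M i0 \o (fun s : R^o => F (s *: v)) : R -> 'rV[R]_n) ('D_v E (t *: v)).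
  apply: near_eq_is_derive (radial_is_derive (Ck_is_derive v (Es 1%N) Bt)).
  by apply: (open_near oO Bt) => s Bs; rewrite /= (chart_normal_exp nE).
rewrite (speed_chart g cF (normal_exp_dom nE Bt) dx) (chart_normal_exp nE Bt).
rewrite -(form_normal_metric nE v v Bt) /gnorm /inner; congr Num.sqrt.
(* The Gauss lemma at [t *: v] carries a factor [t], which is cancelled when nonzero; at the center
   the metric is [g p] itself. *)
have [t0|tn0] := eqVneq t 0; first by rewrite t0 scale0r (normal_metric0 nE).
by apply: (mulfI tn0); have := normal_gauss nE v Bt; rewrite !formZl.
Qed.

Lemma riemannian_dist_le v : B v -> (riemannian_dist g p (F v) <= (nrm v)%:E)%E.
Proof.
move=> Bv; have [e e01 HJ] := radial_domain nE Bv; have [e0 e1] := andP e01.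
apply: ereal_inf_lbound; exists (fun t => F (t *: v)).
  split; last 1 first.
  - by rewrite scale1r.
  - exists 1%N, (fun k => k%:R); split=> //; first by move=> k; rewrite ltr_nat.
    move=> [|//] _; exists `]- e, 1 + e[%classic, (fun t : R^o => F (t *: v)); split=> //.
    + by move=> t; rewrite /= !in_itv/= => /andP[t0 t1]; apply/andP; split; lra.
    + exact: radial_smooth.
  - by rewrite scale0r (normal_exp0 nE).
rewrite /curve_length (_ : (nrm v)%:E = ((nrm v)%:E * lebesgue_measure (`[0%R, 1%R]%classic : set R))%E).
  rewrite -integral_cst//; apply: eq_integral => t; rewrite inE/= in_itv/= => /andP[t0 t1].
  congr EFin; apply: radial_speed; apply: (HJ t _).2.
  by rewrite in_itv/=; apply/andP; split; lra.
by rewrite lebesgue_measure_itv/= lte_fin ltr01 sube0 mule1.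
Qed.

Lemma geodesic_ballE d : tangent_ball g p d `<=` B ->
  geodesic_ball g p d = F @` tangent_ball g p d.
Proof.
move=> dB; apply/seteqP; split=> [q /(riemannian_dist_reach dB)[v vd ->]|_ [v vd <-]].
  by exists v.
by rewrite /geodesic_ball/=; apply: (le_lt_trans (riemannian_dist_le (dB _ vd))); rewrite lte_fin.
Qed.

End GeodesicBall.

(** * Polar coordinates *)

Lemma Ck_on_sqrt (R : realType) (V : normedModType R) k (U : set V) (f : V -> R^o) :
  open U -> (forall x, U x -> 0 < f x) -> Ck_on k U f ->
  Ck_on k U (fun x => Num.sqrt (f x) : R^o).
Proof.
move=> oU f0; elim: k => [|k IH] fk.
  split=> // x Ux; apply: (continuous_comp (f := f) (g := Num.sqrt)); last exact: sqrt_continuous.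
  exact: Ck_on_continuous fk Ux.
have sk := IH (Ck_onW fk).
have s0 x : U x -> 2 * Num.sqrt (f x) != 0.
  by move=> /f0 fx; rewrite mulf_neq0 ?pnatr_eq0// gt_eqF// sqrtr_gt0.
apply: (@Ck_onS _ _ _ _ _ _ (fun v x => 'D_v f x *: (2 * Num.sqrt (f x))^-1 : R^o)) => //.
- by move=> x Ux; exact: (Ck_on_continuous sk Ux).
- move=> x v Ux; exact: (is_derive_comp1 (f := Num.sqrt) (Ck_is_derive v fk Ux) (is_derive1_sqrt (f0 x Ux))).
- move=> v; apply: Ck_onM => //; first exact: Ck_on_derive.
  by apply: Ck_onV => //; apply: Ck_onM => //; exact: Ck_on_cst.
Qed.

Section ProductMaps.
Context {R : realType} (V W1 W2 : normedModType R).

Lemma Ck_on_fst k (U : set (W1 * W2)) : open U -> Ck_on k U (fst : W1 * W2 -> W1).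
Proof.
move=> oU; apply: (@Ck_on_lin_comp _ _ _ _ (fst : W1 * W2 -> W1) k U id) => //.
  by move=> z; exact: cvg_fst.
exact: Ck_on_id.
Qed.

Lemma Ck_on_snd k (U : set (W1 * W2)) : open U -> Ck_on k U (snd : W1 * W2 -> W2).
Proof.
move=> oU; apply: (@Ck_on_lin_comp _ _ _ _ (snd : W1 * W2 -> W2) k U id) => //.
  by move=> z; exact: cvg_snd.
exact: Ck_on_id.
Qed.

Lemma Ck_on_pair k (U : set V) (f : V -> W1) (h : V -> W2) : open U ->
  Ck_on k U f -> Ck_on k U h -> Ck_on k U (fun x => (f x, h x) : W1 * W2).
Proof.
move=> oU fk hk.
have l1 : linear (fun w : W1 => (w, 0) : W1 * W2).
  by move=> a u v; rewrite /GRing.scale/= /GRing.add/= /scale_pair/add_pair/= scaler0 addr0.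
have l2 : linear (fun w : W2 => (0, w) : W1 * W2).
  by move=> a u v; rewrite /GRing.scale/= /GRing.add/= /scale_pair/add_pair/= scaler0 addr0.
have c1 : continuous (fun w : W1 => (w, 0) : W1 * W2).
  by move=> w; apply: cvg_pair; [exact: cvg_id|exact: cvg_cst].
have c2 : continuous (fun w : W2 => (0, w) : W1 * W2).
  by move=> w; apply: cvg_pair; [exact: cvg_cst|exact: cvg_id].
apply: (Ck_on_eq oU _ (Ck_onD oU (Ck_on_lin_comp oU l1 c1 fk) (Ck_on_lin_comp oU l2 c2 hk))).
by move=> x _; rewrite /GRing.add/= /add_pair/= addr0 add0r.
Qed.

End ProductMaps.

Section SmoothTo.
Context {R : realType} {n : nat} {M : smooth_manifold R n} {V : normedModType R}.

Lemma smooth_to_eq (U : set V) (F F' : V -> M) : open U -> (forall x, U x -> F x = F' x) ->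
  smooth_to U F -> smooth_to U F'.
Proof.
move=> oU FF [cF sF]; split=> [x Ux|i k].
  rewrite /prop_for /continuous_at -(FF x Ux); apply: cvg_trans (cF x Ux); apply: near_eq_cvg.
  by apply: (open_near oU Ux) => y /FF ->.
have -> : U `&` F' @^-1` chart_dom M i = U `&` F @^-1` chart_dom M i.
  by apply/seteqP; split=> x [Ux dx]; split=> //; move: dx; rewrite /= FF.
apply: Ck_on_eq (sF i k); last by move=> x [Ux _]; rewrite /= FF.
by apply: open_setI_preimage => //; exact: chart_dom_open.
Qed.

Lemma smooth_to_comp m (U : set V) (O : set 'rV[R]_m) (f : V -> 'rV[R]_m) (F : 'rV[R]_m -> M) :
  open U -> open O -> (forall x, U x -> O (f x)) -> smooth_on U f -> smooth_to O F ->
  smooth_to U (F \o f).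
Proof.
move=> oU oO UO fs [cF sF].
have cf x : U x -> {for x, continuous f} by move=> Ux; exact: (Ck_on_continuous (fs 0%N) Ux).
have cFf x : U x -> {for x, continuous (F \o f)}.
  by move=> Ux; apply: continuous_comp; [exact: cf|exact/cF/UO].
split=> // i k.
have oUi : open (U `&` (F \o f) @^-1` chart_dom M i).
  by apply: open_setI_preimage => //; exact: chart_dom_open.
have oOi : open (O `&` F @^-1` chart_dom M i).
  by apply: open_setI_preimage => //; exact: chart_dom_open.
apply: (@Ck_on_comp _ _ _ _ _ _ _ f (chart M i \o F) oUi oOi); last exact: sF.
  by move=> x [Ux dx]; split=> //; exact: UO.
by apply: Ck_on_sub (fs k) => x [].
Qed.

End SmoothTo.

Lemma form_norm_le (R : realType) n (A : 'M[R]_n) u v :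
  `|form A u v| <= (n ^ 2)%:R * `|A| * `|u| * `|v|.
Proof.
rewrite formE; apply: (le_trans (ler_norm_sum _ _ _)).
apply: (@le_trans _ _ (\sum_(i < n) \sum_(j < n) `|A| * `|u| * `|v|)).
  apply: ler_sum => i _; apply: (le_trans (ler_norm_sum _ _ _)); apply: ler_sum => j _.
  rewrite !normrM mulrC mulrA; do 2?[apply: ler_pM => //; rewrite ?mulr_ge0//]; exact: le_mx_norm.
rewrite !sumr_const !card_ord -mulrnA -[leLHS]mulr_natl -!mulrA.
by rewrite lexx.
Qed.

Lemma posdef_near (R : realType) n (C : 'rV[R]_n -> 'M[R]_n) : posdef (C 0) ->
  {for 0, continuous C} ->
  exists2 e, 0 < e & forall w, `|w| < e -> forall X, X != 0 -> 0 < form (C w) X X.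
Proof.
move=> pC /continuous_distP cC; have [c c0 Hc] := posdef_lower pC.
(* A form is bounded by [n ^ 2] times the norm of its matrix; the [+ 1] makes the final inequality
   strict. *)
pose K : R := (n ^ 2)%:R + 1.
have K0 : 0 < K by rewrite ltr_wpDl.
have [e e0 He] := cC (c / K) (divr_gt0 c0 K0).
exists e => // w we X X0.
have := He w; rewrite subr0 => /(_ we) CC.
have nX : 0 < `|X| ^+ 2 by rewrite exprn_gt0// normr_gt0.
have E : form (C w) X X = form (C 0) X X + form (C w - C 0) X X.
  by rewrite -formDm addrC subrK.
have : `|form (C w - C 0) X X| < c * `|X| ^+ 2.
  apply: le_lt_trans (form_norm_le _ _ _) _; rewrite -mulrA -expr2 ltr_pM2r//.
  apply: (@le_lt_trans _ _ ((n ^ 2)%:R * (c / K))); first by rewrite ler_wpM2l// ltW.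
  by rewrite mulrA ltr_pdivrMr// mulrC ltr_pM2l// /K ltrDl.
rewrite ltr_norml E => /andP[h _]; have := Hc X; lra.
Qed.

Section Polar.
Context {R : realType} {n : nat}.
Local Notation Z := (R^o * 'rV[R]_n)%type.

Lemma Ck_on_scale_pair k (U : set Z) : open U -> Ck_on k U (fun z : Z => z.1 *: z.2).
Proof. by move=> oU; apply: Ck_onZ => //; [exact: Ck_on_fst|exact: Ck_on_snd]. Qed.

Lemma is_derive_scale_pair (t : R^o) (v : 'rV[R]_n) (a : R^o) (X : 'rV[R]_n) :
  is_derive ((t, v) : Z) (a, X) (fun z : Z => z.1 *: z.2) (t *: X + a *: v).
Proof.
have d1 : is_derive ((t, v) : Z) (a, X) (fst : Z -> R^o) a.
  apply: (@is_derive_lin_comp _ _ _ _ (fst : Z -> R^o) id _ _ (a, X)) => //.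
  by move=> z; exact: cvg_fst.
have d2 : is_derive ((t, v) : Z) (a, X) (snd : Z -> 'rV[R]_n) X.
  apply: (@is_derive_lin_comp _ _ _ _ (snd : Z -> 'rV[R]_n) id _ _ (a, X)) => //.
  by move=> z; exact: cvg_snd.
exact: (is_deriveZf d1 d2).
Qed.

End Polar.

(** * Growth of the radial metric *)

Section RadialMetric.
Context {R : realType} {n : nat}.
Variables (B : set 'rV[R]_n) (H : 'rV[R]_n -> 'M[R]_n).
Hypotheses (oB : open B) (Hs : smooth_on B H).

Lemma expanding_radius : B 0 -> posdef (H 0) -> exists2 e, 0 < e & forall w, `|w| < e -> B w ->
  forall X, X != 0 -> 0 < 2 * form (H w) X X + form ('D_w H w) X X.
Proof.
move=> B0 [Hsym Hpos].
(* In ['D_w H w] the direction moves with the point. Written with partial derivatives, the term is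
   visibly continuous in [w] and vanishes at 0. *)
pose C w := 2 *: H w + total_derivative H w w.
have C0 : C 0 = 2 *: H 0.
  by rewrite /C /total_derivative big1 ?addr0// => i _; rewrite mxE scale0r.
have Cs : Ck_on 0 B C.
  apply: (Ck_onD oB).
    by apply: (Ck_onZ oB (Ck_on_cst 0 B (2 : R^o))); exact: Hs.
  have ids : smooth_on B (id : 'rV[R]_n -> 'rV[R]_n) by move=> k; exact: Ck_on_id.
  exact: (total_derivative_smooth oB oB Hs ids ids (fun x Bx => Bx) 0%N).
have pC : posdef (C 0).
  rewrite C0; split; first by rewrite linearZ /= Hsym.
  by move=> u u0; rewrite formZm mulr_gt0//; exact: Hpos.
have [e e0 He] := posdef_near pC (Ck_on_continuous Cs B0).
exists e => // w we Bw X X0; have := He w we X X0.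
by rewrite /C formDm formZm -(derive_total oB (Hs 1%N) w Bw).
Qed.

Lemma is_derive_radial_metric v X (t : R) : B (t *: v) ->
  is_derive t 1 (fun s : R => s ^+ 2 * form (H (s *: v)) X X : R^o)
    (t * (2 * form (H (t *: v)) X X + form ('D_(t *: v) H (t *: v)) X X)).
Proof.
move=> Bt.
have D0 : is_derive (t *: v) v (fun y => form (H y) X X : R^o) (form ('D_v H (t *: v)) X X).
  have D := is_derive_form (Ck_is_derive v (Hs 1%N) Bt) (is_derive_cst X _ _) (is_derive_cst X _ _).
  by rewrite /= form0l form0r !addr0 in D.
have D1 : is_derive t 1 (fun s : R => form (H (s *: v)) X X : R^o) (form ('D_v H (t *: v)) X X).
  by move: D0; rewrite -[t *: v]add0r => /is_derive_line; under eq_fun do rewrite add0r.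
have D2 : is_derive t 1 (fun s : R => s ^+ 2 : R^o) (t *: 1 + 1 *: t).
  exact: (is_deriveZf (is_derive_id t (1 : R)) (is_derive_id t (1 : R))).
have := is_deriveZf D2 D1.
have -> : 'D_(t *: v) H (t *: v) = t *: 'D_v H (t *: v).
  by have [_ ->] := is_derive_dirZ t (Ck_is_derive v (Hs 1%N) Bt).
rewrite formZm /GRing.scale/=.
set a := form _ _ _; set b := form _ _ _.
by have -> : t ^+ 2 * a + (t * 1 + 1 * t) * b = t * (2 * b + t * a) by ring.
Qed.

End RadialMetric.

(** The function [form (g p) (c s) (c s)] is constant along a curve [c] of the sphere; its
    derivative is twice the product with the velocity. *)
Lemma sphere_tangent_orthogonal (R : realType) (n : nat) (M : smooth_manifold R n)
    (g : riemannian_metric M) (p : M) (v X : 'rV[R]_n) :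
  tangent_to (unit_sphere g p) v X -> form (g p) v X = 0.
Proof.
move=> [e [c [e0 cs ce c0 c'0]]].
have J0 : (`]- e, e[%classic : set R^o) 0 by rewrite /= in_itv/= oppr_lt0 e0.
have oJ : open (`]- e, e[%classic : set R^o) by exact: interval_open.
have dc : is_derive (0 : R) 1 (c : R -> 'rV[R]_n) X.
  by rewrite -c'0 derive1E; exact: (Ck_is_derive (1 : R^o) (cs 1%N) J0).
have D1 := is_derive_form (is_derive_cst (g p) (0 : R) 1) dc dc.
have D2 : is_derive (0 : R) 1 (fun s : R => form (g p) (c s) (c s) : R^o) 0.
  apply: near_eq_is_derive (is_derive_cst (1 : R^o) (0 : R) 1).
  apply: (open_near oJ J0) => s Js; rewrite -gnorm_sqr (ce s Js) expr1n//.
have := is_derive_unique D1 D2; rewrite c0.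
rewrite form0m (form_sym X v (gram_sym g p)) /= add0r => h; lra.
Qed.

(** The hypothesis on [v] is the conclusion of the Gauss lemma: it moves products with [v] to [A0],
    where [v] is a unit vector orthogonal to [X] and [Y], so the cross terms vanish. *)
Lemma form_polar (R : realType) n (A A0 : 'M[R]_n) (t a b : R) v X Y :
  A^T = A -> (forall u, form A v u = form A0 v u) ->
  form A0 v v = 1 -> form A0 v X = 0 -> form A0 v Y = 0 ->
  form A (t *: X + a *: v) (t *: Y + b *: v) = a * b + t ^+ 2 * form A X Y.
Proof.
move=> As Av vv vX vY; rewrite formDl !formDr !(formZl, formZr) (form_sym X v As) !Av vv vX vY.
ring.
Qed.

Section PolarCoordinates.
Context {R : realType} {n : nat} {M : smooth_manifold R n} (g : riemannian_metric M) (p : M).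
Local Notation i0 := (chart_at M p).
Variables (r : R) (E : 'rV[R]_n -> 'rV[R]_n).
Hypothesis nE : is_normal_chart g p r E.
Local Notation B := [set v : 'rV[R]_n | `|v| < r].
Local Notation F := (normal_exp p E).
Local Notation L := (normal_log p r E).
Local Notation H := (normal_metric g p E).
Local Notation nrm := (gnorm g p).
Local Notation Z := (R^o * 'rV[R]_n)%type.
Let oB : open B. Proof. exact: open_centered_ball. Qed.
Let Es : smooth_on B E. Proof. exact: normal_smooth nE. Qed.
Let Hs : smooth_on B H. Proof. exact: normal_metric_smooth nE. Qed.
Variable d : R.
Hypotheses (d0 : 0 < d) (dB : tangent_ball g p d `<=` B).
Local Notation T := (tangent_ball g p d).
Local Notation S := (unit_sphere g p).

Let oT : open T. Proof. exact: open_tangent_ball. Qed.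

Lemma exp_map_smooth : smooth_to T (exp_map g p).
Proof.
apply: (smooth_to_eq oT _ (normal_exp_smooth nE oT dB)) => v /dB Bv.
by rewrite (exp_map_normal nE).
Qed.

Lemma exp_map_diffeo : diffeo_onto T (exp_map g p) (geodesic_ball g p d).
Proof.
split; first exact: exp_map_smooth.
exists L; rewrite (geodesic_ballE nE dB); split; first exact: (normal_log_smooth nE oT dB).
- move=> v Tv; rewrite (exp_map_normal nE (dB Tv)) (normal_expK nE (dB Tv)); split=> //.
- move=> _ [v Tv <-]; rewrite (normal_expK nE (dB Tv)); split=> //.
  by rewrite (exp_map_normal nE (dB Tv)).
Qed.

(** The open neighbourhood of the product, required by [isometry_onto], on which the polar map is
    scaling followed by the exponential map. *)
Definition polar_domain : set Z := [set z : Z | T (z.1 *: z.2)].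

Lemma open_polar_domain : open polar_domain.
Proof.
apply: (@open_comp _ _ (fun z : Z => z.1 *: z.2) T) => // z _.
exact: (Ck_on_continuous (Ck_on_scale_pair 0 openT) I).
Qed.

Lemma sphere_in_domain (t : R) v : t \in `]0, d[ -> S v -> nrm (t *: v) = t /\ T (t *: v).
Proof.
rewrite in_itv/= => /andP[t0 td] Sv.
have tv : nrm (t *: v) = t by rewrite gnormZ Sv mulr1 gtr0_norm.
by split=> //; rewrite /tangent_ball/= tv.
Qed.

Lemma polar_smooth : smooth_to polar_domain (polar g p).
Proof.
apply: (@smooth_to_comp _ _ _ _ _ _ T (fun z : Z => z.1 *: z.2) (exp_map g p)) => //.
- exact: open_polar_domain.
- move=> k; apply: Ck_on_scale_pair; exact: open_polar_domain.
- exact: exp_map_smooth.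
Qed.

Definition polar_inverse (q : M) : Z := (nrm (L q), (nrm (L q))^-1 *: L q).

Let oT0 : open (T `\ (0 : 'rV[R]_n)).
Proof.
apply: openI => //; apply: closed_openC.
by apply: accessible_closed_set1; apply: hausdorff_accessible; exact: norm_hausdorff.
Qed.

Lemma punctured_ballE : geodesic_ball g p d `\ p = F @` (T `\ (0 : 'rV[R]_n)).
Proof.
rewrite (geodesic_ballE nE dB); apply/seteqP; split=> [q [[v Tv <-] vp]|_ [v [Tv v0] <-]].
  by exists v => //; split=> // v0; apply: vp; rewrite /= v0 (normal_exp0 nE).
split; first by exists v.
move=> /= vp; apply: v0 => /=.
have B0 : B (0 : 'rV[R]_n) by rewrite /= normr0 (normal_radius nE).
have : L (F v) = L (F 0) by rewrite vp (normal_exp0 nE).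
by rewrite (normal_expK nE (dB Tv)) (normal_expK nE B0).
Qed.

Lemma polar_inverse_smooth : smooth_from (geodesic_ball g p d `\ p) polar_inverse.
Proof.
rewrite punctured_ballE => i k.
have TB : T `\ (0 : 'rV[R]_n) `<=` B by move=> v [/dB].
have oF := open_normal_image nE oT0 TB.
have oi : open (chart M i @` (F @` (T `\ (0 : 'rV[R]_n)) `&` chart_dom M i)) by exact: open_chart_image.
have Ln := normal_log_smooth nE oT0 TB i k.
have f0 v : (T `\ (0 : 'rV[R]_n)) v -> 0 < form (g p) v v.
  by move=> [_ v0]; have [_] := gram_posdef g p; apply; apply/eqP.
have idk : Ck_on k (T `\ (0 : 'rV[R]_n)) (fun v : 'rV[R]_n => v) by exact: (Ck_on_id k oT0).
have nk := Ck_on_sqrt oT0 f0 (Ck_on_form oT0 (Ck_on_cst k _ (g p)) idk idk).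
have n0 v : (T `\ (0 : 'rV[R]_n)) v -> Num.sqrt (form (g p) v v) != 0.
  by move=> /f0 fv; rewrite gt_eqF// sqrtr_gt0.
have Qk := Ck_on_pair oT0 nk (Ck_onZ oT0 (Ck_onV oT0 n0 nk) idk).
apply: (Ck_on_comp oi oT0 _ Ln Qk).
move=> _ [_ [[v Tv <-] dv] <-] /=; rewrite chartK// (normal_expK nE)//.
by apply: dB; case: Tv.
Qed.

Lemma polar_pullback (t : R) v (a b : R) X Y : t \in `]0, d[ -> S v ->
  tangent_to S v X -> tangent_to S v Y ->
  pullback_form g (polar g p) ((t, v) : Z) (a, X) (b, Y) = 1 * a * b + t ^+ 2 * form (H (t *: v)) X Y.
Proof.
move=> tI Sv tX tY; have [_ Tt] := sphere_in_domain tI Sv.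
have Bt := dB Tt; have Ozt : polar_domain ((t, v) : Z) by [].
have oO := open_polar_domain.
have PE z : polar_domain z -> polar g p z = F (z.1 *: z.2).
  by move=> /dB Bz; rewrite /polar (exp_map_normal nE Bz).
have cP : {for ((t, v) : Z), continuous (polar g p)} by case: polar_smooth => + _; apply.
have dP c W : is_derive ((t, v) : Z) (c, W) (chart M i0 \o polar g p) ('D_(t *: W + c *: v) E (t *: v)).
  have := is_derive_compD oB (Es 1%N) (is_derive_scale_pair t v c W) Bt.
  apply: near_eq_is_derive; apply: (open_near oO Ozt) => z Oz /=.
  by rewrite PE// (chart_normal_exp nE)//; exact: dB.
have dom : chart_dom M i0 (polar g p ((t, v) : Z)) by rewrite PE//; exact: (normal_exp_dom nE Bt).
rewrite (pullback_form_chart g cP dom (dP a X) (dP b Y)) PE// (chart_normal_exp nE Bt).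
rewrite -(form_normal_metric nE _ _ Bt) mul1r.
have t0 : t != 0 by move: tI; rewrite in_itv/= => /andP[t0 _]; rewrite gt_eqF.
have [Hsym _] := normal_metric_posdef nE Bt.
apply: (form_polar t a b Hsym (A0 := g p)).
- by move=> u; apply: (mulfI t0); have := normal_gauss nE u Bt; rewrite !formZl.
- by rewrite -gnorm_sqr Sv expr1n.
- exact: sphere_tangent_orthogonal.
- exact: sphere_tangent_orthogonal.
Qed.

Definition polar_metric (t : R) (v X Y : 'rV[R]_n) : R := t ^+ 2 * form (H (t *: v)) X Y.

Lemma polar_isometry :
  isometry_onto g `]0, d[ S (fun _ _ => 1) polar_metric (polar g p) (geodesic_ball g p d `\ p).
Proof.
split.
- exists polar_domain; split; [exact: open_polar_domain| |exact: polar_smooth].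
  by move=> [t v] [tI Sv]; exact: (sphere_in_domain tI Sv).2.
- exists polar_inverse; split; first exact: polar_inverse_smooth.
  + move=> [t v] [/= tI Sv]; have [tv Tt] := sphere_in_domain tI Sv.
    have t0 : t != 0 by move: tI; rewrite /= in_itv/= => /andP[t0 _]; rewrite gt_eqF.
    have PE : polar g p ((t, v) : Z) = F (t *: v) by rewrite /polar /= (exp_map_normal nE (dB Tt)).
    have Bp : (geodesic_ball g p d `\ p) (polar g p ((t, v) : Z)).
      rewrite punctured_ballE PE; exists (t *: v) => //; split=> // /= tv0.
      by move: tv; rewrite tv0 gnorm0 => /esym/eqP; rewrite (negbTE t0).
    split; first exact: Bp.
    by rewrite PE /polar_inverse (normal_expK nE (dB Tt)) tv scalerA mulVf// scale1r.
  + move=> q; rewrite punctured_ballE => -[v [Tv v0] <-].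
    have vp : 0 < nrm v.
      rewrite lt_neqAle gnorm_ge0 andbT eq_sym; apply/negP => /eqP /gnorm_eq0; exact: v0.
    rewrite /polar_inverse (normal_expK nE (dB Tv)); split.
      split=> /=; first by rewrite in_itv/= vp.
      by rewrite /unit_sphere/= gnormZ normfV (gtr0_norm vp) mulVf// gt_eqF.
    by rewrite /polar /= scalerA mulfV ?gt_eqF// scale1r (exp_map_normal nE (dB Tv)).
- move=> t v a b X Y tI Sv tX tY; exact: polar_pullback.
Qed.

Lemma polar_expanding :
  (forall w, T w -> forall X, X != 0 -> 0 < 2 * form (H w) X X + form ('D_w H w) X X) ->
  expanding_throughout_dt `]0, d[ S (fun _ _ => 1) polar_metric.
Proof.
move=> Tpos; split.
- split=> // z _; exists setT, (fun=> 1); split=> //; first exact: openT.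
  by move=> k; exact: Ck_on_cst.
- split.
  + exists (fun z : Z => z.1 ^+ 2 *: H (z.1 *: z.2)); split.
      move=> z [zI Sz]; exists polar_domain, (fun z : Z => z.1 ^+ 2 *: H (z.1 *: z.2)); split=> //.
      * exact: open_polar_domain.
      * exact: (sphere_in_domain zI Sz).2.
      * move=> k; have oO := open_polar_domain; have f1 := @Ck_on_fst R R^o 'rV[R]_n k _ oO.
        apply: (Ck_onZ oO (Ck_onM oO f1 f1)).
        have DB z' : polar_domain z' -> B (z'.1 *: z'.2) by move=> /dB.
        exact: (Ck_on_comp oO oB DB (Ck_on_scale_pair k oO) (Hs k)).
    by move=> t v X Y _ _ _ _; rewrite formZm.
  + move=> t v X Y tI Sv _ _; have [_ Tt] := sphere_in_domain tI Sv.
    have [Hsym _] := normal_metric_posdef nE (dB Tt).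
    by rewrite /polar_metric (form_sym X Y Hsym).
  + move=> t v X tI Sv _ X0; have [_ Tt] := sphere_in_domain tI Sv.
    have [_ Hpos] := normal_metric_posdef nE (dB Tt).
    move: tI; rewrite /= in_itv/= => /andP[t0 _].
    by rewrite /polar_metric mulr_gt0 ?exprn_gt0//; exact: Hpos.
- by move=> t v _ _; rewrite derive1_cst.
- move=> t v X tI Sv _ X0; have [_ Tt] := sphere_in_domain tI Sv.
  have [_ DE] := is_derive_radial_metric Hs X (dB Tt).
  rewrite derive1E /polar_metric DE mulr_gt0//; last exact: Tpos.
  by move: tI; rewrite /= in_itv/= => /andP[].
Qed.

End PolarCoordinates.

Theorem proposition30 (R : realType) (n : nat) (n_ge2 : (2 <= n)%N)
    (M : smooth_manifold R n) (g : riemannian_metric M) (p : M) :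
  exists2 d : R, 0 < d & expanding_throughout_radial g p d.
Proof.
have [r [E nE]] := normal_chart_ex g p.
have r0 := normal_radius nE.
have B0 : [set v : 'rV[R]_n | `|v| < r] 0 by rewrite /= normr0.
have [e e0 He] := expanding_radius (@open_centered_ball R 'rV[R]_n r) (normal_metric_smooth nE) B0
  (normal_metric_posdef nE B0).
have m0 : 0 < Num.min r e by rewrite lt_min r0.
(* In the sup norm, [r] is the range of the normal chart and [e] that of the positivity of the
   radial derivative; the common radius is converted to [gnorm g p]. *)
have [d d0 dm] := tangent_ball_sub g p m0.
have dB : tangent_ball g p d `<=` [set v | `|v| < r].
  by move=> v /dm /=; rewrite lt_min => /andP[].
exists d => //; split.
- by move=> v /dB Bv; rewrite (exp_map_normal nE Bv); exact: (exp_rel_normal nE Bv).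
- exact: (exp_map_diffeo nE dB).
- exists (polar_metric g p E); split; first exact: (polar_isometry nE dB).
  apply: (polar_expanding nE dB) => w Tw; apply: He; last exact: dB.
  by have := dm _ Tw; rewrite /= lt_min => /andP[].
Qed.
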